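(* Let $S$ be a finite dimensional $\Bbbk$-algebra, $M$ a finite dimensional $S$-bimodule, and $R\subseteq M\otimes_S M$ a sub-$S$-bimodule such that $B=T_S(M)/(R)$ is a generalized Koszul algebra. Assume that the projective dimension of the graded right $B$-module $S_B$ is $2$. Let $\theta:R\to S$ be a $\Bbbk$-linear map and let $U=T_S(M)/(r-\theta(r): r\in R)$, equipped with its natural ascending filtration. Then $U$ is a PBW deformation of $B$ if and only if $\theta$ is an $S$-bimodule morphism.
   Context: $\Bbbk$ is a fixed field; all vector spaces, algebras and modules are over $\Bbbk$. $T_S(M)=S\oplus M\oplus (M\otimes_S M)\oplus\cdots$ is the tensor algebra of the bimodule $M$ over $S$, graded by tensor degree, and $(R)$ is the two-sided ideal generated by $R$; so $B$ is graded with $B_0=S$, $B_1=M$. $S_B=B/B_{\ge 1}$ is $B_0$ viewed as a graded right $B$-module. Generalized Koszul algebra: a positively graded algebra $B=\bigoplus_{i\ge0}B_i$ with $\dim_\Bbbk B_i<\infty$ for all $i$ and $S=B_0$ (not necessarily semisimple) such that every $B_i$ ($i\ge1$) is projective both as a left and as a right $S$-module, and the graded right $B$-module $B_0$ has a graded projective resolution $\cdots\to P^{-n}\to\cdots\to P^{-1}\to P^0\to B_0\to0$ with $P^{-n}$ generated in degree $n$ for all $n\ge0$. Natural filtration: with $p:T_S(M)\to U$ the projection, $F_iU=p(S\oplus M\oplus\cdots\oplus M^{\otimes_S i})$ for $i\ge0$ and $F_{-1}U=0$. $U$ with this filtration is a PBW deformation of $B$ if the associated graded algebra $gr(U)=\bigoplus_{i\ge0}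 F_iU/F_{i-1}U$ is isomorphic to $B$ as a graded algebra. *)

(* Defs.v *)
From HB Require Import structures.
Set Warnings "-notation-overridden,-ambiguous-paths,-redundant-canonical-projection,-projection-no-head-constant".
From mathcomp Require Import all_boot all_order all_algebra.
From mathcomp Require Import boolp.

Set Implicit Arguments.
Unset Strict Implicit.
Unset Printing Implicit Defensive.

Import GRing.Theory.
Local Open Scope ring_scope.

(* [algType K] excludes the zero ring, but a deformation may collapse to it;  *)
(* hence this variant of [algType] over rings in which 1 = 0 is allowed.      *)
Record kalgebra (K : fieldType) := KAlgebra {
  kring : pzRingType;
  kscale : K -> kring -> kring;
  kscaleA : forall k l x, kscale k (kscale l x) = kscale (k * l) x;
  kscale1 : forall x, kscale 1 x = x;
  kscaleDr : forall k x y, kscale k (x + y) = kscale k x + kscale k y;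
  kscaleDl : forall x k l, kscale (k + l) x = kscale k x + kscale l x;
  kscaleMl : forall k x y, kscale k (x * y) = kscale k x * y;
  kscaleMr : forall k x y, kscale k (x * y) = x * kscale k y
}.

Definition kcar (K : fieldType) (A : kalgebra K) : Type := kring A.
Coercion kcar : kalgebra >-> Sortclass.

HB.instance Definition _ (K : fieldType) (A : kalgebra K) :=
  GRing.PzRing.copy (kcar A) (kring A).
HB.instance Definition _ (K : fieldType) (A : kalgebra K) :=
  GRing.Zmodule_isLmodule.Build K (kcar A)
    (@kscaleA K A) (@kscale1 K A) (@kscaleDr K A) (@kscaleDl K A).

Section KAlgebraTheory.
Variables (K : fieldType) (A : kalgebra K).
Implicit Types (k : K) (x y : A).

Lemma kscalerAl k x y : k *: (x * y) = (k *: x) * y.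
Proof. exact: kscaleMl. Qed.

Lemma kscalerAr k x y : k *: (x * y) = x * (k *: y).
Proof. exact: kscaleMr. Qed.

End KAlgebraTheory.

Definition fin_dim (K : fieldType) (V : lmodType K) (D : {pred V}) : Prop :=
  exists n (v : 'I_n -> V), (forall i, v i \in D) /\
    forall x, x \in D -> exists c : 'I_n -> K, x = \sum_(i < n) c i *: v i.

(* The left and right actions of S on M are s *>> m and m <<* s; the axioms   *)
(* force the two induced actions of K to agree with the scaling of M.         *)
Reserved Notation "s *>> m" (at level 40, left associativity).
Reserved Notation "m <<* s" (at level 40, left associativity).

HB.mixin Record Lmodule_isBimodule (K : fieldType) (S : kalgebra K) M
    of GRing.Lmodule K M := {
  lact : S -> M -> M;
  ract : M -> S -> M;
  lactDl : forall s t m, lact (s + t) m = lact s m + lact t m;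
  lactDr : forall s m n, lact s (m + n) = lact s m + lact s n;
  lactZl : forall (k : K) s m, lact (k *: s) m = k *: lact s m;
  lact1 : forall m, lact 1 m = m;
  lactA : forall s t m, lact (s * t) m = lact s (lact t m);
  ractDl : forall m n s, ract (m + n) s = ract m s + ract n s;
  ractDr : forall m s t, ract m (s + t) = ract m s + ract m t;
  ractZr : forall (k : K) m s, ract m (k *: s) = k *: ract m s;
  ract1 : forall m, ract m 1 = m;
  ractA : forall m s t, ract m (s * t) = ract (ract m s) t;
  lractA : forall s m t, ract (lact s m) t = lact s (ract m t)
}.

#[short(type="bimodType")]
HB.structure Definition Bimodule (K : fieldType) (S : kalgebra K) :=
  {M of GRing.Lmodule K M & Lmodule_isBimodule K S M}.

Notation "s *>> m" := (lact s m) : ring_scope.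
Notation "m <<* s" := (ract m s) : ring_scope.

Section BimoduleTheory.
Variables (K : fieldType) (S : kalgebra K) (M : bimodType S).
Implicit Types (s t : S) (m n : M) (k : K).

Lemma lactZr k s m : s *>> (k *: m) = k *: (s *>> m).
Proof.
have -> : k *: m = (k *: (1 : S)) *>> m by rewrite lactZl lact1.
by rewrite -lactA -kscalerAr mulr1 lactZl.
Qed.

Lemma ractZl k s m : (k *: m) <<* s = k *: (m <<* s).
Proof.
have -> : k *: m = m <<* (k *: (1 : S)) by rewrite ractZr ract1.
by rewrite -ractA -kscalerAl mul1r ractZr.
Qed.

Lemma lact0 s : s *>> (0 : M) = 0.
Proof. by apply: (addrI (s *>> (0 : M))); rewrite -lactDr !addr0. Qed.

Lemma lact0l m : (0 : S) *>> m = 0.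
Proof. by apply: (addrI ((0 : S) *>> m)); rewrite -lactDl !addr0. Qed.

Lemma ract0 s : (0 : M) <<* s = 0.
Proof. by apply: (addrI ((0 : M) <<* s)); rewrite -ractDl !addr0. Qed.

Lemma ract0r m : m <<* (0 : S) = 0.
Proof. by apply: (addrI (m <<* (0 : S))); rewrite -ractDr !addr0. Qed.

End BimoduleTheory.

Definition regular_bimod (K : fieldType) (S : kalgebra K) : Type := S.

Section RegularBimodule.
Variables (K : fieldType) (S : kalgebra K).
Notation B := (regular_bimod S).
HB.instance Definition _ := GRing.Lmodule.on B.
HB.instance Definition _ := Lmodule_isBimodule.Build K S B
  (@mulrDl S) (@mulrDr S) (fun k s (m : S) => esym (kscalerAl k s m))
  (@mul1r S) (fun s t m => esym (mulrA s t m))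
  (@mulrDl S) (@mulrDr S) (fun k (m : S) s => esym (kscalerAr k m s))
  (@mulr1 S) (@mulrA S) (fun s m t => esym (mulrA s m t)).
End RegularBimodule.

(* Elements of the tensor product are formal sums of pairs (m, n), written    *)
(* as sequences, up to the congruence generated by the usual relations.       *)
Section Tensor.
Variables (K : fieldType) (S : kalgebra K) (M N : bimodType S).
Implicit Types (x y z : seq (M * N)) (s : S) (k : K).

Inductive tensor_rel : seq (M * N) -> seq (M * N) -> Prop :=
| TRrefl x : tensor_rel x x
| TRsym x y : tensor_rel x y -> tensor_rel y x
| TRtrans x y z : tensor_rel x y -> tensor_rel y z -> tensor_rel x z
| TRcat x x' y y' :
    tensor_rel x x' -> tensor_rel y y' -> tensor_rel (x ++ y) (x' ++ y')
| TRcomm x y : tensor_rel (x ++ y) (y ++ x)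
| TR0l n : tensor_rel [:: (0, n)] [::]
| TR0r m : tensor_rel [:: (m, 0)] [::]
| TRDl m m' n : tensor_rel [:: (m + m', n)] [:: (m, n); (m', n)]
| TRDr m n n' : tensor_rel [:: (m, n + n')] [:: (m, n); (m, n')]
| TRbal m s n : tensor_rel [:: (m <<* s, n)] [:: (m, s *>> n)].

Definition tensor_eqv x y : bool := `[< tensor_rel x y >].

Lemma tensor_eqv_is_equiv : equiv_class_of tensor_eqv.
Proof.
split=> [x|x y|y x z]; first exact/asboolP/TRrefl.
  by apply/asboolP/asboolP; apply: TRsym.
by move=> /asboolP xy /asboolP yz; apply/asboolP; apply: TRtrans yz.
Qed.

Canonical tensor_equiv := EquivRelPack tensor_eqv_is_equiv.

Definition tensor : Type := {eq_quot tensor_equiv}%qT.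

HB.instance Definition _ := Choice.on tensor.

Definition tclass x : tensor := (\pi_{eq_quot tensor_equiv} x)%qT.
Definition trepr (u : tensor) : seq (M * N) :=
  repr (u : {eq_quot tensor_equiv}%qT).

Definition tens m n : tensor := tclass [:: (m, n)].

Lemma treprK u : tclass (trepr u) = u. Proof. exact: reprK. Qed.

Lemma tclassP x y : tensor_rel x y <-> tclass x = tclass y.
Proof.
by split=> [xy|/eqmodP/asboolP//]; apply/eqmodP/asboolP.
Qed.

Lemma trepr_rel x : tensor_rel (trepr (tclass x)) x.
Proof. by apply/tclassP; rewrite treprK. Qed.

Definition tmap (f : M * N -> M * N) (u : tensor) : tensor :=
  tclass (map f (trepr u)).

Definition tmorph (f : M * N -> M * N) : Prop :=
  forall x y, tensor_rel x y -> tensor_rel (map f x) (map f y).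

Lemma tmapE f x : tmorph f -> tmap f (tclass x) = tclass (map f x).
Proof. by move=> fP; apply/tclassP/fP/trepr_rel. Qed.

Lemma tmorph_pair (f : M -> M) (g : N -> N) :
  {morph f : m n / m + n} -> {morph g : m n / m + n} ->
  (forall m s n, tensor_rel [:: (f (m <<* s), g n)] [:: (f m, g (s *>> n))]) ->
  tmorph (fun p => (f p.1, g p.2)).
Proof.
move=> fD gD fg x y; elim=> {x y} //=.
- by move=> x; apply: TRrefl.
- by move=> x y _; apply: TRsym.
- by move=> x y z _ xy _; apply: TRtrans.
- by move=> x x' y y' _ xx' _ yy'; rewrite !map_cat; apply: TRcat.
- by move=> x y; rewrite !map_cat; apply: TRcomm.
- move=> n; suff -> : f 0 = 0 by apply: TR0l.
  by apply: (addrI (f 0)); rewrite -fD !addr0.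
- move=> m; suff -> : g 0 = 0 by apply: TR0r.
  by apply: (addrI (g 0)); rewrite -gD !addr0.
- by move=> m m' n; rewrite fD; apply: TRDl.
- by move=> m n n'; rewrite gD; apply: TRDr.
Qed.

Definition topp_pair (p : M * N) := (- p.1, id p.2).
Definition tscale_pair k (p : M * N) := (k *: p.1, id p.2).
Definition tlact_pair s (p : M * N) := (s *>> p.1, id p.2).
Definition tract_pair s (p : M * N) := (id p.1, p.2 <<* s).

Lemma topp_morph : tmorph topp_pair.
Proof.
apply: tmorph_pair => // [m n|m s n]; first exact: opprD.
suff -> : - (m <<* s) = (- m) <<* s by apply: TRbal.
by rewrite -!scaleN1r ractZl.
Qed.

Lemma tscale_morph k : tmorph (tscale_pair k).
Proof.
apply: tmorph_pair => // [m n|m s n]; first exact: scalerDr.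
by rewrite -ractZl; apply: TRbal.
Qed.

Lemma tlact_morph s : tmorph (tlact_pair s).
Proof.
apply: tmorph_pair => // [m n|m t n]; first exact: lactDr.
by rewrite -lractA; apply: TRbal.
Qed.

Lemma tract_morph s : tmorph (tract_pair s).
Proof.
apply: (@tmorph_pair id (fun n => n <<* s)) => // [m n|m t n] /=.
  exact: ractDl.
by rewrite lractA; apply: TRbal.
Qed.

Definition tadd (u v : tensor) := tclass (trepr u ++ trepr v).
Definition topp := tmap topp_pair.
Definition tscale k := tmap (tscale_pair k).
Definition tlact s := tmap (tlact_pair s).
Definition tract u s := tmap (tract_pair s) u.

Lemma taddE x y : tadd (tclass x) (tclass y) = tclass (x ++ y).
Proof. by apply/tclassP/TRcat; apply: trepr_rel. Qed.

Lemma taddA : associative tadd.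
Proof.
by move=> u v w; rewrite -[u]treprK -[v]treprK -[w]treprK !taddE catA.
Qed.

Lemma taddC : commutative tadd.
Proof. by move=> u v; apply/tclassP/TRcomm. Qed.

Lemma tadd0 : left_id (tclass [::]) tadd.
Proof. by move=> u; rewrite -[u]treprK taddE. Qed.

Lemma taddN : left_inverse (tclass [::]) topp tadd.
Proof.
move=> u; rewrite -[u]treprK /topp (tmapE _ topp_morph) taddE.
elim: (trepr u) => [//|[m n] x IH].
rewrite -[map _ _]/([:: (- m, n)] ++ map topp_pair x).
rewrite -[_ :: x]/([:: (m, n)] ++ x) -!taddE.
rewrite -taddA [X in tadd _ X]taddA [X in tadd _ (tadd X _)]taddC !taddA.
rewrite -taddA [X in tadd _ X]taddE IH taddC tadd0 taddE.
apply/tclassP; apply: TRtrans (TR0l n).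
by apply: TRsym; rewrite -(addNr m); apply: TRDl.
Qed.

HB.instance Definition _ :=
  GRing.isZmodule.Build tensor taddA taddC tadd0 taddN.

Lemma tclass_nil : tclass [::] = 0. Proof. by []. Qed.

Lemma tclass_cat x y : tclass (x ++ y) = tclass x + tclass y.
Proof. by rewrite -taddE. Qed.

Lemma tclass_cons m n x : tclass ((m, n) :: x) = tens m n + tclass x.
Proof. by rewrite -tclass_cat. Qed.

Lemma tensor_ind (P : tensor -> Prop) :
  P 0 -> (forall m n u, P u -> P (tens m n + u)) -> forall u, P u.
Proof.
move=> P0 PD u; rewrite -[u]treprK; elim: (trepr u) => [//|[m n] x IH].
by rewrite tclass_cons; apply: PD.
Qed.

Lemma tensDl m m' n : tens (m + m') n = tens m n + tens m' n.
Proof. by rewrite /tens -tclass_cat; apply/tclassP/TRDl. Qed.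

Lemma tensDr m n n' : tens m (n + n') = tens m n + tens m n'.
Proof. by rewrite /tens -tclass_cat; apply/tclassP/TRDr. Qed.

Lemma tens_bal m s n : tens (m <<* s) n = tens m (s *>> n).
Proof. exact/tclassP/TRbal. Qed.

Lemma tens0l n : tens 0 n = 0. Proof. exact/tclassP/TR0l. Qed.
Lemma tens0r m : tens m 0 = 0. Proof. exact/tclassP/TR0r. Qed.

Lemma tmapD f : tmorph f -> {morph tmap f : u v / u + v}.
Proof.
move=> fP u v; rewrite -[u]treprK -[v]treprK -tclass_cat !(tmapE _ fP).
by rewrite map_cat tclass_cat.
Qed.

Lemma tmap0 f : tmorph f -> tmap f 0 = 0.
Proof. by move=> fP; rewrite -tclass_nil (tmapE _ fP). Qed.

Lemma tmap_tens f m n : tmorph f -> tmap f (tens m n) = tens (f (m, n)).1 (f (m, n)).2.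
Proof. by move=> fP; rewrite tmapE //= /tens; case: (f _). Qed.

Lemma tscaleD k : {morph tscale k : u v / u + v}.
Proof. exact/tmapD/tscale_morph. Qed.
Lemma tscale0 k : tscale k 0 = 0. Proof. exact/tmap0/tscale_morph. Qed.
Lemma tscale_tens k m n : tscale k (tens m n) = tens (k *: m) n.
Proof. exact/tmap_tens/tscale_morph. Qed.
Lemma tlactD s : {morph tlact s : u v / u + v}.
Proof. exact/tmapD/tlact_morph. Qed.
Lemma tlact0 s : tlact s 0 = 0. Proof. exact/tmap0/tlact_morph. Qed.
Lemma tlact_tens s m n : tlact s (tens m n) = tens (s *>> m) n.
Proof. exact/tmap_tens/tlact_morph. Qed.
Lemma tractD s : {morph tract^~ s : u v / u + v}.
Proof. exact/tmapD/tract_morph. Qed.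
Lemma tract0 s : tract 0 s = 0. Proof. exact/tmap0/tract_morph. Qed.
Lemma tract_tens s m n : tract (tens m n) s = tens m (n <<* s).
Proof. exact/tmap_tens/tract_morph. Qed.

Lemma tscaleA k l u : tscale k (tscale l u) = tscale (k * l) u.
Proof.
elim/tensor_ind: u => [|m n u IH]; first by rewrite !tscale0.
by rewrite !tscaleD IH !tscale_tens scalerA.
Qed.

Lemma tscale1 : left_id 1 tscale.
Proof.
elim/tensor_ind=> [|m n u IH]; first by rewrite tscale0.
by rewrite tscaleD IH tscale_tens scale1r.
Qed.

Lemma tscaleDl u : {morph tscale^~ u : k l / k + l}.
Proof.
move=> k l /=; elim/tensor_ind: u => [|m n u IH].
  by rewrite !tscale0 addr0.
by rewrite !tscaleD IH !tscale_tens scalerDl tensDl addrACA.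
Qed.

HB.instance Definition _ := GRing.Zmodule_isLmodule.Build K tensor
  tscaleA tscale1 tscaleD tscaleDl.

Lemma scale_tens k m n : k *: tens m n = tens (k *: m) n.
Proof. exact: tscale_tens. Qed.

Lemma tlactDl s t u : tlact (s + t) u = tlact s u + tlact t u.
Proof.
elim/tensor_ind: u => [|m n u IH]; first by rewrite !tlact0 addr0.
by rewrite !tlactD IH !tlact_tens lactDl tensDl addrACA.
Qed.

Lemma tlactZl k s u : tlact (k *: s) u = k *: tlact s u.
Proof.
elim/tensor_ind: u => [|m n u IH]; first by rewrite !tlact0 scaler0.
by rewrite !tlactD IH !tlact_tens scalerDr scale_tens lactZl.
Qed.

Lemma tlact1 u : tlact 1 u = u.
Proof.
elim/tensor_ind: u => [|m n u IH]; first by rewrite tlact0.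
by rewrite tlactD IH tlact_tens lact1.
Qed.

Lemma tlactA s t u : tlact (s * t) u = tlact s (tlact t u).
Proof.
elim/tensor_ind: u => [|m n u IH]; first by rewrite !tlact0.
by rewrite !tlactD IH !tlact_tens lactA.
Qed.

Lemma tractDr u s t : tract u (s + t) = tract u s + tract u t.
Proof.
elim/tensor_ind: u => [|m n u IH]; first by rewrite !tract0 addr0.
by rewrite !tractD IH !tract_tens ractDr tensDr addrACA.
Qed.

Lemma tens_scale k m n : tens m (k *: n) = k *: tens m n.
Proof.
have -> : k *: n = (k *: (1 : S)) *>> n by rewrite lactZl lact1.
by rewrite -tens_bal ractZr ract1 scale_tens.
Qed.

Lemma tractZr k u s : tract u (k *: s) = k *: tract u s.
Proof.
elim/tensor_ind: u => [|m n u IH]; first by rewrite !tract0 scaler0.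
by rewrite !tractD IH !tract_tens scalerDr ractZr tens_scale.
Qed.

Lemma tract1 u : tract u 1 = u.
Proof.
elim/tensor_ind: u => [|m n u IH]; first by rewrite tract0.
by rewrite tractD IH tract_tens ract1.
Qed.

Lemma tractA u s t : tract u (s * t) = tract (tract u s) t.
Proof.
elim/tensor_ind: u => [|m n u IH]; first by rewrite !tract0.
by rewrite !tractD IH !tract_tens ractA.
Qed.

Lemma tlractA s u t : tract (tlact s u) t = tlact s (tract u t).
Proof.
elim/tensor_ind: u => [|m n u IH]; first by rewrite tlact0 tract0 tlact0.
by rewrite !(tlactD, tractD) IH !(tlact_tens, tract_tens).
Qed.

HB.instance Definition _ := Lmodule_isBimodule.Build K S tensor
  tlactDl tlactD tlactZl tlact1 tlactA
  (fun u v s => tractD s u v) tractDr tractZr tract1 tractA tlractA.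

(* The additive map on the tensor product induced by b, meaningful only when  *)
(* b is biadditive and S-balanced (lemma tliftE).                             *)
Definition tlift (V : zmodType) (b : M -> N -> V) (u : tensor) : V :=
  \sum_(p <- trepr u) b p.1 p.2.

Section Lift.
Variables (V : zmodType) (b : M -> N -> V).
Hypothesis bDl : forall m m' n, b (m + m') n = b m n + b m' n.
Hypothesis bDr : forall m n n', b m (n + n') = b m n + b m n'.
Hypothesis b_bal : forall m s n, b (m <<* s) n = b m (s *>> n).

Lemma tlift_class x : tlift b (tclass x) = \sum_(p <- x) b p.1 p.2.
Proof.
rewrite /tlift; have := trepr_rel x; move: (trepr _) => y; elim=> {x y} //=.
- by move=> x y z _ -> _ ->.
- by move=> x x' y y' _ xx' _ yy'; rewrite !big_cat /= xx' yy'.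
- by move=> x y; rewrite !big_cat /= addrC.
- move=> n; rewrite big_seq1 big_nil /=.
  by apply: (addrI (b 0 n)); rewrite -bDl !addr0.
- move=> m; rewrite big_seq1 big_nil /=.
  by apply: (addrI (b m 0)); rewrite -bDr !addr0.
- by move=> m m' n; rewrite !big_cons !big_nil !addr0 /= bDl.
- by move=> m n n'; rewrite !big_cons !big_nil !addr0 /= bDr.
- by move=> m s n; rewrite !big_cons !big_nil !addr0 /= b_bal.
Qed.

Lemma tliftD : {morph tlift b : u v / u + v}.
Proof.
move=> u v; rewrite -[u]treprK -[v]treprK -tclass_cat !tlift_class.
by rewrite big_cat.
Qed.

Lemma tliftE m n : tlift b (tens m n) = b m n.
Proof. by rewrite tlift_class big_seq1. Qed.

Lemma tlift0 : tlift b 0 = 0.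
Proof. by rewrite -tclass_nil tlift_class big_nil. Qed.

End Lift.
End Tensor.

Section DirectSum.
Variables (K : fieldType) (E : nat -> lmodType K).

Record dsum := DSum {
  dval :> forall n, E n;
  dval_fin : exists N, forall n, (N <= n)%N -> dval n = 0
}.

HB.instance Definition _ := gen_eqMixin dsum.
HB.instance Definition _ := gen_choiceMixin dsum.

Implicit Types (f g h : dsum) (k : K).

Lemma dsumP f g : (forall n, f n = g n) -> f = g.
Proof.
case: f g => [f fP] [g gP] /= fg; have {}fg : f = g by apply: functional_extensionality_dep.
by case: g / fg gP => gP; congr DSum; apply: Prop_irrelevance.
Qed.

Definition dbound f : nat := projT1 (cid (dval_fin f)).

Lemma dboundP f n : (dbound f <= n)%N -> f n = 0.
Proof. exact: (projT2 (cid (dval_fin f))). Qed.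

Fact dzero_fin : exists N, forall n, (N <= n)%N -> (fun=> 0 : E n) n = 0.
Proof. by exists 0. Qed.
Definition dzero := DSum dzero_fin.

Fact dopp_fin f : exists N, forall n, (N <= n)%N -> - f n = 0.
Proof. by exists (dbound f) => n /dboundP->; rewrite oppr0. Qed.
Definition dopp f := DSum (dopp_fin f).

Fact dadd_fin f g : exists N, forall n, (N <= n)%N -> f n + g n = 0.
Proof.
exists (maxn (dbound f) (dbound g)) => n; rewrite geq_max => /andP[fn gn].
by rewrite !dboundP // addr0.
Qed.
Definition dadd f g := DSum (dadd_fin f g).

Fact dscale_fin k f : exists N, forall n, (N <= n)%N -> k *: f n = 0.
Proof. by exists (dbound f) => n /dboundP->; rewrite scaler0. Qed.
Definition dscale k f := DSum (dscale_fin k f).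

Fact daddA : associative dadd.
Proof. by move=> f g h; apply: dsumP => n /=; rewrite addrA. Qed.
Fact daddC : commutative dadd.
Proof. by move=> f g; apply: dsumP => n /=; rewrite addrC. Qed.
Fact dadd0 : left_id dzero dadd.
Proof. by move=> f; apply: dsumP => n /=; rewrite add0r. Qed.
Fact daddN : left_inverse dzero dopp dadd.
Proof. by move=> f; apply: dsumP => n /=; rewrite addNr. Qed.

HB.instance Definition _ := GRing.isZmodule.Build dsum daddA daddC dadd0 daddN.

Fact dscaleA k l f : dscale k (dscale l f) = dscale (k * l) f.
Proof. by apply: dsumP => n /=; rewrite scalerA. Qed.
Fact dscale1 : left_id 1 dscale.
Proof. by move=> f; apply: dsumP => n /=; rewrite scale1r. Qed.
Fact dscaleDr : right_distributive dscale +%R.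
Proof. by move=> k f g; apply: dsumP => n /=; rewrite scalerDr. Qed.
Fact dscaleDl f : {morph dscale^~ f : k l / k + l}.
Proof. by move=> k l; apply: dsumP => n /=; rewrite scalerDl. Qed.

HB.instance Definition _ := GRing.Zmodule_isLmodule.Build K dsum
  dscaleA dscale1 dscaleDr dscaleDl.

Definition dincl_fun n (x : E n) m : E m :=
  match n =P m with ReflectT e => ecast i (E i) e x | ReflectF _ => 0 end.

Fact dincl_fin n (x : E n) :
  exists N, forall m, (N <= m)%N -> dincl_fun x m = 0.
Proof.
exists n.+1 => m nm; rewrite /dincl_fun.
by case: eqP => // e; rewrite e ltnn in nm.
Qed.

Definition dincl n (x : E n) := DSum (dincl_fin x).

Lemma dincl_id n (x : E n) : dincl x n = x.
Proof. by rewrite /= /dincl_fun; case: eqP => // e; rewrite eq_axiomK. Qed.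

Lemma dincl_neq n (x : E n) m : n != m -> dincl x m = 0.
Proof. by rewrite /= /dincl_fun; case: eqP. Qed.

Lemma dinclP n (x : E n) f :
  f n = x -> (forall m, n != m -> f m = 0) -> dincl x = f.
Proof.
move=> fn f0; apply: dsumP => m; have [<-|nm] := eqVneq n m.
  by rewrite dincl_id.
by rewrite dincl_neq // f0.
Qed.

Lemma dincl0 n : dincl (0 : E n) = 0.
Proof. exact: dinclP. Qed.

Lemma dinclD n (x y : E n) : dincl (x + y) = dincl x + dincl y.
Proof.
apply: dinclP => [|m nm]; first by rewrite -[LHS]/(dincl x n + dincl y n) !dincl_id.
by rewrite -[LHS]/(dincl x m + dincl y m) !dincl_neq // addr0.
Qed.

Lemma dinclZ n k (x : E n) : dincl (k *: x) = k *: dincl x.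
Proof.
apply: dinclP => [|m nm]; first by rewrite -[LHS]/(k *: dincl x n) dincl_id.
by rewrite -[LHS]/(k *: dincl x m) dincl_neq // scaler0.
Qed.

Lemma dsum_apply I (r : seq I) (F : I -> dsum) n :
  (\sum_(i <- r) F i) n = \sum_(i <- r) F i n.
Proof. by elim: r => [|i r IH]; rewrite ?big_nil // !big_cons -IH. Qed.

Lemma dsum_decomp f N : (forall n, (N <= n)%N -> f n = 0) ->
  f = \sum_(0 <= i < N) dincl (f i).
Proof.
move=> fN; apply: dsumP => n; rewrite dsum_apply.
have [nN|Nn] := ltnP n N; last first.
  rewrite fN // big_nat big1 // => i /andP[_ iN].
  by rewrite dincl_neq // neq_ltn (leq_trans iN Nn).
rewrite (bigD1_seq n) ?mem_index_iota ?iota_uniq //= big1 => [|i ni].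
  by rewrite addr0 -[RHS]/(dincl (f n) n) dincl_id.
exact: dincl_neq.
Qed.

Lemma dsum_ind (P : dsum -> Prop) : P 0 ->
  (forall n (x : E n) f, P f -> P (dincl x + f)) -> forall f, P f.
Proof.
move=> P0 PD f; rewrite (dsum_decomp (@dboundP f)); move: (dbound f) => N.
by elim/big_rec: _ => // i g _ Pg; apply: PD.
Qed.

(* A graded multiplication on E: products of homogeneous elements, with the   *)
(* ring axioms stated in the direct sum to avoid casting along addnA & co.    *)
Record graded_mul := GradedMul {
  gop : forall i j, E i -> E j -> E (i + j)%N;
  gone : E 0%N;
  gopDl : forall i j (x x' : E i) (y : E j), gop (x + x') y = gop x y + gop x' y;
  gopDr : forall i j (x : E i) (y y' : E j), gop x (y + y') = gop x y + gop x y';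
  gopZl : forall i j k (x : E i) (y : E j), gop (k *: x) y = k *: gop x y;
  gopZr : forall i j k (x : E i) (y : E j), gop x (k *: y) = k *: gop x y;
  gopA : forall i j l (x : E i) (y : E j) (z : E l),
    dincl (gop x (gop y z)) = dincl (gop (gop x y) z);
  gop1l : forall i (x : E i), dincl (gop gone x) = dincl x;
  gop1r : forall i (x : E i), dincl (gop x gone) = dincl x
}.

End DirectSum.

Definition graded_sum (K : fieldType) (E : nat -> lmodType K)
  (m : graded_mul E) : Type := dsum E.

Section GradedSum.
Variables (K : fieldType) (E : nat -> lmodType K) (m : graded_mul E).
Notation A := (graded_sum m).
HB.instance Definition _ := GRing.Lmodule.on A.
Implicit Types (f g h : A) (k : K).

Definition gmul f g : A :=
  \sum_(0 <= i < dbound f) \sum_(0 <= j < dbound g)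
    dincl (gop m (f i) (g j)).
Definition gunit : A := dincl (gone m).

Lemma gop0l i j (y : E j) : gop m (0 : E i) y = 0.
Proof. by rewrite -(scale0r (0 : E i)) gopZl scale0r. Qed.

Lemma gop0r i j (x : E i) : gop m x (0 : E j) = 0.
Proof. by rewrite -(scale0r (0 : E j)) gopZr scale0r. Qed.

Lemma big_nat_widen0 (V : zmodType) (F : nat -> V) N N' :
  (forall i, (N <= i)%N -> F i = 0) -> (N <= N')%N ->
  \sum_(0 <= i < N) F i = \sum_(0 <= i < N') F i.
Proof.
move=> F0 NN'; rewrite (@big_cat_nat _ _ _ N 0 N') //=.
rewrite [X in _ + X]big_nat [X in _ + X]big1 ?addr0 // => i /andP[Ni _].
exact: F0.
Qed.

Lemma gmulE f g N : (dbound f <= N)%N -> (dbound g <= N)%N ->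
  gmul f g =
    \sum_(0 <= i < N) \sum_(0 <= j < N) dincl (gop m (f i) (g j)).
Proof.
move=> fN gN; rewrite /gmul (big_nat_widen0 _ fN) => [|i fi].
  apply: eq_bigr => i _; apply: (big_nat_widen0 _ gN) => j gj.
  by rewrite (dboundP gj) gop0r dincl0.
by rewrite big1 // => j _; rewrite (dboundP fi) gop0l dincl0.
Qed.

Lemma gmulDl : left_distributive gmul +%R.
Proof.
move=> f f' g; set N := maxn (maxn (dbound f) (dbound f'))
  (maxn (dbound (f + f')) (dbound g)).
rewrite !(@gmulE _ _ N) ?leq_max ?leqnn ?orbT // -big_split /=.
apply: eq_bigr => i _; rewrite -big_split /=.
by apply: eq_bigr => j _; rewrite -dinclD -gopDl.
Qed.

Lemma gmulDr : right_distributive gmul +%R.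
Proof.
move=> f g g'; set N := maxn (maxn (dbound g) (dbound g'))
  (maxn (dbound (g + g')) (dbound f)).
rewrite !(@gmulE _ _ N) ?leq_max ?leqnn ?orbT // -big_split /=.
apply: eq_bigr => i _; rewrite -big_split /=.
by apply: eq_bigr => j _; rewrite -dinclD -gopDr.
Qed.

Lemma gmulZl k f g : k *: gmul f g = gmul (k *: f) g.
Proof.
set N := maxn (maxn (dbound f) (dbound g)) (dbound (k *: f)).
rewrite !(@gmulE _ _ N) ?leq_max ?leqnn ?orbT // scaler_sumr.
apply: eq_bigr => i _; rewrite scaler_sumr.
by apply: eq_bigr => j _; rewrite -dinclZ -gopZl.
Qed.

Lemma gmulZr k f g : k *: gmul f g = gmul f (k *: g).
Proof.
set N := maxn (maxn (dbound f) (dbound g)) (dbound (k *: g)).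
rewrite !(@gmulE _ _ N) ?leq_max ?leqnn ?orbT // scaler_sumr.
apply: eq_bigr => i _; rewrite scaler_sumr.
by apply: eq_bigr => j _; rewrite -dinclZ -gopZr.
Qed.

Lemma gmul0l g : gmul 0 g = 0.
Proof. by rewrite -(scale0r (0 : A)) -gmulZl !scale0r. Qed.

Lemma gmul0r g : gmul g 0 = 0.
Proof. by rewrite -(scale0r (0 : A)) -gmulZr !scale0r. Qed.

Lemma gmul_dincl i j (x : E i) (y : E j) :
  gmul (dincl x) (dincl y) = dincl (gop m x y).
Proof.
set N := maxn (maxn (dbound (dincl x)) (dbound (dincl y))) (maxn i.+1 j.+1).
have lti : (i < N)%N by rewrite !leq_max leqnn !orbT.
have ltj : (j < N)%N by rewrite !leq_max leqnn !orbT.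
rewrite (@gmulE _ _ N) ?leq_max ?leqnn ?orbT //.
rewrite (bigD1_seq i) ?mem_index_iota ?iota_uniq //= [X in _ + X]big1 ?addr0.
  rewrite (bigD1_seq j) ?mem_index_iota ?iota_uniq //= [X in _ + X]big1 ?addr0.
    by rewrite -![dincl_fun _ _]/(dincl _ _) !dincl_id.
  move=> l lj; rewrite -[dincl_fun y l]/(dincl y l) dincl_neq 1?eq_sym //.
  by rewrite gop0r dincl0.
move=> l li; rewrite big1 // => j' _.
by rewrite -[dincl_fun x l]/(dincl x l) dincl_neq 1?eq_sym // gop0l dincl0.
Qed.

Lemma gmulA : associative gmul.
Proof.
move=> f g h; elim/dsum_ind: f => [|i x f IHf]; first by rewrite !gmul0l.
rewrite !gmulDl {}IHf; congr (_ + _).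
elim/dsum_ind: g => [|j y g IHg]; first by rewrite !(gmul0l, gmul0r).
rewrite !(gmulDl, gmulDr) {}IHg; congr (_ + _).
elim/dsum_ind: h => [|l z h IHh]; first by rewrite !gmul0r.
by rewrite !gmulDr {}IHh !gmul_dincl gopA.
Qed.

Lemma gmul1l : left_id gunit gmul.
Proof.
move=> f; elim/dsum_ind: f => [|i x f IHf]; first by rewrite gmul0r.
by rewrite gmulDr IHf gmul_dincl gop1l.
Qed.

Lemma gmul1r : right_id gunit gmul.
Proof.
move=> f; elim/dsum_ind: f => [|i x f IHf]; first by rewrite gmul0l.
by rewrite gmulDl IHf gmul_dincl gop1r.
Qed.

HB.instance Definition _ := GRing.Zmodule_isPzRing.Build A
  gmulA gmul1l gmul1r gmulDl gmulDr.

Definition graded_sum_kalgebra : kalgebra K :=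
  @KAlgebra K A (fun k (f : A) => k *: f) (@scalerA K A) (@scale1r K A)
    (@scalerDr K A) (fun f k l => scalerDl f k l) gmulZl gmulZr.

End GradedSum.

Definition internal_direct_sum (I : eqType) (V : zmodType)
    (D : I -> {pred V}) : Prop :=
  [/\ forall i, zmod_closed (D i),
      forall x, exists (s : seq I) (c : I -> V),
        (forall i, c i \in D i) /\ x = \sum_(i <- s) c i
    & forall (s : seq I) (c : I -> V), uniq s -> (forall i, c i \in D i) ->
        \sum_(i <- s) c i = 0 -> forall i, i \in s -> c i = 0].

Definition is_grading (K : fieldType) (A : kalgebra K)
    (D : nat -> {pred A}) : Prop :=
  [/\ forall i, submod_closed (D i),
      1 \in D 0%N,
      forall i j x y, x \in D i -> y \in D j -> x * y \in D (i + j)%N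
    & internal_direct_sum D].

Record gralgebra (K : fieldType) := GrAlgebra {
  galg :> kalgebra K;
  gdeg : nat -> {pred galg};
  gdegP : is_grading gdeg
}.
Arguments gdeg {K} g n : rename.
Arguments gdegP {K} g : rename.

Section GradedSumGrading.
Variables (K : fieldType) (E : nat -> lmodType K) (m : graded_mul E).
Notation A := (graded_sum_kalgebra m).

Definition graded_sum_deg n : {pred A} :=
  fun f => `[< exists x : E n, f = dincl x >].

Lemma graded_sum_degP n (f : A) :
  reflect (exists x : E n, f = dincl x) (f \in graded_sum_deg n).
Proof. exact: asboolP. Qed.

Lemma graded_sum_grading : is_grading graded_sum_deg.
Proof.
have DZ n : submod_closed (graded_sum_deg n).
  split=> [|k f g /graded_sum_degP[x ->] /graded_sum_degP[y ->]].
    by apply/graded_sum_degP; exists 0; rewrite dincl0.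
  by apply/graded_sum_degP; exists (k *: x + y); rewrite dinclD dinclZ.
split=> [//||i j f g /graded_sum_degP[x ->] /graded_sum_degP[y ->]|].
- by apply/graded_sum_degP; exists (gone m).
- by apply/graded_sum_degP; exists (gop m x y); apply: gmul_dincl.
split=> [i|f|s c us cD].
- exact: GRing.submod_closedB (DZ i).
- exists (index_iota 0 (dbound f)), (fun i => dincl (f i)); split=> [i|].
    by apply/graded_sum_degP; exists (f i).
  exact: dsum_decomp (@dboundP _ _ f).
- move=> s0 i si.
  have /(congr1 (fun f : dsum E => f i)) := s0.
  rewrite (dsum_apply s (fun i => c i : dsum E)) (bigD1_seq i) //=.
  rewrite [X in _ + X]big1 => [|j ji].
    rewrite addr0; have /graded_sum_degP[x ->] := cD i.
    by rewrite dincl_id => ->; apply: dincl0.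
  have /graded_sum_degP[x ->] := cD j.
  by rewrite -[LHS]/(dincl x i) dincl_neq.
Qed.

Definition graded_sum_algebra : gralgebra K := GrAlgebra graded_sum_grading.

End GradedSumGrading.

Section TensorAlgebra.
Variables (K : fieldType) (S : kalgebra K) (M : bimodType S).

Fixpoint tpow n : bimodType S :=
  match n with
  | 0 => regular_bimod S
  | n1.+1 => match n1 with 0 => M | _.+1 => tensor M (tpow n1) end
  end.

Definition tcons n : M -> tpow n -> tpow n.+1 :=
  match n with
  | 0 => fun m (s : S) => m <<* s
  | _.+1 => fun m x => tens m x
  end.

(* The product (m1 (x) ... (x) mi) . y is m1 . (... . (mi . y)).              *)
Fixpoint tmul i j : tpow i -> tpow j -> tpow (i + j)%N :=
  match i return tpow i -> tpow j -> tpow (i + j)%N with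
  | 0 => fun (s : S) y => s *>> y
  | i1.+1 =>
    match i1 return (tpow i1 -> tpow j -> tpow (i1 + j)%N) ->
                    tpow i1.+1 -> tpow j -> tpow (i1 + j).+1 with
    | 0 => fun _ m y => tcons m y
    | _.+1 => fun mul_i1 u y => tlift (fun m x => tcons m (mul_i1 x y)) u
    end (@tmul i1 j)
  end.

Lemma tconsDl n m m' (x : tpow n) : tcons (m + m') x = tcons m x + tcons m' x.
Proof. by case: n x => [|n] x; [apply: ractDl | apply: tensDl]. Qed.

Lemma tconsDr n m (x x' : tpow n) : tcons m (x + x') = tcons m x + tcons m x'.
Proof. by case: n x x' => [|n] x x'; [apply: ractDr | apply: tensDr]. Qed.

Lemma tcons_bal n m s (x : tpow n) : tcons (m <<* s) x = tcons m (s *>> x).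
Proof. by case: n x => [|n] x; [symmetry; apply: ractA | apply: tens_bal]. Qed.

Lemma tcons_lact n s m (x : tpow n) : tcons (s *>> m) x = s *>> tcons m x.
Proof. by case: n x => [|n] x; [apply: lractA | symmetry; apply: tlact_tens]. Qed.

Lemma tconsZl n k m (x : tpow n) : tcons (k *: m) x = k *: tcons m x.
Proof.
have -> : k *: m = (k *: (1 : S)) *>> m by rewrite lactZl lact1.
by rewrite tcons_lact lactZl lact1.
Qed.

Lemma tconsZr n k m (x : tpow n) : tcons m (k *: x) = k *: tcons m x.
Proof.
have -> : k *: x = (k *: (1 : S)) *>> x by rewrite lactZl lact1.
by rewrite -tcons_bal ractZr ract1 tconsZl.
Qed.

Lemma tmul0 j (s : S) (y : tpow j) : @tmul 0 j s y = s *>> y.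
Proof. by []. Qed.

Lemma tcons_ind n (P : tpow n.+1 -> Prop) : P 0 ->
  (forall m x u, P u -> P (tcons m x + u)) -> forall u, P u.
Proof.
case: n P => [|n] P P0 PD u; last first.
  by elim/tensor_ind: u => // m x u; apply: PD.
by rewrite -[u]addr0 -[u](@ract1 _ S M); apply: (PD u (1 : S)).
Qed.

Lemma tmul_spec i j :
  [/\ forall (x x' : tpow i) (y : tpow j),
        tmul (x + x') y = tmul x y + tmul x' y,
      forall s (x : tpow i) (y : tpow j), tmul (s *>> x) y = s *>> tmul x y
    & forall (x : tpow i) (y y' : tpow j),
        tmul x (y + y') = tmul x y + tmul x y'] /\
  forall m (x : tpow i) (y : tpow j),
    @tmul i.+1 j (tcons m x) y = tcons m (tmul x y).
Proof.
elim: i => [|i IH].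
  split; first split.
  - by move=> s s' y; apply: lactDl.
  - by move=> s t y; apply: lactA.
  - by move=> s y y'; apply: lactDr.
  - by move=> m s y; rewrite /= -tcons_bal.
case: IH => [[Dl sl Dr] consE].
case: i Dl sl Dr consE => [|i] Dl sl Dr consE.
  split; first split.
  - by move=> m m' y; apply: tconsDl.
  - by move=> s m y; apply: tcons_lact.
  - by move=> m y y'; apply: tconsDr.
  - move=> m m' y; apply: (@tliftE _ _ M M _ (fun m1 m2 => tcons m1 (tcons m2 y))).
    + by move=> m1 m2 n; apply: tconsDl.
    + by move=> m1 n1 n2; rewrite tconsDl tconsDr.
    + by move=> m1 s n; rewrite tcons_lact tcons_bal.
pose b (y : tpow j) m (x : tpow i.+1) := tcons m (tmul x y).
have bDl y m m' x : b y (m + m') x = b y m x + b y m' x by apply: tconsDl.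
have bDr y m x x' : b y m (x + x') = b y m x + b y m x'.
  by rewrite /b Dl tconsDr.
have bb y m s x : b y (m <<* s) x = b y m (s *>> x).
  by rewrite /b sl tcons_bal.
have mulE (u : tpow i.+2) (y : tpow j) : tmul u y = tlift (b y) u by [].
have D (u v : tpow i.+2) (y : tpow j) : tmul (u + v) y = tmul u y + tmul v y.
  by rewrite !mulE; apply: tliftD.
have Z (y : tpow j) : tmul (0 : tpow i.+2) y = 0.
  by rewrite mulE; apply: tlift0.
split; first split=> //.
- move=> s u y; elim/tcons_ind: u => [|m x u IH].
    by rewrite lact0 !Z lact0.
  by rewrite lactDr !D lactDr IH -tcons_lact !consE tcons_lact.
- move=> u y y'; elim/tcons_ind: u => [|m x u IH]; first by rewrite !Z addr0.
  by rewrite !D IH !consE Dr tconsDr addrACA.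
- move=> m u y.
  apply: (@tliftE _ _ M (tpow i.+2) _ (fun m' x => tcons m' (tmul x y))).
  + by move=> m1 m2 x; apply: tconsDl.
  + by move=> m1 x x'; rewrite D tconsDr.
  + move=> m1 s x; rewrite tcons_bal; congr (tcons _ _).
    elim/tcons_ind: x => [|m2 x u' IH]; first by rewrite lact0 Z lact0.
    by rewrite lactDr !D lactDr IH -tcons_lact !consE tcons_lact.
Qed.

Lemma tmulDl i j (x x' : tpow i) (y : tpow j) :
  tmul (x + x') y = tmul x y + tmul x' y.
Proof. by case: (tmul_spec i j) => [[]]. Qed.

Lemma tmulDr i j (x : tpow i) (y y' : tpow j) :
  tmul x (y + y') = tmul x y + tmul x y'.
Proof. by case: (tmul_spec i j) => [[]]. Qed.

Lemma tmul_lact i j s (x : tpow i) (y : tpow j) :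
  tmul (s *>> x) y = s *>> tmul x y.
Proof. by case: (tmul_spec i j) => [[]]. Qed.

Lemma tmul_cons i j m (x : tpow i) (y : tpow j) :
  @tmul i.+1 j (tcons m x) y = tcons m (tmul x y).
Proof. by case: (tmul_spec i j). Qed.

Lemma tmulZl i j k (x : tpow i) (y : tpow j) : tmul (k *: x) y = k *: tmul x y.
Proof.
have -> : k *: x = (k *: (1 : S)) *>> x by rewrite lactZl lact1.
by rewrite tmul_lact lactZl lact1.
Qed.

Lemma tmul0l i j (y : tpow j) : tmul (0 : tpow i) y = 0.
Proof. by rewrite -(scale0r (0 : tpow i)) tmulZl scale0r. Qed.

Lemma tmulZr i j k (x : tpow i) (y : tpow j) : tmul x (k *: y) = k *: tmul x y.
Proof.
elim: i x => [|i IH] x; first exact: lactZr.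
elim/tcons_ind: x => [|m x u IHu]; first by rewrite !tmul0l scaler0.
by rewrite !tmulDl scalerDr IHu !tmul_cons IH tconsZr.
Qed.

Definition dcons_fun m (f : dsum tpow) n : tpow n :=
  match n with 0 => 0 | n1.+1 => tcons m (f n1) end.

Fact dcons_fin m f :
  exists N, forall n, (N <= n)%N -> dcons_fun m f n = 0.
Proof.
exists (dbound f).+1 => -[//|n] fn /=; rewrite dboundP //.
by rewrite -(scale0r (0 : tpow n)) tconsZr scale0r.
Qed.

Definition dcons m f : dsum tpow := DSum (dcons_fin m f).

Lemma dcons_dincl m n (x : tpow n) : dcons m (dincl x) = @dincl _ tpow n.+1 (tcons m x).
Proof.
symmetry; apply: dinclP => [|[//|l] nl].
  by rewrite -[LHS]/(tcons m (dincl x n)) dincl_id.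
rewrite -[LHS]/(tcons m (dincl x l)) dincl_neq //.
by rewrite -(scale0r (0 : tpow l)) tconsZr scale0r.
Qed.

Lemma dinclDt n (x y : tpow n) :
  dincl (x + y) = dincl x + dincl y :> dsum tpow.
Proof. exact: dinclD. Qed.

Lemma tmulA i j l (x : tpow i) (y : tpow j) (z : tpow l) :
  dincl (tmul x (tmul y z)) = dincl (tmul (tmul x y) z) :> dsum tpow.
Proof.
elim: i x => [|i IH] x; first by rewrite !tmul0 tmul_lact.
elim/tcons_ind: x => [|m x u IHu]; first by rewrite !tmul0l !dincl0.
rewrite !tmulDl !dinclDt IHu !tmul_cons; congr (_ + _).
by rewrite -[LHS]dcons_dincl IH dcons_dincl.
Qed.

Lemma tmul1l i (x : tpow i) :
  dincl (@tmul 0 i (1 : S) x) = dincl x :> dsum tpow.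
Proof. by rewrite tmul0 lact1. Qed.

Lemma tmul1r i (x : tpow i) :
  dincl (@tmul i 0 x (1 : S)) = dincl x :> dsum tpow.
Proof.
elim: i x => [|i IH] x; first by congr dincl; apply: mulr1.
elim/tcons_ind: x => [|m x u IHu]; first by rewrite !tmul0l !dincl0.
by rewrite !tmulDl !dinclDt IHu tmul_cons -[X in X + _]dcons_dincl IH dcons_dincl.
Qed.

Definition tensor_graded_mul : @graded_mul K tpow :=
  @GradedMul K tpow tmul (1 : S) tmulDl tmulDr tmulZl tmulZr tmulA tmul1l tmul1r.

Definition tensor_algebra : gralgebra K := graded_sum_algebra tensor_graded_mul.

Definition tensor_incl n (x : tpow n) : tensor_algebra := @dincl K tpow n x.

End TensorAlgebra.

Record submodule (A : pzRingType) (V : lmodType A) := Submodule {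
  submod_pred :> {pred V};
  submodP : submod_closed submod_pred
}.

Section SubmoduleTypes.
Variables (A : pzRingType) (V : lmodType A) (W : submodule V).

HB.instance Definition _ :=
  GRing.isSubmodClosed.Build A V (submod_pred W) (submodP W).

Record submod_type := SubmodElt {
  submod_val :> V;
  submod_valP : submod_val \in submod_pred W
}.
HB.instance Definition _ := [isSub for submod_val].
HB.instance Definition _ := [Choice of submod_type by <:].
HB.instance Definition _ := [SubChoice_isSubLmodule of submod_type by <:].

Definition quotmod : Type := Quotient.quot (submod_pred W).
HB.instance Definition _ := GRing.Zmodule.on quotmod.

Definition qmod (x : V) : quotmod := (\pi_(Quotient.quot (submod_pred W)) x)%qT.
Definition qmod_repr (u : quotmod) : V := repr (u : Quotient.quot (submod_pred W)).

Lemma qmod_reprK u : qmod (qmod_repr u) = u.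
Proof. exact: reprK. Qed.

Lemma qmodP x y : qmod x = qmod y <-> x - y \in submod_pred W.
Proof.
rewrite -[_ \in _]/(Quotient.equiv (submod_pred W) x y).
by split=> [/eqmodP|] xy; [|apply/eqmodP].
Qed.

Lemma qmodD : {morph qmod : x y / x + y}.
Proof. exact: Quotient.pi_add. Qed.

Lemma qmod0 : qmod 0 = 0.
Proof. by apply: (addrI (qmod 0)); rewrite -qmodD !addr0. Qed.

Lemma qmod_eq0 x : qmod x = 0 <-> x \in submod_pred W.
Proof. by rewrite -qmod0 qmodP subr0. Qed.

Definition qmod_scale (a : A) (u : quotmod) : quotmod := qmod (a *: qmod_repr u).

Lemma qmod_scaleE a x : qmod_scale a (qmod x) = qmod (a *: x).
Proof.
by apply/qmodP; rewrite -scalerBr rpredZ //; apply/qmodP/qmod_reprK.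
Qed.

Fact qmod_scaleA a b u : qmod_scale a (qmod_scale b u) = qmod_scale (a * b) u.
Proof. by rewrite -[u]qmod_reprK !qmod_scaleE scalerA. Qed.
Fact qmod_scale1 : left_id 1 qmod_scale.
Proof. by move=> u; rewrite -[u]qmod_reprK qmod_scaleE scale1r. Qed.
Fact qmod_scaleDr : right_distributive qmod_scale +%R.
Proof.
move=> a u v; rewrite -[u]qmod_reprK -[v]qmod_reprK -qmodD !qmod_scaleE.
by rewrite scalerDr qmodD.
Qed.
Fact qmod_scaleDl u : {morph qmod_scale^~ u : a b / a + b}.
Proof.
by move=> a b; rewrite -[u]qmod_reprK !qmod_scaleE scalerDl qmodD.
Qed.

HB.instance Definition _ := GRing.Zmodule_isLmodule.Build A quotmod
  qmod_scaleA qmod_scale1 qmod_scaleDr qmod_scaleDl.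

Lemma qmodZ a x : qmod (a *: x) = a *: qmod x.
Proof. by rewrite -qmod_scaleE. Qed.

End SubmoduleTypes.

Record subbimodule (K : fieldType) (S : kalgebra K) (N : bimodType S) :=
  Subbimodule {
    subbimod_pred :> {pred N};
    subbimod_zmod : zmod_closed subbimod_pred;
    subbimod_lact : forall s x, x \in subbimod_pred -> s *>> x \in subbimod_pred;
    subbimod_ract : forall s x, x \in subbimod_pred -> x <<* s \in subbimod_pred
  }.

Section SubbimoduleType.
Variables (K : fieldType) (S : kalgebra K) (N : bimodType S).
Variable R : subbimodule N.

Fact subbimod_closed : submod_closed (subbimod_pred R).
Proof.
have [R0 RB] := subbimod_zmod R; split=> // k x y xR yR.
have kxR : k *: x \in subbimod_pred R.
  by rewrite -[x](@lact1 _ S) -lactZl subbimod_lact.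
have := RB _ _ kxR (RB _ _ R0 yR).
by rewrite sub0r opprK.
Qed.

HB.instance Definition _ :=
  GRing.isSubmodClosed.Build K N (subbimod_pred R) subbimod_closed.

Record subbimod_type := SubbimodElt {
  subbimod_val :> N;
  subbimod_valP : subbimod_val \in subbimod_pred R
}.
HB.instance Definition _ := [isSub for subbimod_val].
HB.instance Definition _ := [Choice of subbimod_type by <:].
HB.instance Definition _ := [SubChoice_isSubLmodule of subbimod_type by <:].

Definition sub_lact (s : S) (x : subbimod_type) : subbimod_type :=
  SubbimodElt (subbimod_lact s (subbimod_valP x)).
Definition sub_ract (x : subbimod_type) (s : S) : subbimod_type :=
  SubbimodElt (subbimod_ract s (subbimod_valP x)).

Fact sub_lactDl s t x : sub_lact (s + t) x = sub_lact s x + sub_lact t x.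
Proof. by apply: val_inj; rewrite /= lactDl. Qed.
Fact sub_lactDr s x y : sub_lact s (x + y) = sub_lact s x + sub_lact s y.
Proof. by apply: val_inj; rewrite /= lactDr. Qed.
Fact sub_lactZl (k : K) s x : sub_lact (k *: s) x = k *: sub_lact s x.
Proof. by apply: val_inj; rewrite /= lactZl. Qed.
Fact sub_lact1 x : sub_lact 1 x = x.
Proof. by apply: val_inj; rewrite /= lact1. Qed.
Fact sub_lactA s t x : sub_lact (s * t) x = sub_lact s (sub_lact t x).
Proof. by apply: val_inj; rewrite /= lactA. Qed.
Fact sub_ractDl x y s : sub_ract (x + y) s = sub_ract x s + sub_ract y s.
Proof. by apply: val_inj; rewrite /= ractDl. Qed.
Fact sub_ractDr x s t : sub_ract x (s + t) = sub_ract x s + sub_ract x t.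
Proof. by apply: val_inj; rewrite /= ractDr. Qed.
Fact sub_ractZr (k : K) x s : sub_ract x (k *: s) = k *: sub_ract x s.
Proof. by apply: val_inj; rewrite /= ractZr. Qed.
Fact sub_ract1 x : sub_ract x 1 = x.
Proof. by apply: val_inj; rewrite /= ract1. Qed.
Fact sub_ractA x s t : sub_ract x (s * t) = sub_ract (sub_ract x s) t.
Proof. by apply: val_inj; rewrite /= ractA. Qed.
Fact sub_lractA s x t : sub_ract (sub_lact s x) t = sub_lact s (sub_ract x t).
Proof. by apply: val_inj; rewrite /= lractA. Qed.

HB.instance Definition _ := Lmodule_isBimodule.Build K S subbimod_type
  sub_lactDl sub_lactDr sub_lactZl sub_lact1 sub_lactA
  sub_ractDl sub_ractDr sub_ractZr sub_ract1 sub_ractA sub_lractA.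

End SubbimoduleType.

Definition bimodule_morphism (K : fieldType) (S : kalgebra K)
    (M N : bimodType S) (f : M -> N) : Prop :=
  [/\ forall x y, f (x + y) = f x + f y,
      forall s x, f (s *>> x) = s *>> f x
    & forall x s, f (x <<* s) = f x <<* s].

Section Ideals.
Variables (K : fieldType) (A : kalgebra K).

Record ideal := Ideal {
  ideal_pred :> {pred A};
  ideal_zmod : zmod_closed ideal_pred;
  idealMl : forall a x, x \in ideal_pred -> a * x \in ideal_pred;
  idealMr : forall a x, x \in ideal_pred -> x * a \in ideal_pred
}.

Definition gen_ideal_pred (X : A -> Prop) : {pred A} := fun x =>
  `[< exists s : seq (A * A * A), (forall p, p \in s -> X p.1.2) /\
        x = \sum_(p <- s) p.1.1 * p.1.2 * p.2 >].

Section GeneratedIdeal.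
Variable X : A -> Prop.

Lemma gen_idealP x :
  reflect (exists s : seq (A * A * A), (forall p, p \in s -> X p.1.2) /\
             x = \sum_(p <- s) p.1.1 * p.1.2 * p.2)
          (x \in gen_ideal_pred X).
Proof. exact: asboolP. Qed.

Lemma gen_idealMl a x : x \in gen_ideal_pred X -> a * x \in gen_ideal_pred X.
Proof.
case/gen_idealP=> s [sX ->]; apply/gen_idealP.
exists [seq (a * p.1.1, p.1.2, p.2) | p <- s]; split.
  by move=> _ /mapP[p /sX Xp ->].
by rewrite big_map mulr_sumr; apply: eq_bigr => p _; rewrite !mulrA.
Qed.

Lemma gen_idealMr a x : x \in gen_ideal_pred X -> x * a \in gen_ideal_pred X.
Proof.
case/gen_idealP=> s [sX ->]; apply/gen_idealP.
exists [seq (p.1, p.2 * a) | p <- s]; split.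
  by move=> _ /mapP[p /sX Xp ->].
by rewrite big_map mulr_suml; apply: eq_bigr => p _; rewrite !mulrA.
Qed.

Lemma gen_ideal_zmod : zmod_closed (gen_ideal_pred X).
Proof.
split=> [|x y]; first by apply/gen_idealP; exists [::]; rewrite big_nil.
move=> xI /(gen_idealMl (-1)); rewrite mulN1r => /gen_idealP[t [tX ->]].
case/gen_idealP: xI => s [sX ->]; apply/gen_idealP; exists (s ++ t).
by split=> [p|]; [rewrite mem_cat => /orP[/sX|/tX] | rewrite big_cat].
Qed.

Definition gen_ideal : ideal :=
  Ideal gen_ideal_zmod gen_idealMl gen_idealMr.

Lemma gen_ideal_gen x : X x -> x \in gen_ideal_pred X.
Proof.
move=> Xx; apply/gen_idealP; exists [:: (1, x, 1)].
by split=> [p|]; [rewrite inE => /eqP-> | rewrite big_seq1 mul1r mulr1].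
Qed.

End GeneratedIdeal.

Section Quotient.
Variable I : ideal.

Fact ideal_submod_closed : submod_closed (ideal_pred I).
Proof.
have [I0 IB] := ideal_zmod I; split=> // k x y xI yI.
have kxI : k *: x \in ideal_pred I.
  by rewrite -[x]mul1r kscalerAl idealMl.
by have := IB _ _ kxI (IB _ _ I0 yI); rewrite sub0r opprK.
Qed.

Definition ideal_submodule : submodule A := Submodule ideal_submod_closed.

Definition quotalg : Type := quotmod ideal_submodule.
HB.instance Definition _ := GRing.Lmodule.on quotalg.

Definition qalg (x : A) : quotalg := qmod ideal_submodule x.
Definition qalg_repr (u : quotalg) : A := qmod_repr u.
Definition qalg_mul (u v : quotalg) : quotalg := qalg (qalg_repr u * qalg_repr v).

Lemma qalg_reprK u : qalg (qalg_repr u) = u.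
Proof. exact: qmod_reprK. Qed.

Lemma qalgP x y : qalg x = qalg y <-> x - y \in ideal_pred I.
Proof. exact: qmodP. Qed.

Lemma qalg_eq0 x : qalg x = 0 <-> x \in ideal_pred I.
Proof. exact: qmod_eq0. Qed.

Lemma qalgD : {morph qalg : x y / x + y}. Proof. exact: qmodD. Qed.
Lemma qalgZ (k : K) x : qalg (k *: x) = k *: qalg x. Proof. exact: qmodZ. Qed.
Lemma qalg0 : qalg 0 = 0. Proof. exact: qmod0. Qed.

Lemma qalg_sum (T : Type) (s : seq T) (f : T -> A) :
  qalg (\sum_(j <- s) f j) = \sum_(j <- s) qalg (f j).
Proof.
by elim: s => [|j s IH]; rewrite ?(big_nil, qalg0) // !big_cons qalgD IH.
Qed.

Lemma qalgM x y : qalg_mul (qalg x) (qalg y) = qalg (x * y).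
Proof.
set x' := qalg_repr (qalg x); set y' := qalg_repr (qalg y).
have xI : x' - x \in ideal_pred I by apply/qalgP/qalg_reprK.
have yI : y' - y \in ideal_pred I by apply/qalgP/qalg_reprK.
apply/qalgP; have -> : x' * y' - x * y = (x' - x) * y' + x * (y' - y).
  by rewrite mulrBl mulrBr addrA subrK.
have [I0 IB] := ideal_zmod I.
have := IB _ _ (idealMr y' xI) (IB _ _ I0 (idealMl x yI)).
by rewrite sub0r opprK.
Qed.

Fact qalg_mulA : associative qalg_mul.
Proof.
move=> u v w; rewrite -[u]qalg_reprK -[v]qalg_reprK -[w]qalg_reprK.
by rewrite !qalgM mulrA.
Qed.
Fact qalg_mul1l : left_id (qalg 1) qalg_mul.
Proof. by move=> u; rewrite -[u]qalg_reprK qalgM mul1r. Qed.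
Fact qalg_mul1r : right_id (qalg 1) qalg_mul.
Proof. by move=> u; rewrite -[u]qalg_reprK qalgM mulr1. Qed.
Fact qalg_mulDl : left_distributive qalg_mul +%R.
Proof.
move=> u v w; rewrite -[u]qalg_reprK -[v]qalg_reprK -[w]qalg_reprK.
by rewrite -qalgD !qalgM mulrDl qalgD.
Qed.
Fact qalg_mulDr : right_distributive qalg_mul +%R.
Proof.
move=> u v w; rewrite -[u]qalg_reprK -[v]qalg_reprK -[w]qalg_reprK.
by rewrite -qalgD !qalgM mulrDr qalgD.
Qed.

HB.instance Definition _ := GRing.Zmodule_isPzRing.Build quotalg
  qalg_mulA qalg_mul1l qalg_mul1r qalg_mulDl qalg_mulDr.

Lemma qalgMr x y : qalg (x * y) = qalg x * qalg y.
Proof. by rewrite -qalgM. Qed.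

Fact qalg_scaleMl (k : K) (u v : quotalg) : k *: (u * v) = (k *: u) * v.
Proof.
by rewrite -[u]qalg_reprK -[v]qalg_reprK -qalgZ -!qalgMr -qalgZ kscalerAl.
Qed.
Fact qalg_scaleMr (k : K) (u v : quotalg) : k *: (u * v) = u * (k *: v).
Proof.
by rewrite -[u]qalg_reprK -[v]qalg_reprK -qalgZ -!qalgMr -qalgZ kscalerAr.
Qed.

Definition quot_kalgebra : kalgebra K :=
  @KAlgebra K quotalg (fun k (u : quotalg) => k *: u) (@scalerA K quotalg)
    (@scale1r K quotalg) (@scalerDr K quotalg) (fun u k l => scalerDl u k l)
    qalg_scaleMl qalg_scaleMr.

End Quotient.
End Ideals.

(* The quotient of a graded algebra by homogeneous elements, with deg n the   *)
(* image of the component of degree n.                                        *)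
Section GradedQuotient.
Variables (K : fieldType) (A : gralgebra K) (X : A -> Prop).
Hypothesis X_homog : forall x, X x -> exists n, x \in gdeg A n.
Notation I := (gen_ideal X).
Notation Q := (quot_kalgebra I).

Definition quot_deg n : {pred Q} :=
  fun u => `[< exists2 x, x \in gdeg A n & u = qalg I x >].

Lemma quot_degP n (u : Q) :
  reflect (exists2 x, x \in gdeg A n & u = qalg I x) (u \in quot_deg n).
Proof. exact: asboolP. Qed.

Let deg_submod n : submod_closed (gdeg A n).
Proof. by case: (gdegP A). Qed.

Let deg0 n : 0 \in gdeg A n. Proof. by case: (deg_submod n). Qed.

Let degD n x y : x \in gdeg A n -> y \in gdeg A n -> x + y \in gdeg A n.
Proof. by case: (deg_submod n) => _ DZ xD yD; rewrite -[x]scale1r DZ. Qed.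

Let I0 : 0 \in gen_ideal_pred X. Proof. by case: (gen_ideal_zmod X). Qed.

Let ID x y : x \in gen_ideal_pred X -> y \in gen_ideal_pred X ->
  x + y \in gen_ideal_pred X.
Proof.
case: (gen_ideal_zmod X) => _ IB xI yI.
by have := IB _ _ xI (IB _ _ I0 yI); rewrite sub0r opprK.
Qed.

Definition homog_sum x := exists (s : seq nat) (c : nat -> A),
  [/\ uniq s, forall i, c i \in gdeg A i,
      forall i, c i \in gen_ideal_pred X & x = \sum_(i <- s) c i].

Lemma sum_pad (s : seq nat) N (c : nat -> A) : uniq s ->
  (forall i, i \in s -> (i < N)%N) ->
  \sum_(i <- s) c i = \sum_(0 <= i < N) (if i \in s then c i else 0).
Proof.
move=> us sN; rewrite -big_mkcond -big_filter; apply: perm_big.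
apply: uniq_perm => //; first by rewrite filter_uniq ?iota_uniq.
move=> i; rewrite mem_filter mem_index_iota /=.
by case si: (i \in s) => //; rewrite sN.
Qed.

Lemma seq_bound (s : seq nat) : exists N, forall i, i \in s -> (i < N)%N.
Proof.
exists (\max_(i <- s) i.+1)%N => i si.
exact: (leq_bigmax_seq (F := succn) i).
Qed.

Lemma homog_sumD x y : homog_sum x -> homog_sum y -> homog_sum (x + y).
Proof.
move=> [s [c [us cD cI ->]]] [t [d [ut dD dI ->]]].
have [N sN] := seq_bound (s ++ t).
exists (index_iota 0 N).
exists (fun i => (if i \in s then c i else 0) + (if i \in t then d i else 0)).
split=> [|i|i|]; first exact: iota_uniq.
- by apply: degD; case: ifP.
- by apply: ID; case: ifP.
rewrite big_split /= -!sum_pad // => i si; apply: sN; rewrite mem_cat si ?orbT //.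
Qed.

Lemma homog_sum1 n x : x \in gdeg A n -> x \in gen_ideal_pred X -> homog_sum x.
Proof.
move=> xn xI; exists [:: n], (fun i => if i == n then x else 0).
split=> // [i|i|]; try by case: eqP => // ->.
by rewrite big_seq1 eqxx.
Qed.

Lemma homog_sum_sum (T : eqType) (s : seq T) (F : T -> A) :
  (forall i, i \in s -> homog_sum (F i)) -> homog_sum (\sum_(i <- s) F i).
Proof.
move=> sF; rewrite big_seq; apply: big_ind => //; last exact: homog_sumD.
exact: (@homog_sum1 0%N).
Qed.

Lemma gen_ideal_homog x : x \in gen_ideal_pred X -> homog_sum x.
Proof.
case/gen_idealP=> s [sX ->]; apply: homog_sum_sum => -[[a r] b] /sX /= Xr.
have [n rn] := X_homog Xr.
have [_ _ DM [_ span _]] := gdegP A.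
have [sa [ca [caD ->]]] := span a; have [sb [cb [cbD ->]]] := span b.
rewrite mulr_suml mulr_suml; apply: homog_sum_sum => i _.
rewrite mulr_sumr; apply: homog_sum_sum => j _.
apply: (@homog_sum1 (i + n + j)%N); first by apply/DM/cbD/DM/rn/caD.
exact/gen_idealMr/gen_idealMl/gen_ideal_gen.
Qed.

Lemma quot_grading : is_grading quot_deg.
Proof.
have [_ D1 DM [_ span indep]] := gdegP A.
have QZ n : submod_closed (quot_deg n).
  split=> [|k u v /quot_degP[x xn ->] /quot_degP[y yn ->]].
    by apply/quot_degP; exists 0; rewrite ?qalg0.
  apply/quot_degP; exists (k *: x + y); last by rewrite qalgD qalgZ.
  by case: (deg_submod n) => _; apply.
split=> [//||i j u v /quot_degP[x xi ->] /quot_degP[y yj ->]|].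
- by apply/quot_degP; exists 1.
- by apply/quot_degP; exists (x * y); [apply: DM | apply: qalgM].
split=> [i|u|s c us cD c0 i si]; first exact: GRing.submod_closedB (QZ i).
  have [s [c [cD cE]]] := span (qalg_repr u).
  exists s, (fun i => qalg I (c i)); split=> [i|].
    by apply/quot_degP; exists (c i).
  by rewrite -[u]qalg_reprK cE; apply: qalg_sum.
have /choice[d dP] j : exists x, x \in gdeg A j /\ c j = qalg I x.
  by have /quot_degP[x] := cD j; exists x.
have sumI : \sum_(j <- s) d j \in gen_ideal_pred X.
  apply/(qalg_eq0 I); rewrite -c0 qalg_sum; apply: eq_bigr => j _.
  by case: (dP j) => _ ->.
have [t [e [ut eD eI dE]]] := gen_ideal_homog sumI.
have [N sN] := seq_bound (s ++ t).
pose g j := (if j \in s then d j else 0) - (if j \in t then e j else 0).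
have gD j : g j \in gdeg A j.
  rewrite /g -scaleN1r; apply: degD; first by case: ifP => // _; case: (dP j).
  rewrite -[_ *: _]addr0; case: (deg_submod j) => _; apply=> //.
  by case: ifP.
have g0 : \sum_(j <- index_iota 0 N) g j = 0.
  rewrite /g big_split /= sumrN -!sum_pad // ?dE ?subrr // => j jst.
    by apply: sN; rewrite mem_cat jst orbT.
  by apply: sN; rewrite mem_cat jst.
have := indep _ _ (iota_uniq 0 (N - 0)) gD g0 i.
rewrite mem_index_iota sN ?mem_cat ?si // => /(_ isT); rewrite /g si => /eqP.
rewrite subr_eq0 => /eqP di; case: (dP i) => _ ->; apply/qalg_eq0.
by rewrite di; case: ifP.
Qed.

Definition quot_gralgebra : gralgebra K := GrAlgebra quot_grading.

End GradedQuotient.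

Definition projective (A : pzRingType) (P : lmodType A) : Prop :=
  forall (E F : lmodType A) (g : {linear E -> F}) (f : {linear P -> F}),
    (forall y, exists x, g x = y) ->
    exists h : {linear P -> E}, forall x, g (h x) = f x.

(* The component of degree 0 as a ring, and all components as left and right  *)
(* modules over it; right modules are modules over the converse ring.         *)
Section Components.
Variables (K : fieldType) (B : gralgebra K).

Definition gdeg_pred n : {pred B} := gdeg B n.
Definition gdeg0_pred : {pred B} := gdeg B 0.

Fact gdeg_zmod n : zmod_closed (gdeg_pred n).
Proof. by case: (gdegP B) => _ _ _ []. Qed.

Fact gdeg0_subring : subring_closed gdeg0_pred.
Proof.
have [_ D1 DM _] := gdegP B; have [_ DB] := gdeg_zmod 0.
by split=> // x y x0 y0; apply: DM x0 y0.
Qed.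

HB.instance Definition _ n :=
  GRing.isZmodClosed.Build B (gdeg_pred n) (gdeg_zmod n).
HB.instance Definition _ :=
  GRing.isSubringClosed.Build B gdeg0_pred gdeg0_subring.

Record deg0_ring := Deg0 {
  deg0_val :> B;
  deg0_valP : deg0_val \in gdeg0_pred
}.
HB.instance Definition _ := [isSub for deg0_val].
HB.instance Definition _ := [Choice of deg0_ring by <:].
HB.instance Definition _ := GRing.SubChoice_isSubPzRing.Build _ _ deg0_ring
  (GRing.subringClosedP _).

Record component n := Component {
  component_val :> B;
  component_valP : component_val \in gdeg_pred n
}.

Section Component.
Variable n : nat.
HB.instance Definition _ := [isSub for @component_val n].
HB.instance Definition _ := [Choice of component n by <:].
HB.instance Definition _ := [SubChoice_isSubZmodule of component n by <:].

Fact component_lactP (a : deg0_ring) (x : component n) :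
  deg0_val a * component_val x \in gdeg_pred n.
Proof.
by case: (gdegP B) => _ _ DM _; apply: DM (deg0_valP a) (component_valP x).
Qed.

Fact component_ractP (a : deg0_ring) (x : component n) :
  component_val x * deg0_val a \in gdeg_pred n.
Proof.
case: (gdegP B) => _ _ DM _; have := DM _ _ _ _ (component_valP x) (deg0_valP a).
by rewrite addn0.
Qed.

Definition left_component : Type := component n.
HB.instance Definition _ := GRing.Zmodule.on left_component.
Definition left_scale (a : deg0_ring) (x : left_component) : left_component :=
  Component (component_lactP a x).

Fact left_scaleA a b x : left_scale a (left_scale b x) = left_scale (a * b) x.
Proof. by apply: val_inj; rewrite /= mulrA. Qed.
Fact left_scale1 : left_id 1 left_scale.
Proof. by move=> x; apply: val_inj; rewrite /= mul1r. Qed.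
Fact left_scaleDr : right_distributive left_scale +%R.
Proof. by move=> a x y; apply: val_inj; rewrite /= mulrDr. Qed.
Fact left_scaleDl x : {morph left_scale^~ x : a b / a + b}.
Proof. by move=> a b; apply: val_inj; rewrite /= mulrDl. Qed.

HB.instance Definition _ := GRing.Zmodule_isLmodule.Build deg0_ring
  left_component left_scaleA left_scale1 left_scaleDr left_scaleDl.

Definition right_component : Type := component n.
HB.instance Definition _ := GRing.Zmodule.on right_component.
Definition right_scale (a : deg0_ring^c) (x : right_component) :
  right_component := Component (component_ractP a x).

Fact right_scaleA a b x :
  right_scale a (right_scale b x) = right_scale (a * b) x.
Proof. by apply: val_inj; rewrite /= mulrA. Qed.
Fact right_scale1 : left_id 1 right_scale.
Proof. by move=> x; apply: val_inj; rewrite /= mulr1. Qed.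
Fact right_scaleDr : right_distributive right_scale +%R.
Proof. by move=> a x y; apply: val_inj; rewrite /= mulrDl. Qed.
Fact right_scaleDl x : {morph right_scale^~ x : a b / a + b}.
Proof. by move=> a b; apply: val_inj; rewrite /= mulrDr. Qed.

HB.instance Definition _ := GRing.Zmodule_isLmodule.Build deg0_ring^c
  right_component right_scaleA right_scale1 right_scaleDr right_scaleDl.

End Component.
End Components.

Section GradedModules.
Variables (K : fieldType) (B : gralgebra K).

(* Graded right B-modules: modules over the converse ring of B, on which      *)
(* (b : B^c) *: x is x . b, graded by the integers.                           *)
Record grmodule := GrModule {
  gm_mod :> lmodType (kcar B)^c;
  gm_deg : int -> {pred gm_mod};
  gm_degP : internal_direct_sum gm_deg;
  gm_act : forall i j x (b : B), x \in gm_deg i -> b \in gdeg B j ->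
    (b : (kcar B)^c) *: x \in gm_deg (i + j%:Z)
}.
Arguments gm_deg : clear implicits.

Record grhom (P Q : grmodule) := GrHom {
  grhom_fun :> {linear P -> Q};
  grhom_deg : forall i x, x \in gm_deg P i -> grhom_fun x \in gm_deg Q i
}.

(* Projective objects, exactness and projective dimension are taken in the    *)
(* category of graded modules and homogeneous maps of degree 0.               *)
Definition graded_projective (P : grmodule) : Prop :=
  forall (E F : grmodule) (g : grhom E F) (f : grhom P F),
    (forall y, exists x, g x = y) ->
    exists h : grhom P E, forall x, g (h x) = f x.

Definition generated_in_degree (P : grmodule) (n : int) : Prop :=
  forall x : P, exists s : seq (P * B),
    (forall p, p \in s -> p.1 \in gm_deg P n) /\
    x = \sum_(p <- s) (p.2 : (kcar B)^c) *: p.1.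

Record gr_resolution (N : grmodule) := GrResolution {
  res_mod :> nat -> grmodule;
  res_proj : forall n, graded_projective (res_mod n);
  res_d : forall n, grhom (res_mod n.+1) (res_mod n);
  res_aug : grhom (res_mod 0%N) N;
  res_aug_surj : forall y, exists x, res_aug x = y;
  res_exact0 : forall x, res_aug x = 0 <-> exists y, res_d 0%N y = x;
  res_exact : forall n x, res_d n x = 0 <-> exists y, res_d n.+1 y = x
}.

Definition proj_dim_le (N : grmodule) (d : nat) : Prop :=
  exists P : gr_resolution N, forall n, (d < n)%N -> forall x : P n, x = 0.

Definition proj_dim_eq (N : grmodule) (d : nat) : Prop :=
  proj_dim_le N d /\ forall e, (e < d)%N -> ~ proj_dim_le N e.

Definition positive_part : {pred (kcar B)^c^o} := fun x =>
  `[< exists s : seq B, (forall y, y \in s -> exists n, y \in gdeg B n.+1) /\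
        x = \sum_(y <- s) y >].

Lemma positive_partP (x : B) :
  reflect (exists s : seq B,
             (forall y, y \in s -> exists n, y \in gdeg B n.+1) /\
             x = \sum_(y <- s) y)
          ((x : (kcar B)^c^o) \in positive_part).
Proof. exact: asboolP. Qed.

Let posD (x y : B) : (x : (kcar B)^c^o) \in positive_part ->
  (y : (kcar B)^c^o) \in positive_part ->
  ((x + y : B) : (kcar B)^c^o) \in positive_part.
Proof.
move=> /positive_partP[s [sP ->]] /positive_partP[t [tP ->]].
apply/positive_partP; exists (s ++ t); split=> [z|]; last by rewrite big_cat.
by rewrite mem_cat => /orP[/sP|/tP].
Qed.

Let pos0 : (0 : (kcar B)^c^o) \in positive_part.
Proof. by apply/positive_partP; exists [::]; rewrite big_nil. Qed.

Let pos_sum (T : eqType) (s : seq T) (F : T -> B) :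
  (forall i, i \in s -> (F i : (kcar B)^c^o) \in positive_part) ->
  ((\sum_(i <- s) F i : B) : (kcar B)^c^o) \in positive_part.
Proof.
move=> sF; rewrite big_seq.
exact: (big_ind (fun y : B => (y : (kcar B)^c^o) \in positive_part)).
Qed.

Let pos_deg n (x : B) : x \in gdeg B n.+1 ->
  (x : (kcar B)^c^o) \in positive_part.
Proof.
move=> xn; apply/positive_partP; exists [:: x].
by split=> [y|]; [rewrite inE => /eqP->; exists n | rewrite big_seq1].
Qed.

Let posMr (x b : B) : (x : (kcar B)^c^o) \in positive_part ->
  ((x * b : B) : (kcar B)^c^o) \in positive_part.
Proof.
case/positive_partP=> s [sP ->]; have [_ _ DM [_ span _]] := gdegP B.
have [t [c [cD ->]]] := span b; rewrite mulr_suml; apply: pos_sum => y /sP[n yn].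
rewrite mulr_sumr; apply: pos_sum => j _.
by apply: (@pos_deg (n + j)%N); apply: DM yn (cD j).
Qed.

Let posMdeg n (x b : B) : b \in gdeg B n.+1 ->
  ((x * b : B) : (kcar B)^c^o) \in positive_part.
Proof.
move=> bn; have [_ _ DM [_ span _]] := gdegP B.
have [t [c [cD ->]]] := span x; rewrite mulr_suml; apply: pos_sum => j _.
by apply: (@pos_deg (j + n)%N); rewrite -addnS; apply: DM (cD j) bn.
Qed.

Fact positive_part_closed : submod_closed positive_part.
Proof. by split=> [|b x y xp yp]; [exact: pos0 | exact: (posD (posMr b xp) yp)]. Qed.

Definition positive_submodule : submodule (kcar B)^c^o :=
  Submodule positive_part_closed.

Definition trivial_deg (i : int) : {pred quotmod positive_submodule} :=
  fun u => (i == 0) || (u == 0).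

Fact trivial_degP : internal_direct_sum trivial_deg.
Proof.
split=> [i|u|s c us cD c0 i si].
- split=> [|u v]; rewrite /in_mem /= /trivial_deg.
    by rewrite eqxx orbT.
  by case: eqP => //= _ /eqP-> /eqP->; rewrite subr0.
- exists [:: 0], (fun i => if i == 0 then u else 0); split=> [i|].
    by rewrite /in_mem /= /trivial_deg; case: (i == 0); rewrite /= ?eqxx.
  by rewrite big_seq1 eqxx.
- have cj0 j : j != 0 -> c j = 0.
    by move=> j0; have := cD j; rewrite /in_mem /= /trivial_deg (negPf j0) => /eqP.
  have [i0|/cj0//] := eqVneq i 0.
  move: c0; rewrite (bigD1_seq i) //= big1 ?addr0 // => j ji.
  by apply: cj0; rewrite -i0.
Qed.

Fact trivial_act i j u (b : B) : u \in trivial_deg i -> b \in gdeg B j ->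
  (b : (kcar B)^c) *: u \in trivial_deg (i + j%:Z).
Proof.
rewrite /in_mem /= /trivial_deg => /orP[/eqP->|/eqP->] bj; last first.
  by rewrite scaler0 eqxx orbT.
case: j bj => [//|j] bj; apply/orP; right; apply/eqP.
rewrite -[u]qmod_reprK -qmodZ; apply/qmod_eq0.
exact: (posMdeg (qmod_repr u : B) bj).
Qed.

(* B / B_{>= 1}; [(kcar B)^c^o] is B as a right module over itself.           *)
Definition trivial_module : grmodule := GrModule trivial_degP trivial_act.

Definition generalized_koszul : Prop :=
  [/\ forall n, fin_dim (gdeg B n),
      forall n, (0 < n)%N ->
        projective (left_component B n) /\ projective (right_component B n)
    & exists P : gr_resolution trivial_module,
        forall n : nat, generated_in_degree (P n) n%:Z].

End GradedModules.

Section Filtrations.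
Variables (K : fieldType) (A : kalgebra K).

Record filtration := Filtration {
  fil :> nat -> {pred A};
  fil_submod : forall i, submod_closed (fil i);
  filS : forall i x, x \in fil i -> x \in fil i.+1;
  fil1 : 1 \in fil 0%N;
  filM : forall i j x y, x \in fil i -> y \in fil j -> x * y \in fil (i + j)%N
}.
Arguments fil : clear implicits.
Arguments fil_submod : clear implicits.
Arguments fil1 : clear implicits.

Variable F : filtration.

Definition fil_module i : submodule A := Submodule (fil_submod F i).

(* F_{i-1} inside F_i, with F_{-1} = 0.                                       *)
Definition fil_prev i : {pred submod_type (fil_module i)} := fun x =>
  if i is i1.+1 then submod_val x \in fil F i1 else submod_val x == 0.

Fact fil_prev_closed i : submod_closed (@fil_prev i).
Proof.
case: i => [|i].
  split=> [|k x y]; first by rewrite /in_mem /= /fil_prev /=.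
  rewrite /in_mem /= /fil_prev /= => /eqP x0 /eqP y0.
  by rewrite x0 y0 scaler0 addr0.
have [F0 FD] := fil_submod F i.
by split=> [|k x y xF yF]; [apply: F0 | apply: FD].
Qed.

Definition gr_piece i : lmodType K := quotmod (Submodule (@fil_prev_closed i)).

Definition gr_class i (x : A) (xF : x \in fil F i) : gr_piece i :=
  qmod (Submodule (@fil_prev_closed i)) (@SubmodElt _ _ (fil_module i) x xF).

Definition gr_repr i (u : gr_piece i) : submod_type (fil_module i) :=
  qmod_repr (u : quotmod (Submodule (@fil_prev_closed i))).

Definition gr_op i j (u : gr_piece i) (v : gr_piece j) : gr_piece (i + j)%N :=
  gr_class (filM (submod_valP (gr_repr u)) (submod_valP (gr_repr v))).

Definition fpred i : {pred A} := fun x =>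
  if i is i1.+1 then x \in fil F i1 else x == 0.

Lemma gr_reprK i (u : gr_piece i) : gr_class (submod_valP (gr_repr u)) = u.
Proof.
by rewrite -[RHS]qmod_reprK /gr_class; congr qmod; apply: val_inj.
Qed.

Lemma gr_classP i x y (xF : x \in fil F i) (yF : y \in fil F i) :
  gr_class xF = gr_class yF <-> x - y \in fpred i.
Proof. by rewrite /gr_class qmodP; case: i xF yF. Qed.

Lemma gr_repr_class i x (xF : x \in fil F i) :
  submod_val (gr_repr (gr_class xF)) - x \in fpred i.
Proof. by have /gr_classP := gr_reprK (gr_class xF). Qed.

Lemma fpred0 i : 0 \in fpred i.
Proof.
case: i => [|i]; rewrite /in_mem /= /fpred ?eqxx //.
by case: (fil_submod F i).
Qed.

Lemma fpredD i x y : x \in fpred i -> y \in fpred i -> x + y \in fpred i.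
Proof.
case: i => [/eqP->|i xi yi]; first by rewrite add0r.
by have [_ FD] := fil_submod F i; rewrite -[x]scale1r; apply: FD.
Qed.

Lemma fpredMl i j x y : x \in fil F i -> y \in fpred j -> x * y \in fpred (i + j)%N.
Proof.
case: j => [xi /eqP->|j xi yj]; first by rewrite mulr0 fpred0.
by rewrite addnS; apply: filM xi yj.
Qed.

Lemma fpredMr i j x y : x \in fpred i -> y \in fil F j -> x * y \in fpred (i + j)%N.
Proof.
case: i => [/eqP-> _|i xi yj]; first by rewrite mul0r fpred0.
by rewrite addSn; apply: filM xi yj.
Qed.

Lemma gr_opE i j x y (xF : x \in fil F i) (yF : y \in fil F j) :
  gr_op (gr_class xF) (gr_class yF) = gr_class (filM xF yF).
Proof.
apply/gr_classP; set x' := submod_val (gr_repr (gr_class xF)).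
set y' := submod_val (gr_repr (gr_class yF)).
have -> : x' * y' - x * y = (x' - x) * y' + x * (y' - y).
  by rewrite mulrBl mulrBr addrA subrK.
apply: fpredD; first exact: (fpredMr (gr_repr_class xF) (submod_valP (gr_repr (gr_class yF)))).
exact: (fpredMl xF (gr_repr_class yF)).
Qed.

Lemma gr_classD i x y (xF : x \in fil F i) (yF : y \in fil F i)
  (xyF : x + y \in fil F i) : gr_class xF + gr_class yF = gr_class xyF.
Proof.
by rewrite -[LHS]qmodD /gr_class; congr qmod; apply: val_inj.
Qed.

Lemma gr_classZ i k x (xF : x \in fil F i) (kxF : k *: x \in fil F i) :
  k *: gr_class xF = gr_class kxF.
Proof.
by rewrite -[LHS]qmodZ /gr_class; congr qmod; apply: val_inj.
Qed.

Lemma gr_class_eq i x y (xF : x \in fil F i) (yF : y \in fil F i) :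
  x = y -> gr_class xF = gr_class yF.
Proof. by move=> xy; apply/gr_classP; rewrite xy subrr fpred0. Qed.

Lemma gr_ind i (P : gr_piece i -> Prop) :
  (forall x (xF : x \in fil F i), P (gr_class xF)) -> forall u, P u.
Proof. by move=> PF u; rewrite -[u]gr_reprK; apply: PF. Qed.

Let filD i x y : x \in fil F i -> y \in fil F i -> x + y \in fil F i.
Proof. by case: (fil_submod F i) => _ FD xF yF; rewrite -[x]scale1r FD. Qed.

Let filZ i k x : x \in fil F i -> k *: x \in fil F i.
Proof. by case: (fil_submod F i) => F0 FD xF; rewrite -[_ *: _]addr0 FD. Qed.

Fact gr_opDl i j (u u' : gr_piece i) (v : gr_piece j) :
  gr_op (u + u') v = gr_op u v + gr_op u' v.
Proof.
elim/gr_ind: u => x xF; elim/gr_ind: u' => x' x'F; elim/gr_ind: v => y yF.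
rewrite (gr_classD _ _ (filD xF x'F)) !gr_opE.
rewrite (gr_classD _ _ (filD (filM xF yF) (filM x'F yF))).
by apply: gr_class_eq; rewrite mulrDl.
Qed.

Fact gr_opDr i j (u : gr_piece i) (v v' : gr_piece j) :
  gr_op u (v + v') = gr_op u v + gr_op u v'.
Proof.
elim/gr_ind: u => x xF; elim/gr_ind: v => y yF; elim/gr_ind: v' => y' y'F.
rewrite (gr_classD _ _ (filD yF y'F)) !gr_opE.
rewrite (gr_classD _ _ (filD (filM xF yF) (filM xF y'F))).
by apply: gr_class_eq; rewrite mulrDr.
Qed.

Fact gr_opZl i j k (u : gr_piece i) (v : gr_piece j) :
  gr_op (k *: u) v = k *: gr_op u v.
Proof.
elim/gr_ind: u => x xF; elim/gr_ind: v => y yF.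
rewrite (gr_classZ _ (filZ k xF)) !gr_opE (gr_classZ _ (filZ k (filM xF yF))).
by apply: gr_class_eq; rewrite kscalerAl.
Qed.

Fact gr_opZr i j k (u : gr_piece i) (v : gr_piece j) :
  gr_op u (k *: v) = k *: gr_op u v.
Proof.
elim/gr_ind: u => x xF; elim/gr_ind: v => y yF.
rewrite (gr_classZ _ (filZ k yF)) !gr_opE (gr_classZ _ (filZ k (filM xF yF))).
by apply: gr_class_eq; rewrite kscalerAr.
Qed.

Lemma gr_dincl_eq i j x y (xF : x \in fil F i) (yF : y \in fil F j) :
  i = j -> x = y -> @dincl _ gr_piece _ (gr_class xF) = dincl (gr_class yF).
Proof.
by move=> ij; case: j / ij yF => yF xy; congr dincl; apply: gr_class_eq.
Qed.

Fact gr_opA i j l (u : gr_piece i) (v : gr_piece j) (w : gr_piece l) :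
  @dincl _ gr_piece _ (gr_op u (gr_op v w)) = dincl (gr_op (gr_op u v) w).
Proof.
elim/gr_ind: u => x xF; elim/gr_ind: v => y yF; elim/gr_ind: w => z zF.
by rewrite !gr_opE; apply: gr_dincl_eq; [apply: addnA | apply: mulrA].
Qed.

Fact gr_op1l i (u : gr_piece i) :
  @dincl _ gr_piece _ (gr_op (gr_class (fil1 F)) u) = dincl u.
Proof.
by elim/gr_ind: u => x xF; rewrite gr_opE; apply: gr_dincl_eq; rewrite ?mul1r.
Qed.

Fact gr_op1r i (u : gr_piece i) :
  @dincl _ gr_piece _ (gr_op u (gr_class (fil1 F))) = dincl u.
Proof.
elim/gr_ind: u => x xF; rewrite gr_opE.
by apply: gr_dincl_eq; rewrite ?addn0 ?mulr1.
Qed.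

Definition gr_graded_mul : graded_mul gr_piece :=
  GradedMul gr_opDl gr_opDr gr_opZl gr_opZr gr_opA gr_op1l gr_op1r.

Definition gr : gralgebra K := graded_sum_algebra gr_graded_mul.

End Filtrations.

Section NaturalFiltration.
Variables (K : fieldType) (A : gralgebra K) (I : ideal A).
Notation U := (quot_kalgebra I).

Definition natural_fil i : {pred U} := fun u =>
  `[< exists c : nat -> A, (forall j, c j \in gdeg A j) /\
        u = qalg I (\sum_(0 <= j < i.+1) c j) >].

Lemma natural_filP i (u : U) :
  reflect (exists c : nat -> A, (forall j, c j \in gdeg A j) /\
             u = qalg I (\sum_(0 <= j < i.+1) c j))
          (u \in natural_fil i).
Proof. exact: asboolP. Qed.

Let deg_submod n : submod_closed (gdeg A n).
Proof. by case: (gdegP A). Qed.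

Let deg0 n : 0 \in gdeg A n. Proof. by case: (deg_submod n). Qed.

Fact natural_fil_submod i : submod_closed (natural_fil i).
Proof.
split=> [|k u v /natural_filP[c [cD ->]] /natural_filP[d [dD ->]]].
  by apply/natural_filP; exists (fun=> 0); rewrite big1 // qalg0.
apply/natural_filP; exists (fun j => k *: c j + d j); split=> [j|].
  by case: (deg_submod j) => _; apply.
by rewrite big_split /= -scaler_sumr qalgD qalgZ.
Qed.

Lemma natural_fil_deg i j x :
  x \in gdeg A j -> (j <= i)%N -> qalg I x \in natural_fil i.
Proof.
move=> xj ji; apply/natural_filP; exists (fun l => if l == j then x else 0).
split=> [l|]; first by case: eqP => // ->.
rewrite (bigD1_seq j) ?mem_index_iota ?iota_uniq //= eqxx big1 ?addr0 //.
by move=> l /negPf->.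
Qed.

Lemma natural_fil_sum i (T : eqType) (s : seq T) (f : T -> U) :
  (forall j, j \in s -> f j \in natural_fil i) ->
  \sum_(j <- s) f j \in natural_fil i.
Proof.
have [F0 FD] := natural_fil_submod i.
move=> sf; rewrite big_seq; apply: (big_ind (fun u => u \in natural_fil i)) => //.
by move=> u v uF vF; rewrite -[u]scale1r; apply: FD.
Qed.

Fact natural_filS i u : u \in natural_fil i -> u \in natural_fil i.+1.
Proof.
case/natural_filP=> c [cD ->]; rewrite qalg_sum; apply: natural_fil_sum => j.
rewrite mem_index_iota => /andP[_ ji].
by apply: natural_fil_deg (cD j) _; rewrite ltnW.
Qed.

Fact natural_fil1 : (1 : U) \in natural_fil 0%N.
Proof. by apply: (@natural_fil_deg 0 0 1) => //; case: (gdegP A). Qed.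

Fact natural_filM i j (u v : U) : u \in natural_fil i -> v \in natural_fil j ->
  u * v \in natural_fil (i + j)%N.
Proof.
move=> /natural_filP[c [cD ->]] /natural_filP[d [dD ->]].
rewrite -[_ * _]/(qalg I _ * qalg I _) -qalgMr mulr_suml qalg_sum.
apply: natural_fil_sum => l; rewrite mem_index_iota => /andP[_ li].
rewrite mulr_sumr qalg_sum; apply: natural_fil_sum => l'.
rewrite mem_index_iota => /andP[_ l'j].
case: (gdegP A) => _ _ DM _; apply: natural_fil_deg (DM _ _ _ _ (cD l) (dD l')) _.
by rewrite leq_add.
Qed.

Definition natural_filtration : filtration U :=
  Filtration natural_fil_submod natural_filS natural_fil1 natural_filM.

End NaturalFiltration.

Definition gralgebra_iso (K : fieldType) (A B : gralgebra K) : Prop :=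
  exists f : {linear A -> B},
    [/\ bijective f, {morph f : x y / x * y}, f 1 = 1
      & forall n x, f x \in gdeg B n <-> x \in gdeg A n].

Definition pbw_deformation (K : fieldType) (A : gralgebra K) (I : ideal A)
    (B : gralgebra K) : Prop :=
  gralgebra_iso (gr (natural_filtration I)) B.

Section Quadratic.
Variables (K : fieldType) (S : kalgebra K) (M : bimodType S).
Variable R : subbimodule (tensor M M).

Definition quadratic_rel (x : tensor_algebra M) : Prop :=
  exists r : subbimod_type R, x = @tensor_incl K S M 2 (subbimod_val r).

Fact quadratic_rel_homog x :
  quadratic_rel x -> exists n, x \in gdeg (tensor_algebra M) n.
Proof.
by case=> r ->; exists 2; apply/graded_sum_degP; exists (subbimod_val r).
Qed.

Definition quadratic_algebra : gralgebra K := quot_gralgebra quadratic_rel_homog.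

Definition deformed_rel (theta : subbimod_type R -> S)
    (x : tensor_algebra M) : Prop :=
  exists r : subbimod_type R,
    x = @tensor_incl K S M 2 (subbimod_val r) - @tensor_incl K S M 0 (theta r).

End Quadratic.

(* Main.v *)
From HB Require Import structures.
Require Import Defs.
Set Warnings "-notation-overridden,-ambiguous-paths,-redundant-canonical-projection,-projection-no-head-constant".
From mathcomp Require Import all_boot all_order all_algebra.
From mathcomp Require Import boolp.

Import GRing.Theory.
Local Open Scope ring_scope.

Set Implicit Arguments.
Unset Strict Implicit.
Unset Printing Implicit Defensive.

(** Write T for the tensor algebra of M, Q for the ideal (R) and I for the
    ideal generated by the r - theta r, so that B = T / Q and U = T / I.

    Suppose that gr U is isomorphic to B.  Then S maps onto gr_0 U, which has
    the dimension of B_0 = S, so S embeds in U ([deformation_scalars_inj]).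
    The scalars theta (s r) - s theta r and theta (r s) - (theta r) s lie in I,
    hence vanish.

    Conversely let theta be a bimodule morphism.  The symbol map from T to gr U
    is a surjective morphism of graded algebras, and it has kernel Q as soon as
    the component of degree n of any element of I of degree at most n lies in Q
    ([deformed_top], [deformation_of_top]).  The obstruction is cancellation: in
    a sum of products t (r - theta r) t' the leading terms t r t' may cancel and
    leave an unexpected element of lower degree.  Such cancellations are
    governed by the map from R (x)_S B to M (x)_S B, whose kernel is the third
    syzygy of S_B; projective dimension 2 makes this map injective, so that the
    only cancellations left are those that come from S-linearity and from the
    relations themselves, and these are harmless.

    Tensor products over S are avoided by means of a dual basis (v_i, phi_i) of
    the right S-module M.  It gives contractions D_i of T, of degree -1, such
    that x = x_0 + sum_i v_i D_i(x) ([partial_expand]).  If r_1, ..., r_N span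
    R, then S_B has a presentation by finite free graded modules

      B^N(-2) + B^d(-1)  ->  B^d(-1)  ->  B  ->  S_B

    in which the first map has the entries D_i(r_k) on the first summand and is
    the idempotent complementary to (phi_i(v_j)) on the second; B^d is M (x) B
    plus a complement killed by the v_i.  Comparing this presentation with a
    projective resolution of length 2 yields an endomorphism of the first module
    that is compatible with the differential and kills its kernel
    ([second_syzygy_split]).  Its part of degree 0 is a matrix c over S with
    r_k = sum_l r_l c_kl and such that sum_k D_i(r_k) b_k = 0 in B for all i
    implies sum_k c_kl b_k = 0 in B for all l ([relation_syzygies]); this is the
    injectivity of R (x) B -> M (x) B in coordinates.

    Now filter I by the subspaces J_n spanned by the products
    m_1 ... m_i (r - theta r) t of formal degree at most n ([relfil]).  The
    heart of the proof is that an element of J_(n+1) without component of degree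
    n+1 lies in J_n ([relfil_strict]).  Modulo J_n such an element is
    sum_k (r_k - theta r_k) t_k + sum_i v_i y_i with y_i in J_n.  Contracting its
    leading term shows that sum_k D_i(r_k) t_k is in Q, hence so are the
    q_l = sum_k c_kl t_k.  By right linearity of theta the first sum equals
    sum_l (r_l - theta r_l) q_l, where q_l may be replaced, up to lower degree,
    by an element of J, so that the first sum is absorbed in the second one.
    What remains is of the form sum_i v_i D_i(x'), and induction on n applies to
    D_i(x'), which is in J_n by left linearity of theta. *)

Arguments gm_deg {K B} g i : rename.

(** * Homogeneous components *)

Section DirectSumDecompositions.
Variables (I : eqType) (V : zmodType) (D : I -> {pred V}).
Hypothesis D_sum : internal_direct_sum D.

Lemma homog0 i : 0 \in D i.
Proof. by case: D_sum => /(_ i) []. Qed.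

Lemma homogB i x y : x \in D i -> y \in D i -> x - y \in D i.
Proof. by case: D_sum => /(_ i) [_ DB] _ _; apply: DB. Qed.

Lemma homogD i x y : x \in D i -> y \in D i -> x + y \in D i.
Proof. by move=> xi yi; rewrite -[y]opprK -[- y]sub0r homogB // homogB // homog0. Qed.

(** Puts sums over different index sequences on a common one. *)
Lemma sum_over_superset (s t : seq I) (c : I -> V) :
  uniq s -> uniq t -> {subset s <= t} ->
  \sum_(i <- s) c i = \sum_(i <- t) (if i \in s then c i else 0).
Proof.
move=> us ut st; rewrite -big_mkcond -big_filter; apply: perm_big.
apply: uniq_perm; rewrite ?filter_uniq // => i; rewrite mem_filter.
by case si: (i \in s) => //; rewrite st.
Qed.

Lemma homogeneous_decomposition x : exists (s : seq I) (c : I -> V),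
  [/\ uniq s, forall i, c i \in D i & x = \sum_(i <- s) c i].
Proof.
case: (D_sum) => _ /(_ x) [s [c [cD ->]]] _ {x}.
elim: s => [|i s [t [d [ut dD dE]]]].
  by exists [::], (fun=> 0); split=> // [i|]; rewrite ?homog0 // !big_nil.
pose u := undup (i :: t).
exists u, (fun j => (if j \in [:: i] then c j else 0) + (if j \in t then d j else 0)).
split=> [|j|]; first exact: undup_uniq.
  by apply: homogD; case: ifP; rewrite // homog0.
rewrite big_cons {}dE big_split /= -!sum_over_superset ?undup_uniq ?big_seq1 //.
  by move=> j jt; rewrite mem_undup inE jt orbT.
by move=> j; rewrite mem_undup !inE => ->.
Qed.

Lemma homogeneous_component (s : seq I) (c : I -> V) i y :
  uniq s -> (forall j, c j \in D j) -> y \in D i ->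
  \sum_(j <- s) c j = y -> y = if i \in s then c i else 0.
Proof.
move=> us cD yi sy; have [_ _ indep] := D_sum.
have [u uu [su iu]] : exists2 u, uniq u & {subset s <= u} /\ i \in u.
  exists (undup (i :: s)); first exact: undup_uniq.
  by split=> [j js|]; rewrite mem_undup inE ?eqxx ?js ?orbT.
pose d j := (if j \in s then c j else 0) - (if j \in [:: i] then y else 0).
have dD j : d j \in D j.
  rewrite /d; apply: homogB; first by case: ifP; rewrite ?homog0.
  by case: ifP; rewrite ?homog0 // inE => /eqP->.
have d0 : \sum_(j <- u) d j = 0.
  rewrite /d big_split /= sumrN -(sum_over_superset c us uu su) sy.
  have iu' : {subset [:: i] <= u} by move=> j; rewrite inE => /eqP->.
  have <- := sum_over_superset (s := [:: i]) (fun=> y) isT uu iu'.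
  by rewrite big_seq1 subrr.
have /eqP := indep u d uu dD d0 i iu.
by rewrite /d mem_head subr_eq0 => /eqP->.
Qed.

End DirectSumDecompositions.

(** * Graded modules: images and lifting *)

Section ImageModule.
Variables (K : fieldType) (B : gralgebra K) (E F : grmodule B) (g : grhom E F).

(** A homogeneous map sends the component of degree i of a preimage to the
    component of degree i of the image, so that component is a preimage too. *)
Lemma homogeneous_preimage i x : g x \in gm_deg F i ->
  exists2 x', x' \in gm_deg E i & g x' = g x.
Proof.
move=> gxi; have [s [c [us cD xE]]] := homogeneous_decomposition (gm_degP E) x.
exists (if i \in s then c i else 0).
  by case: ifP => // _; apply: homog0 (gm_degP E) i.
have gx : \sum_(j <- s) g (c j) = g x by rewrite xE linear_sum.
have cgD j : g (c j) \in gm_deg F j by apply: grhom_deg.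
rewrite [RHS](homogeneous_component (c := fun j => g (c j)) (gm_degP F) us cgD gxi gx).
by case: ifP; rewrite ?linear0.
Qed.

Definition image_pred : {pred F} := fun y => `[< exists x, g x = y >].

Fact image_closed : submod_closed image_pred.
Proof.
split=> [|a y z /asboolP[x <-] /asboolP[x' <-]]; apply/asboolP.
  by exists 0; rewrite linear0.
by exists (a *: x + x'); rewrite linearP.
Qed.

Definition image_sub : submodule F := Submodule image_closed.

Definition image_deg (i : int) : {pred submod_type image_sub} :=
  fun y => submod_val y \in gm_deg F i.

Fact image_degP : internal_direct_sum image_deg.
Proof.
split=> [i|[y yP]|s c us cD c0 i si].
- split=> [|x y xi yi]; first exact: homog0 (gm_degP F) i.
  exact: (homogB (gm_degP F) xi yi).
- have /asboolP[x xE] := yP.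
  have [s [c [us cD cE]]] := homogeneous_decomposition (gm_degP E) x.
  have cP i : g (c i) \in image_pred by apply/asboolP; exists (c i).
  exists s, (fun i => SubmodElt (W := image_sub) (cP i)); split=> [i|].
    exact: grhom_deg.
  apply: val_inj; rewrite raddf_sum /= -xE cE linear_sum.
  by apply: eq_bigr.
- have [_ _ indep] := gm_degP F; apply: val_inj.
  have vc0 : \sum_(j <- s) val (c j) = 0.
    by have := congr1 val c0; rewrite raddf_sum.
  exact: (indep s (fun j => val (c j)) us cD vc0 i si).
Qed.

Fact image_act i j (y : submod_type image_sub) (b : B) :
  y \in image_deg i -> b \in gdeg B j ->
  (b : (kcar B)^c) *: y \in image_deg (i + j%:Z).
Proof. exact: gm_act. Qed.

Definition image_module : grmodule B := GrModule image_degP image_act.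

Section Corestriction.
Variables (P : grmodule B) (f : grhom P F).
Hypothesis fg : forall p, exists x, g x = f p.

Definition corestr (p : P) : image_module :=
  SubmodElt (W := image_sub) (asboolT (fg p)).

Fact corestr_linear : linear corestr.
Proof. by move=> a p q; apply: val_inj; rewrite /= linearP. Qed.

HB.instance Definition _ :=
  GRing.isLinear.Build (kcar B)^c P image_module _ corestr corestr_linear.

Fact corestr_deg i p : p \in gm_deg P i -> corestr p \in gm_deg image_module i.
Proof. exact: grhom_deg. Qed.

Definition corestr_hom : grhom P image_module := GrHom corestr_deg.

End Corestriction.

(** Projectivity lifts along surjections; replacing the target by the image of g
    gives lifting along any g whose image contains that of f. *)
Lemma graded_projective_lift (P : grmodule B) (f : grhom P F) :
  graded_projective P -> (forall p, exists x, g x = f p) ->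
  exists h : grhom P E, forall p, g (h p) = f p.
Proof.
move=> Pproj fg; pose g_im x : exists x', g x' = g x := ex_intro _ x erefl.
have [y|h hP] := Pproj _ _ (corestr_hom g_im) (corestr_hom fg).
  case: y => y yP; have /asboolP[x xE] := yP.
  by exists x; apply: val_inj.
by exists h => p; have /(congr1 val) := hP p.
Qed.

End ImageModule.

(** * Finite free graded modules *)

Section FreeModules.
Variables (K : fieldType) (B : gralgebra K).

(** The grading of B indexed by the integers, so that degrees can be shifted. *)
Definition zdeg (i : int) : {pred B} := fun b =>
  match i with Posz n => b \in gdeg B n | Negz _ => b == 0 end.

Lemma gdeg0 n : 0 \in gdeg B n.
Proof. by case: (gdegP B) => /(_ n) []. Qed.

Fact zdeg_degP : internal_direct_sum zdeg.
Proof.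
have [gsub _ _ [gz span indep]] := gdegP B.
split=> [[n|n]|b|s c us cD c0 i si].
- exact: (gz n).
- split=> [|x y]; first exact: eqxx.
  by move=> /eqP-> /eqP->; rewrite subr0 [_ \in _]eqxx.
- have [s [c [cD bE]]] := span b.
  exists [seq Posz n | n <- s], (fun i => if i is Posz n then c n else 0).
  split=> [[n|n]|]; [exact: cD | exact: eqxx |].
  by rewrite big_map bE.
- have cN n : c (Negz n) = 0 by apply/eqP/(cD (Negz n)).
  case: i si => n si; last exact: cN.
  pose s' := [seq `|i|%N | i <- s & (0 <= i)%R].
  have us' : uniq s'.
    rewrite map_inj_in_uniq ?filter_uniq // => -[x|x] [y|y];
      rewrite !mem_filter //= => _ _; first by move=> /= ->.
  apply: (indep s' (fun n => c (Posz n)) us' (fun n => cD (Posz n))).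
    rewrite -[RHS]c0 /s' big_map big_filter big_mkcond.
    by apply: eq_bigr => -[m|m] _ //=; rewrite cN.
  by apply/mapP; exists (Posz n); rewrite ?mem_filter.
Qed.

Lemma zdegM i n a b : a \in zdeg i -> b \in gdeg B n -> a * b \in zdeg (i + n%:Z).
Proof.
case: i => [m|m] ai bn.
  by have [_ _ DM _] := gdegP B; apply: DM ai bn.
by move/eqP: ai => ->; rewrite mul0r; case: (zdeg_degP) => /(_ (Negz m + n%:Z)) [].
Qed.

Variables (I : finType) (delta : I -> int).

(** The right module with basis I, the k-th basis vector being placed in degree
    [delta k].  Right B-modules are left modules over the converse ring, so that
    b acts on the coefficients by multiplication on the right ([fcoefZ]). *)
Definition free_module : lmodType (kcar B)^c := {ffun I -> (kcar B)^c^o}.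
Implicit Types (f : free_module).

Definition fcoef f k : B := (f : {ffun I -> (kcar B)^c^o}) k.

Lemma fcoefP f g : (forall k, fcoef f k = fcoef g k) -> f = g.
Proof. by move=> fg; apply/ffunP. Qed.
Lemma fcoefD f g k : fcoef (f + g) k = fcoef f k + fcoef g k.
Proof. by rewrite /fcoef ffunE. Qed.
Lemma fcoefN f k : fcoef (- f) k = - fcoef f k.
Proof. by rewrite /fcoef ffunE. Qed.
Lemma fcoef0 k : fcoef 0 k = 0.
Proof. by rewrite /fcoef ffunE. Qed.
Lemma fcoefZ (b : B) f k : fcoef ((b : (kcar B)^c) *: f) k = fcoef f k * b.
Proof. by rewrite /fcoef ffunE. Qed.
Lemma fcoef_sum J (s : seq J) (F : J -> free_module) k :
  fcoef (\sum_(j <- s) F j) k = \sum_(j <- s) fcoef (F j) k.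
Proof.
by elim: s => [|j s IH]; rewrite ?big_nil ?fcoef0 // !big_cons fcoefD IH.
Qed.

Definition free_deg i : {pred free_module} :=
  fun f => [forall k, fcoef f k \in zdeg (i - delta k)].

Lemma in_free_degP i f :
  reflect (forall k, fcoef f k \in zdeg (i - delta k)) (f \in free_deg i).
Proof. exact: forallP. Qed.

Definition single k b : free_module :=
  [ffun j => if j == k then b else 0 : (kcar B)^c^o].

Lemma fcoef_single k b j : fcoef (single k b) j = if j == k then b else 0.
Proof. by rewrite /fcoef ffunE. Qed.

Fact free_degP : internal_direct_sum free_deg.
Proof.
split=> [i|f|s c us cD c0 i si].
- split=> [|f g /in_free_degP fi /in_free_degP gi]; apply/in_free_degP => k.
    by rewrite fcoef0; apply: homog0 zdeg_degP _.
  by rewrite fcoefD fcoefN; apply: (homogB zdeg_degP).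
- have /choice[s /choice[c cP]] k : exists s (c : int -> B),
    [/\ uniq s, forall i, c i \in zdeg i & fcoef f k = \sum_(i <- s) c i].
    exact: homogeneous_decomposition zdeg_degP _.
  pose t := undup (flatten [seq [seq i + delta k | i <- s k] | k <- enum I]).
  exists t, (fun i => [ffun k =>
    (if i - delta k \in s k then c k (i - delta k) else 0) : (kcar B)^c^o]).
  split=> [i|].
    apply/in_free_degP => k; rewrite /fcoef ffunE; have [_ ckD _] := cP k.
    by case: ifP => // _; apply: homog0 zdeg_degP _.
  apply: fcoefP => k; rewrite fcoef_sum; have [usk ckD ->] := cP k.
  have -> : \sum_(i <- s k) c k i
      = \sum_(i <- [seq i + delta k | i <- s k]) c k (i - delta k).
    by rewrite big_map; apply: eq_bigr => i _; rewrite addrK.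
  rewrite (@sum_over_superset _ _ _ t) ?undup_uniq //.
  + apply: eq_bigr => i _; rewrite /fcoef ffunE.
    have <- : (i - delta k + delta k \in [seq j + delta k | j <- s k])
        = (i - delta k \in s k).
      exact: (mem_map (@addIr _ (delta k))).
    by rewrite subrK.
  + by rewrite map_inj_uniq //; apply: addIr.
  + move=> i ik; rewrite mem_undup; apply/flatten_mapP; exists k => //.
    exact: mem_enum.
- apply: fcoefP => k; rewrite fcoef0.
  have [_ _ indep] := zdeg_degP.
  have := indep [seq j - delta k | j <- s] (fun j => fcoef (c (j + delta k)) k).
  rewrite map_inj_uniq ?us => [|x y /addIr//]; move=> /(_ isT).
  move=> H; rewrite -[i](subrK (delta k)); apply: H.
  + by move=> j; have /in_free_degP/(_ k) := cD (j + delta k); rewrite addrK.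
  + rewrite big_map -[RHS](fcoef0 k) -c0 fcoef_sum.
    by apply: eq_bigr => j _; rewrite subrK.
  + exact: map_f.
Qed.

Fact free_act i j f (b : B) : f \in free_deg i -> b \in gdeg B j ->
  (b : (kcar B)^c) *: f \in free_deg (i + j%:Z).
Proof.
move=> /in_free_degP fi bj; apply/in_free_degP => k; rewrite fcoefZ addrAC.
exact: zdegM.
Qed.

Definition free_grmodule : grmodule B := GrModule free_degP free_act.

Definition basis k : free_grmodule := single k 1.

Lemma fcoef_basis k j : fcoef (basis k) j = if j == k then 1 else 0.
Proof. exact: fcoef_single. Qed.

Lemma basis_deg k : basis k \in gm_deg free_grmodule (delta k).
Proof.
apply/in_free_degP => j; rewrite fcoef_basis; case: eqP => [->|_].
  by rewrite subrr; case: (gdegP B).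
exact: homog0 zdeg_degP _.
Qed.

Lemma free_expand (f : free_grmodule) :
  f = \sum_k (fcoef f k : (kcar B)^c) *: basis k.
Proof.
apply: fcoefP => j; rewrite fcoef_sum (bigD1 j) //= big1 => [|k kj].
  by rewrite addr0 fcoefZ fcoef_basis eqxx mul1r.
by rewrite fcoefZ fcoef_basis eq_sym (negPf kj) mul0r.
Qed.

(** Not restricted to homogeneous maps: it compares a [grhom] with a composite,
    which is only a linear map. *)
Lemma free_linear_eq (E : grmodule B) (f g : {linear free_grmodule -> E}) :
  (forall k, f (basis k) = g (basis k)) -> forall x, f x = g x.
Proof.
move=> fg x; rewrite (free_expand x) !linear_sum; apply: eq_bigr => k _.
by rewrite !linearZ /= fg.
Qed.

Section Universal.
Variables (E : grmodule B) (x : I -> E).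

Definition free_fun (f : free_grmodule) : E :=
  \sum_k (fcoef f k : (kcar B)^c) *: x k.

Fact free_fun_linear : linear free_fun.
Proof.
move=> a f g; rewrite /free_fun scaler_sumr -big_split; apply: eq_bigr => k _ /=.
by rewrite fcoefD fcoefZ scalerA -scalerDl.
Qed.

HB.instance Definition _ :=
  GRing.isLinear.Build (kcar B)^c free_grmodule E _ free_fun free_fun_linear.

Lemma free_fun_basis k : free_fun (basis k) = x k.
Proof.
rewrite /free_fun (bigD1 k) //= big1 => [|j jk].
  by rewrite addr0 fcoef_basis eqxx scale1r.
by rewrite fcoef_basis (negPf jk) scale0r.
Qed.

Hypothesis xD : forall k, x k \in gm_deg E (delta k).

Fact free_fun_deg i (f : free_grmodule) :
  f \in gm_deg free_grmodule i -> free_fun f \in gm_deg E i.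
Proof.
move=> /in_free_degP fi; apply: (big_ind (fun y => y \in gm_deg E i)).
- exact: homog0 (gm_degP E) i.
- exact: homogD (gm_degP E) i.
move=> k _; have := fi k; case ik: (i - delta k) => [n|n].
  by move=> fn; rewrite -[i](subrK (delta k)) ik addrC; apply: gm_act.
by move=> /eqP->; rewrite scale0r; apply: homog0 (gm_degP E) i.
Qed.

Definition free_hom : grhom free_grmodule E := GrHom free_fun_deg.

Lemma free_homE f : free_hom f = \sum_k (fcoef f k : (kcar B)^c) *: x k.
Proof. by []. Qed.

End Universal.

(** Elementary for free modules: choose homogeneous preimages of the images of
    the basis vectors. *)
Lemma free_lift (E F : grmodule B) (g : grhom E F) (f : grhom free_grmodule F) :
  (forall k, exists x, g x = f (basis k)) ->
  exists h : grhom free_grmodule E, forall x, g (h x) = f x.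
Proof.
move=> fg.
have /choice[x xP] k : exists x, x \in gm_deg E (delta k) /\ g x = f (basis k).
  have [x gx] := fg k.
  have : g x \in gm_deg F (delta k) by rewrite gx; apply/grhom_deg/basis_deg.
  by case/homogeneous_preimage=> x' x'D gx'; exists x'; rewrite gx' gx.
exists (free_hom (fun k => (xP k).1)).
set h := free_hom (fun _ => _).
apply: (@free_linear_eq F (g \o h : {linear _ -> _}) f) => k /=.
by rewrite free_fun_basis (xP k).2.
Qed.

End FreeModules.

(** * Comparison with a resolution of length two *)

Section Comparison.
Variables (K : fieldType) (B : gralgebra K) (N : grmodule B).
Variables (I0 I1 I2 : finType).
Variables (e0 : I0 -> int) (e1 : I1 -> int) (e2 : I2 -> int).
Notation F0 := (free_grmodule B e0).
Notation F1 := (free_grmodule B e1).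
Notation F2 := (free_grmodule B e2).
Variables (d2 : grhom F2 F1) (d1 : grhom F1 F0) (aug : grhom F0 N).
Hypothesis aug_surj : forall y, exists x, aug x = y.
Hypothesis ex0 : forall x, aug x = 0 <-> exists y, d1 y = x.
Hypothesis ex1 : forall x, d1 x = 0 <-> exists y, d2 y = x.

Lemma grhom_comp_ex (P Q R : grmodule B) (g : grhom Q R) (f : grhom P Q) :
  exists h : grhom P R, forall x, h x = g (f x).
Proof.
have hD i x : x \in gm_deg P i -> (g \o f) x \in gm_deg R i.
  by move=> xi; do 2!apply: grhom_deg.
by exists (GrHom hD).
Qed.

Lemma grhom_sub_ex (P Q : grmodule B) (f g : grhom P Q) :
  exists h : grhom P Q, forall x, h x = f x - g x.
Proof.
have hD i x : x \in gm_deg P i -> (f \- g) x \in gm_deg Q i.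
  by move=> xi; apply: (homogB (gm_degP Q)); apply: grhom_deg.
by exists (GrHom hD).
Qed.

(** Let Q be a resolution with Q_3 = 0, and let a : Q -> F and b : F -> Q be
    comparison maps in degrees 0, 1 and 2.  A homotopy (h0, h1) from the identity
    of F to a b gives d2 h1 = 1 - a1 b1 - h0 d1, so that tau = a2 b2 + h1 d2
    satisfies d2 tau = d2.  It kills the kernel of d2 because b2 does, as the
    differential of Q_2 is injective.  In other words tau is the projection of
    F2 onto a copy of the image of d2. *)
Lemma second_syzygy_split : proj_dim_le N 2 ->
  exists tau : grhom F2 F2,
    (forall x, d2 (tau x) = d2 x) /\ (forall x, d2 x = 0 -> tau x = 0).
Proof.
case=> Q Q3.
have d1d2 x : d1 (d2 x) = 0 by apply/ex1; exists x.
have augd1 x : aug (d1 x) = 0 by apply/ex0; exists x.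
have q1q2 x : res_d Q 0 (res_d Q 1 x) = 0 by apply/res_exact; exists x.
have q0q1 x : res_aug Q (res_d Q 0 x) = 0 by apply/res_exact0; exists x.
have q2_inj x : res_d Q 1 x = 0 -> x = 0.
  by case/res_exact=> y <-; rewrite (Q3 3 isT y) linear0.
have [a0 a0P] : exists a0 : grhom (Q 0) F0, forall x, aug (a0 x) = res_aug Q x.
  by apply: graded_projective_lift => //; apply: res_proj.
have [a0q a0qE] := grhom_comp_ex a0 (res_d Q 0).
have [a1 a1P] : exists a1 : grhom (Q 1) F1, forall x, d1 (a1 x) = a0q x.
  apply: graded_projective_lift => [|x]; first exact: res_proj.
  by apply/ex0; rewrite a0qE a0P.
have [a1q a1qE] := grhom_comp_ex a1 (res_d Q 1).
have [a2 a2P] : exists a2 : grhom (Q 2) F2, forall x, d2 (a2 x) = a1q x.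
  apply: graded_projective_lift => [|x]; first exact: res_proj.
  by apply/ex1; rewrite a1qE a1P a0qE q1q2 linear0.
have [b0 b0P] : exists b0 : grhom F0 (Q 0), forall x, res_aug Q (b0 x) = aug x.
  by apply: free_lift => k; apply: res_aug_surj.
have [b0d b0dE] := grhom_comp_ex b0 d1.
have [b1 b1P] : exists b1 : grhom F1 (Q 1), forall x, res_d Q 0 (b1 x) = b0d x.
  by apply: free_lift => k; apply/res_exact0; rewrite b0dE b0P.
have [b1d b1dE] := grhom_comp_ex b1 d2.
have [b2 b2P] : exists b2 : grhom F2 (Q 2), forall x, res_d Q 1 (b2 x) = b1d x.
  by apply: free_lift => k; apply/res_exact; rewrite b1dE b1P b0dE d1d2 linear0.
have b2_ker x : d2 x = 0 -> b2 x = 0.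
  by move=> d2x; apply: q2_inj; rewrite b2P b1dE d2x linear0.
have [id0 id0E] : exists i : grhom F0 F0, forall x, i x = x.
  by exists (free_hom (fun k => basis_deg B e0 k)) => x; rewrite [RHS]free_expand.
have [id1 id1E] : exists i : grhom F1 F1, forall x, i x = x.
  by exists (free_hom (fun k => basis_deg B e1 k)) => x; rewrite [RHS]free_expand.
have [ab0 ab0E] := grhom_comp_ex a0 b0.
have [c0 c0E] := grhom_sub_ex id0 ab0.
have [h0 h0P] : exists h0 : grhom F0 F1, forall x, d1 (h0 x) = c0 x.
  by apply: free_lift => k; apply/ex0; rewrite c0E linearB id0E ab0E a0P b0P subrr.
have [ab1 ab1E] := grhom_comp_ex a1 b1.
have [c1 c1E] := grhom_sub_ex id1 ab1.
have [h0d h0dE] := grhom_comp_ex h0 d1.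
have [c1' c1'E] := grhom_sub_ex c1 h0d.
have [h1 h1P] : exists h1 : grhom F1 F2, forall x, d2 (h1 x) = c1' x.
  apply: free_lift => k; apply/ex1; rewrite c1'E linearB h0dE h0P c0E id0E ab0E.
  by rewrite c1E linearB id1E ab1E a1P a0qE b1P b0dE subrr.
have [ab2 ab2E] := grhom_comp_ex a2 b2.
have [h1d h1dE] := grhom_comp_ex h1 d2.
have hD i x : x \in gm_deg F2 i -> (ab2 \+ h1d) x \in gm_deg F2 i.
  by move=> xi; apply: (homogD (gm_degP F2)); apply: grhom_deg.
exists (GrHom hD); split=> x /=.
  rewrite linearD ab2E a2P a1qE b2P b1dE h1dE h1P c1'E c1E id1E ab1E h0dE.
  by rewrite d1d2 linear0 subr0 addrC subrK.
by move=> d2x; rewrite ab2E b2_ker // h1dE d2x !linear0 addr0.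
Qed.

End Comparison.

(** * Components and contractions of the tensor algebra *)

Section TensorAlgebraComponents.
Variables (K : fieldType) (S : kalgebra K) (M : bimodType S).
Notation T := (tensor_algebra M).
Implicit Types (x y z : T) (s : S) (m : M).

Definition tcomp x n : tpow M n := dval (x : dsum (tpow M)) n.

Lemma tcompP x y : (forall n, tcomp x n = tcomp y n) -> x = y.
Proof. exact: dsumP. Qed.
Lemma tcompD x y n : tcomp (x + y) n = tcomp x n + tcomp y n.
Proof. by []. Qed.
Lemma tcomp0 n : tcomp 0 n = 0.
Proof. by []. Qed.
Lemma tcompN x n : tcomp (- x) n = - tcomp x n.
Proof. by []. Qed.
Lemma tcompB x y n : tcomp (x - y) n = tcomp x n - tcomp y n.
Proof. by []. Qed.
Lemma tcompZ (k : K) x n : tcomp (k *: x) n = k *: tcomp x n.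
Proof. by []. Qed.
Lemma tcomp_sum J (r : seq J) (F : J -> T) n :
  tcomp (\sum_(j <- r) F j) n = \sum_(j <- r) tcomp (F j) n.
Proof. by elim: r => [|j r IH]; rewrite ?big_nil // !big_cons tcompD IH. Qed.

Lemma tcomp_incl n (a : tpow M n) : tcomp (tensor_incl a) n = a.
Proof. exact: dincl_id. Qed.
Lemma tcomp_incl_neq n (a : tpow M n) p : n != p -> tcomp (tensor_incl a) p = 0.
Proof. exact: dincl_neq. Qed.

Lemma tensor_incl0 n : tensor_incl (0 : tpow M n) = 0.
Proof. exact: dincl0. Qed.
Lemma tensor_inclD n (a b : tpow M n) :
  tensor_incl (a + b) = tensor_incl a + tensor_incl b.
Proof. exact: dinclD. Qed.
Lemma tensor_inclZ n (k : K) (a : tpow M n) :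
  tensor_incl (k *: a) = k *: tensor_incl a.
Proof. exact: dinclZ. Qed.
Lemma tensor_inclN n (a : tpow M n) : tensor_incl (- a) = - tensor_incl a.
Proof. by rewrite -scaleN1r tensor_inclZ scaleN1r. Qed.
Lemma tensor_incl_sum n J (r : seq J) (F : J -> tpow M n) :
  tensor_incl (\sum_(j <- r) F j) = \sum_(j <- r) tensor_incl (F j).
Proof.
by elim: r => [|j r IH]; rewrite ?big_nil ?tensor_incl0 // !big_cons tensor_inclD IH.
Qed.
Lemma tensor_incl_inj n : injective (@tensor_incl K S M n).
Proof. by move=> a b /(congr1 (tcomp^~ n)); rewrite !tcomp_incl. Qed.
Lemma tensor_inclM i j (a : tpow M i) (b : tpow M j) :
  tensor_incl a * tensor_incl b = tensor_incl (tmul a b).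
Proof. exact: gmul_dincl. Qed.

Lemma tensor_degP n x :
  reflect (exists a : tpow M n, x = tensor_incl a) (x \in gdeg T n).
Proof. exact: graded_sum_degP. Qed.

Lemma tensor_deg_comp n x : x \in gdeg T n -> x = tensor_incl (tcomp x n).
Proof. by case/tensor_degP=> a ->; rewrite tcomp_incl. Qed.

Definition tS s : T := @tensor_incl K S M 0 s.
Definition tM m : T := @tensor_incl K S M 1 m.

Lemma tSD s t : tS (s + t) = tS s + tS t. Proof. exact: tensor_inclD. Qed.
Lemma tSZ (k : K) s : tS (k *: s) = k *: tS s. Proof. exact: tensor_inclZ. Qed.
Lemma tSN s : tS (- s) = - tS s. Proof. exact: tensor_inclN. Qed.
Lemma tMD m m' : tM (m + m') = tM m + tM m'. Proof. exact: tensor_inclD. Qed.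
Lemma tSM s t : tS (s * t) = tS s * tS t.
Proof. by rewrite [RHS]tensor_inclM. Qed.
Lemma tS_incl s n (a : tpow M n) : tS s * tensor_incl a = tensor_incl (s *>> a).
Proof. exact: tensor_inclM. Qed.
Lemma tM_incl m n (a : tpow M n) :
  tM m * tensor_incl a = @tensor_incl K S M n.+1 (tcons m a).
Proof. exact: tensor_inclM. Qed.
Lemma tS_tM s m : tS s * tM m = tM (s *>> m).
Proof. exact: tensor_inclM. Qed.
Lemma tMS m s : tM m * tS s = tM (m <<* s).
Proof. exact: tensor_inclM. Qed.
Lemma tMM m m' : tM m * tM m' = @tensor_incl K S M 2 (tens m m').
Proof. exact: tensor_inclM. Qed.

Lemma tens_incl_ract (a : tensor M M) s :
  @tensor_incl K S M 2 (a <<* s) = @tensor_incl K S M 2 a * tS s.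
Proof.
elim/tensor_ind: a => [|m n a IH]; first by rewrite ract0 (@tensor_incl0 2) mul0r.
rewrite ractDl !(@tensor_inclD 2) mulrDl IH; congr (_ + _).
by rewrite -tMM -mulrA tMS tMM; congr tensor_incl; apply: tract_tens.
Qed.

(** T is generated by S and M, and words may be built from right to left. *)
Lemma tensor_alg_ind (P : T -> Prop) :
  (forall s, P (tS s)) -> (forall x y, P x -> P y -> P (x + y)) ->
  (forall m x, P x -> P (tM m * x)) -> forall x, P x.
Proof.
move=> PS PD PM; have P0 : P 0 by rewrite -(tensor_incl0 0); apply: PS.
have Pincl n (a : tpow M n) : P (tensor_incl a).
  elim: n a => [|n IH] a; first exact: PS.
  elim/tcons_ind: a => [|m a u Pu]; first by rewrite tensor_incl0.
  by rewrite tensor_inclD -tM_incl; apply: PD => //; apply/PM/IH.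
by elim/dsum_ind => // n a x Px; apply: PD Px; apply: Pincl.
Qed.

Lemma tcomp_SM s x n : tcomp (tS s * x) n = s *>> tcomp x n.
Proof.
elim/dsum_ind: x => [|m a x IH]; first by rewrite mulr0 tcomp0 lact0.
rewrite mulrDr !tcompD lactDr IH; congr (_ + _).
rewrite -[dincl a]/(tensor_incl a) tS_incl.
have [<-|mn] := eqVneq m n; first by rewrite !tcomp_incl.
by rewrite !tcomp_incl_neq // lact0.
Qed.

Lemma tcons0 n m : tcons m (0 : tpow M n) = 0.
Proof. by rewrite -(scale0r (0 : tpow M n)) tconsZr scale0r. Qed.

Lemma tcomp_MM0 m x : tcomp (tM m * x) 0 = 0.
Proof.
elim/dsum_ind: x => [|k a x IH]; first by rewrite mulr0.
rewrite mulrDr tcompD IH addr0 -[dincl a]/(tensor_incl a) tM_incl.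
exact: tcomp_incl_neq.
Qed.

Lemma tcomp_MMS m x n : tcomp (tM m * x) n.+1 = tcons m (tcomp x n).
Proof.
elim/dsum_ind: x => [|k a x IH]; first by rewrite mulr0 !tcomp0 tcons0.
rewrite mulrDr !tcompD tconsDr IH; congr (_ + _).
rewrite -[dincl a]/(tensor_incl a) tM_incl.
have [<-|kn] := eqVneq k n; first by rewrite !tcomp_incl.
by rewrite !tcomp_incl_neq // ?tcons0 // eqSS.
Qed.

Lemma tensor_gdeg0 n : 0 \in gdeg T n.
Proof. by apply/tensor_degP; exists 0; rewrite tensor_incl0. Qed.
Lemma incl_gdeg n (a : tpow M n) : tensor_incl a \in gdeg T n.
Proof. by apply/tensor_degP; exists a. Qed.

Lemma tensor_decomp x : exists N, x = \sum_(0 <= n < N) tensor_incl (tcomp x n).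
Proof. by exists (dbound x); apply/dsum_decomp/dboundP. Qed.

Definition deg_le n x := forall p, (n < p)%N -> tcomp x p = 0.

Lemma deg_leD n x y : deg_le n x -> deg_le n y -> deg_le n (x + y).
Proof. by move=> xn yn m nm; rewrite tcompD xn // yn // addr0. Qed.
Lemma deg_leN n x : deg_le n x -> deg_le n (- x).
Proof. by move=> xn m nm; rewrite tcompN xn // oppr0. Qed.
Lemma deg_leB n x y : deg_le n x -> deg_le n y -> deg_le n (x - y).
Proof. by move=> xn yn; apply/deg_leD/deg_leN. Qed.
Lemma deg_le_incl n (a : tpow M n) : deg_le n (tensor_incl a).
Proof. by move=> m nm; rewrite tcomp_incl_neq // neq_ltn nm. Qed.
Lemma deg_leW n p x : (n <= p)%N -> deg_le n x -> deg_le p x.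
Proof. by move=> np xn m pm; apply/xn/(leq_ltn_trans np). Qed.
Lemma deg_leP n x : deg_le n.+1 x -> tcomp x n.+1 = 0 -> deg_le n x.
Proof. by move=> xn x0 m; rewrite leq_eqVlt => /predU1P[<-|/xn]. Qed.
Lemma deg_leS s n x : deg_le n x -> deg_le n (tS s * x).
Proof. by move=> xn m nm; rewrite tcomp_SM xn // lact0. Qed.
Lemma deg_leM m n x : deg_le n x -> deg_le n.+1 (tM m * x).
Proof. by move=> xn [//|p] np; rewrite tcomp_MMS xn // tcons0. Qed.
Lemma deg_le_sum n J (r : seq J) (F : J -> T) :
  (forall j, deg_le n (F j)) -> deg_le n (\sum_(j <- r) F j).
Proof. by move=> Fn; apply: big_ind => //; apply: deg_leD. Qed.
Lemma deg_le_ex x : exists n, deg_le n x.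
Proof.
by exists (dbound x) => m xm; apply: (dboundP (f := (x : dsum (tpow M)))); apply: ltnW.
Qed.
Lemma deg_leMl n p x y : deg_le n x -> deg_le p y -> deg_le (n + p) (x * y).
Proof.
have inclM q (a : tpow M q) z : deg_le p z -> deg_le (q + p) (tensor_incl a * z).
  move=> zp; elim: q a => [|q IH] a; first exact: deg_leS.
  elim/tcons_ind: a => [|m a u Pu]; first by rewrite tensor_incl0 mul0r.
  rewrite tensor_inclD -tM_incl mulrDl -mulrA; apply: deg_leD => //.
  by rewrite addSn; apply: deg_leM.
move=> xn yp; have [N ->] := tensor_decomp x; rewrite mulr_suml.
apply: deg_le_sum => q; have [nq|qn] := ltnP n q.
  by rewrite xn // tensor_incl0 mul0r.
by apply: deg_leW (inclM _ _ _ yp); rewrite leq_add2r.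
Qed.

Section Contraction.
Variable phi : M -> S.
Hypothesis phiD : forall m m', phi (m + m') = phi m + phi m'.
Hypothesis phiR : forall m s, phi (m <<* s) = phi m * s.

(** Contraction of the first tensor factor, [phi m *>> a] from m (x) a; it is
    well defined on the tensor product over S because phi is right S-linear. *)
Definition contr_pow n : tpow M n.+1 -> tpow M n :=
  match n return tpow M n.+1 -> tpow M n with
  | 0 => phi
  | n1.+1 => fun u => tlift (fun m (a : tpow M n1.+1) => phi m *>> a) u
  end.

Let liftDl n m m' (a : tpow M n) :
  phi (m + m') *>> a = phi m *>> a + phi m' *>> a.
Proof. by rewrite phiD lactDl. Qed.

Let liftB n m s (a : tpow M n) : phi (m <<* s) *>> a = phi m *>> (s *>> a).
Proof. by rewrite phiR lactA. Qed.

Lemma contr_powD n (u u' : tpow M n.+1) :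
  contr_pow (u + u') = contr_pow u + contr_pow u'.
Proof.
case: n u u' => [|n] u u'; first exact: phiD.
apply: (@tliftD _ _ M (tpow M n.+1) (tpow M n.+1)
  (fun m (a : tpow M n.+1) => phi m *>> a)) => [m m' a|m a a'|m s a].
- exact: liftDl.
- exact: lactDr.
- exact: liftB.
Qed.

Lemma contr_pow_cons n m (a : tpow M n) : contr_pow (tcons m a) = phi m *>> a.
Proof.
case: n a => [|n] a; first exact: phiR.
apply: (@tliftE _ _ M (tpow M n.+1) (tpow M n.+1)
  (fun m (a : tpow M n.+1) => phi m *>> a)) => [m1 m' a1|m1 a1 a'|m1 s a1].
- exact: liftDl.
- exact: lactDr.
- exact: liftB.
Qed.

Lemma contr_pow0 n : contr_pow (0 : tpow M n.+1) = 0.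
Proof. by apply: (addrI (contr_pow (0 : tpow M n.+1))); rewrite -contr_powD !addr0. Qed.

Fact contr_fin x : exists N, forall n, (N <= n)%N -> contr_pow (tcomp x n.+1) = 0.
Proof.
have [N xN] := deg_le_ex x; exists N => n Nn.
by rewrite xN ?ltnS // contr_pow0.
Qed.

Definition contr x : T := DSum (contr_fin x).

Lemma tcomp_contr x n : tcomp (contr x) n = contr_pow (tcomp x n.+1).
Proof. by []. Qed.

Lemma contrD x y : contr (x + y) = contr x + contr y.
Proof. by apply: tcompP => n; rewrite tcompD !tcomp_contr tcompD contr_powD. Qed.
Lemma contr0 : contr 0 = 0.
Proof. by apply: (addrI (contr 0)); rewrite -contrD !addr0. Qed.
Lemma contrN x : contr (- x) = - contr x.
Proof. by apply: (addrI (contr x)); rewrite -contrD !subrr contr0. Qed.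
Lemma contrB x y : contr (x - y) = contr x - contr y.
Proof. by rewrite contrD contrN. Qed.
Lemma contr_sum J (r : seq J) (F : J -> T) :
  contr (\sum_(j <- r) F j) = \sum_(j <- r) contr (F j).
Proof. by elim: r => [|j r IH]; rewrite ?big_nil ?contr0 // !big_cons contrD IH. Qed.

Lemma contrS s : contr (tS s) = 0.
Proof.
by apply: tcompP => n; rewrite tcomp_contr tcomp_incl_neq // contr_pow0.
Qed.

Lemma contrM m x : contr (tM m * x) = tS (phi m) * x.
Proof.
by apply: tcompP => n; rewrite tcomp_contr tcomp_MMS contr_pow_cons tcomp_SM.
Qed.

(** Contraction only touches the first factor, hence commutes with
    multiplication on the right of elements of positive degree. *)
Lemma contr_tensM (a : tpow M 2) x :
  contr (tensor_incl a * x) = contr (tensor_incl a) * x.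
Proof.
elim/tensor_ind: a => [|m n u IH]; first by rewrite tensor_incl0 !(mul0r, contr0).
rewrite (@tensor_inclD 2) mulrDl !contrD IH mulrDl; congr (_ + _).
by rewrite -tMM -mulrA !contrM mulrA.
Qed.

Lemma contr_deg n x : x \in gdeg T n.+1 -> contr x \in gdeg T n.
Proof.
move=> /tensor_degP[a ->]; apply/tensor_degP; exists (contr_pow a).
apply: tcompP => m; rewrite tcomp_contr; have [<-|nm] := eqVneq n m.
  by rewrite !tcomp_incl.
by rewrite !tcomp_incl_neq // contr_pow0.
Qed.

End Contraction.

End TensorAlgebraComponents.

(** * Dual bases *)

Section DualBasis.
Variables (K : fieldType) (S : kalgebra K) (M : bimodType S).
Notation T := (tensor_algebra M).

(** A finite dual basis of M as a right S-module: it exists exactly when M is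
    finitely generated projective on the right. *)
Record dual_basis := DualBasis {
  db_size : nat;
  db_vec : 'I_db_size -> M;
  db_fun : 'I_db_size -> M -> S;
  db_funD : forall i m m', db_fun i (m + m') = db_fun i m + db_fun i m';
  db_funR : forall i m s, db_fun i (m <<* s) = db_fun i m * s;
  db_expand : forall m, m = \sum_i db_vec i <<* db_fun i m
}.

Variable b : dual_basis.
Notation d := (db_size b).
Notation v := (@db_vec b).
Notation phi := (@db_fun b).

Lemma db_fun_sum i J (r : seq J) (F : J -> M) :
  phi i (\sum_(j <- r) F j) = \sum_(j <- r) phi i (F j).
Proof.
have phi0 : phi i 0 = 0 by apply: (addrI (phi i 0)); rewrite -db_funD !addr0.
exact: (big_morph _ (db_funD (d := b) i) phi0).
Qed.

(** By analogy with noncommutative partial derivatives: the coefficient of v_i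
    when x is written with its first factors expanded in the dual basis. *)
Definition partial i (x : T) := contr (@db_funD b i) (@db_funR b i) x.

Lemma partial_expand (x : T) :
  x = tS M (tcomp x 0) + \sum_i tM (v i) * partial i x.
Proof.
elim/tensor_alg_ind: x => [s|x y IHx IHy|m x _].
- rewrite tcomp_incl big1 ?addr0 // => i _.
  by rewrite /partial contrS mulr0.
- rewrite {1}IHx {1}IHy tcompD (@tSD _ _ M) addrACA -big_split; congr (_ + _).
  by apply: eq_bigr => i _; rewrite /partial contrD mulrDr.
- rewrite tcomp_MM0 -[X in X + _]/(@tensor_incl K S M 0 0) tensor_incl0 add0r.
  rewrite {1}(db_expand b m) /tM (@tensor_incl_sum _ _ M 1) mulr_suml.
  apply: eq_bigr => i _; rewrite /partial contrM mulrA.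
  by congr (_ * _); symmetry; apply: tMS.
Qed.

End DualBasis.

Arguments partial {K S M} b i x.

(** * Finite-dimensional spaces *)

(** Induction on the number n of generators v_i of an ambient space: W is spanned
    by its elements with vanishing coefficient on the first generator, and by one
    more element if there is one with a nonzero coefficient. *)
Lemma fin_dim_sub (K : fieldType) (V : lmodType K) (W : {pred V}) :
  submod_closed W -> fin_dim (V := V) predT -> fin_dim W.
Proof.
move=> Wsub [n [v [_ vspan]]].
have {vspan} : forall x, x \in W -> exists c : 'I_n -> K, x = \sum_(i < n) c i *: v i.
  by move=> x _; apply: vspan.
elim: n v W Wsub => [|n IH] v W [W0 WP] Wspan.
  exists 0%N, v; split=> [[]//|]; exact: Wspan.
pose W' : {pred V} := fun x => (x \in W) &&
  `[< exists c : 'I_n -> K, x = \sum_(i < n) c i *: v (lift ord0 i) >].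
have W'P x : x \in W' <-> x \in W /\
    exists c : 'I_n -> K, x = \sum_(i < n) c i *: v (lift ord0 i).
  split=> [/andP[xW /asboolP]|[xW xc]] //.
  by apply/andP; split=> //; apply/asboolP.
have [|x /W'P[]//|p [w [wW' wspan]]] := IH (fun i => v (lift ord0 i)) W'.
  split=> [|k x y /W'P[xW [c xE]] /W'P[yW [d yE]]]; apply/W'P; split=> //.
  - by exists (fun=> 0); rewrite big1 // => i _; rewrite scale0r.
  - exact: WP.
  exists (fun i => k * c i + d i); rewrite xE yE scaler_sumr -big_split.
  by apply: eq_bigr => i _; rewrite /= scalerDl scalerA.
have wW i : w i \in W by have /W'P[] := wW' i.
have [[u [c [uW uE c0]]]|noc] := pselect (exists u (c : 'I_n.+1 -> K),
    [/\ u \in W, u = \sum_(i < n.+1) c i *: v i & c ord0 != 0]); last first.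
  exists p, w; split=> // x xW; apply/wspan/W'P; split=> //.
  have [c xE] := Wspan x xW; exists (fun i => c (lift ord0 i)).
  rewrite xE big_ord_recl (_ : c ord0 = 0) ?scale0r ?add0r //.
  by apply/eqP; apply: contraT => c0; case: noc; exists x, c.
exists p.+1, (fun i => if unlift ord0 i is Some j then w j else u).
split=> [i|x xW]; first by case: unlift.
have [d xE] := Wspan x xW; pose k := d ord0 / c ord0.
have [|e eE] := wspan (- k *: u + x).
  apply/W'P; split; first exact: WP.
  exists (fun i => d (lift ord0 i) - k * c (lift ord0 i)).
  rewrite uE xE scaler_sumr -big_split big_ord_recl /=.
  rewrite scalerA -scalerDl mulNr divfK // addNr scale0r add0r.
  by apply: eq_bigr => i _; rewrite scalerA -scalerDl mulNr addrC.
exists (fun i => if unlift ord0 i is Some j then e j else k).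
rewrite big_ord_recl unlift_none.
under eq_bigr => i _ do rewrite !liftK.
by rewrite -eE scaleNr addrA subrr add0r.
Qed.

(** Take a spanning family of minimal size.  A nonzero element x of the kernel
    could replace one of its vectors; the images of the other vectors would then
    span V, which contradicts minimality. *)
Lemma fin_dim_surj_inj (K : fieldType) (V : lmodType K) (psi : {linear V -> V}) :
  fin_dim (V := V) predT -> (forall y, exists x, psi x = y) ->
  forall x, psi x = 0 -> x = 0.
Proof.
move=> Vfin psi_surj x psix; pose spans n := `[< exists v : 'I_n -> V,
  forall y, exists c : 'I_n -> K, y = \sum_(i < n) c i *: v i >].
have exn : exists n, spans n.
  by have [n [v [_ vP]]] := Vfin; exists n; apply/asboolP; exists v => y; apply: vP.
have [[|n] /asboolP[v vP] nmin] := ex_minnP exn.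
  by have [c ->] := vP x; rewrite big_ord0.
have [c xE] := vP x; have [/existsP[j cj]|c0] := boolP [exists j, c j != 0]; last first.
  rewrite xE big1 // => i _; move: c0; rewrite negb_exists => /forallP/(_ i).
  by rewrite negbK => /eqP->; rewrite scale0r.
suff /nmin : spans n by rewrite ltnn.
apply/asboolP; exists (fun i => psi (v (lift j i))) => y.
have [z zy] := psi_surj y; have [d zE] := vP z; pose k := d j / c j.
exists (fun i => d (lift j i) - k * c (lift j i)).
have -> : y = psi (z - k *: x) by rewrite linearB linearZ /= psix scaler0 subr0.
rewrite zE xE scaler_sumr -sumrB (bigD1_ord j) //= scalerA -scalerBl divfK //.
rewrite subrr scale0r add0r linear_sum; apply: eq_bigr => i _.
by rewrite scalerA -scalerBl linearZ.
Qed.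

Lemma tensor_fin_dim (K : fieldType) (S : kalgebra K) (M N : bimodType S) :
  fin_dim (V := M) predT -> fin_dim (V := N) predT ->
  fin_dim (V := tensor M N) predT.
Proof.
move=> [p [v [_ vP]]] [q [w [_ wP]]].
have span u : exists c : 'I_p * 'I_q -> K, u = \sum_k c k *: tens (v k.1) (w k.2).
  elim/tensor_ind: u => [|m n u [c ->]].
    by exists (fun=> 0); rewrite big1 // => i _; rewrite scale0r.
  have [a ->] := vP m isT; have [b ->] := wP n isT.
  exists (fun k => a k.1 * b k.2 + c k).
  under [RHS]eq_bigr => k _ do rewrite scalerDl; rewrite big_split; congr (_ + _).
  rewrite -(pair_bigA _ (fun i j => (a i * b j) *: tens (v i) (w j))) /=.
  have tens_suml J (r : seq J) (F : J -> M) x :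
      tens (\sum_(j <- r) F j) x = \sum_(j <- r) tens (F j) x.
    by elim: r => [|j r IH]; rewrite ?big_nil ?tens0l // !big_cons tensDl IH.
  have tens_sumr J (r : seq J) (F : J -> N) x :
      tens x (\sum_(j <- r) F j) = \sum_(j <- r) tens x (F j).
    by elim: r => [|j r IH]; rewrite ?big_nil ?tens0r // !big_cons tensDr IH.
  rewrite tens_suml; apply: eq_bigr => i _; rewrite tens_sumr; apply: eq_bigr => j _.
  by rewrite -scale_tens tens_scale scalerA.
exists #|{: 'I_p * 'I_q}|, (fun i => tens (v (enum_val i).1) (w (enum_val i).2)).
split=> // u _; have [c ->] := span u; exists (fun i => c (enum_val i)).
by rewrite (big_enum_val (fun k => c k *: tens (v k.1) (w k.2))).
Qed.

(** * The quadratic algebra *)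

Section Ideals.
Variables (K : fieldType) (A : kalgebra K).

Lemma gen_ideal_ind (X : A -> Prop) (P : A -> Prop) :
  P 0 -> (forall x y, P x -> P y -> P (x + y)) ->
  (forall a x b, X x -> P (a * x * b)) ->
  forall x, x \in ideal_pred (gen_ideal X) -> P x.
Proof.
move=> P0 PD PX x /gen_idealP[s [sX ->]].
by rewrite big_seq; apply: big_ind => // p ps; apply: PX; apply: sX.
Qed.

Variable I : ideal A.

Lemma ideal0 : 0 \in ideal_pred I.
Proof. by case: (ideal_zmod I). Qed.
Lemma idealB x y :
  x \in ideal_pred I -> y \in ideal_pred I -> x - y \in ideal_pred I.
Proof. by case: (ideal_zmod I) => _; apply. Qed.
Lemma idealN x :
  x \in ideal_pred I -> - x \in ideal_pred I.
Proof. by move=> xI; rewrite -sub0r idealB // ideal0. Qed.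
Lemma idealD x y :
  x \in ideal_pred I -> y \in ideal_pred I -> x + y \in ideal_pred I.
Proof. by move=> xI yI; rewrite -[y]opprK idealB // idealN. Qed.
Lemma ideal_sum J (r : seq J) (F : J -> A) :
  (forall j, F j \in ideal_pred I) -> \sum_(j <- r) F j \in ideal_pred I.
Proof.
move=> FI; apply: (big_ind (fun x => x \in ideal_pred I)) => //.
  exact: ideal0.
exact: idealD.
Qed.

End Ideals.

Section QuadraticAlgebra.
Variables (K : fieldType) (S : kalgebra K) (M : bimodType S).
Variable R : subbimodule (tensor M M).
Notation T := (tensor_algebra M).
Notation Q := (gen_ideal (@quadratic_rel K S M R)).
Notation B := (quadratic_algebra R).
Notation tR r := (@tensor_incl K S M 2 (subbimod_val r)).

Lemma quadratic_gen (r : subbimod_type R) : tR r \in ideal_pred Q.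
Proof. by apply: gen_ideal_gen; exists r. Qed.

(** Every element of Q is a sum of products with a factor in R, of degree 2. *)
Lemma quadratic_low x : x \in ideal_pred Q -> tcomp x 0 = 0 /\ tcomp x 1 = 0.
Proof.
have [PD PM] : (forall x y : T, tcomp x 0 = 0 /\ tcomp x 1 = 0 ->
    tcomp y 0 = 0 /\ tcomp y 1 = 0 -> tcomp (x + y) 0 = 0 /\ tcomp (x + y) 1 = 0) /\
  (forall m (x : T), tcomp x 0 = 0 /\ tcomp x 1 = 0 ->
    tcomp (tM m * x) 0 = 0 /\ tcomp (tM m * x) 1 = 0).
  split=> [y z [y0 y1] [z0 z1]|m y [y0 _]]; first by rewrite !tcompD y0 y1 z0 z1 !addr0.
  by rewrite tcomp_MM0 tcomp_MMS y0 tcons0.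
move: x; apply: gen_ideal_ind => //= a _ b [r ->]; rewrite -mulrA.
elim/tensor_alg_ind: a => [s|a a' IHa IHa'|m a IHa]; last 2 first.
- by rewrite mulrDl; apply: PD.
- by rewrite -mulrA; apply: PM.
rewrite !tcomp_SM; elim/tensor_ind: (subbimod_val r) => [|m n u [u0 u1]].
  by rewrite (@tensor_incl0 _ _ M 2) mul0r lact0 lact0.
rewrite (@tensor_inclD _ _ M 2) mulrDl !tcompD !lactDr u0 u1 !addr0.
by rewrite -tMM -mulrA tcomp_MM0 tcomp_MMS tcomp_MM0 tcons0 !lact0.
Qed.

Lemma quadratic_comp x n : x \in ideal_pred Q -> tensor_incl (tcomp x n) \in ideal_pred Q.
Proof.
case/gen_ideal_homog; first exact: quadratic_rel_homog.
move=> s [c [us cD cQ ->]]; rewrite tcomp_sum.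
rewrite (@tensor_incl_sum _ _ M n); apply: ideal_sum => j.
have := cQ j; rewrite (tensor_deg_comp (cD j)).
have [<-|jn] := eqVneq j n; first by rewrite tcomp_incl.
by rewrite tcomp_incl_neq // tensor_incl0 => _; apply: ideal0.
Qed.

Lemma quadratic_of_comp x :
  (forall n, tensor_incl (tcomp x n) \in ideal_pred Q) -> x \in ideal_pred Q.
Proof. by move=> xQ; have [N ->] := tensor_decomp x; apply: ideal_sum. Qed.

(** * A dual basis from the projectivity of the component of degree one *)

Section DualBasisExistence.
Notation S0 := (deg0_ring B).
Notation M1 := (right_component B 1).

Let cS_P s : qalg Q (tS M s) \in gdeg_pred (B := B) 0.
Proof. by apply/quot_degP; exists (tS M s) => //; apply: (@incl_gdeg _ _ M 0). Qed.
Let cS s : S0 := Deg0 (cS_P s).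

Let cM_P m : qalg Q (tM m) \in gdeg_pred (B := B) 1.
Proof. by apply/quot_degP; exists (tM m) => //; apply: (@incl_gdeg _ _ M 1). Qed.
Let cM m : M1 := Component (cM_P m).

(* B_0 is S and B_1 is M, as Q vanishes in degrees 0 and 1. *)
Let sOf (a : S0) : S := tcomp (qalg_repr (deg0_val a) : T) 0.

Let sOfK a : cS (sOf a) = a.
Proof.
apply: val_inj => /=; have /quot_degP[x xD aE] := deg0_valP a.
rewrite [RHS]aE; apply/qalgP.
have /qalgP/quadratic_low[c0 _] : qalg Q (qalg_repr (deg0_val a)) = qalg Q x.
  by rewrite qalg_reprK.
rewrite (tensor_deg_comp xD) /sOf.
have -> : tcomp (qalg_repr (deg0_val a) : T) 0 = tcomp x 0.
  by apply/eqP; rewrite -subr_eq0; apply/eqP.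
by rewrite subrr ideal0.
Qed.

Let cS_inj : injective cS.
Proof.
move=> s t /(congr1 val) /= /qalgP/quadratic_low[c0 _]; move: c0.
by rewrite tcompB !tcomp_incl => /eqP; rewrite subr_eq0 => /eqP.
Qed.

Let cM_inj : injective cM.
Proof.
move=> s t /(congr1 val) /= /qalgP/quadratic_low[_ c0]; move: c0.
by rewrite tcompB !tcomp_incl => /eqP; rewrite subr_eq0 => /eqP.
Qed.

Let cMD m m' : cM (m + m') = cM m + cM m'.
Proof. by apply: val_inj; rewrite /= tMD qalgD. Qed.

Let cMR m s : cM (m <<* s) = (cS s : S0^c) *: cM m.
Proof. by apply: val_inj; rewrite /= -tMS qalgMr. Qed.

Let cSD s t : cS (s + t) = cS s + cS t.
Proof. by apply: val_inj; rewrite /= tSD qalgD. Qed.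

Let cSM s t : cS (s * t) = cS s * cS t.
Proof. by apply: val_inj; rewrite /= tSM qalgMr. Qed.

(** A section of the projection from a free right module onto M has the phi_i
    as its coordinates. *)
Lemma dual_basis_exists : fin_dim (V := M) predT -> projective M1 ->
  inhabited (dual_basis M).
Proof.
move=> [n [v [_ vP]]] proj.
pose E : lmodType S0^c := {ffun 'I_n -> S0^c^o}.
pose gf (e : E) : M1 := \sum_i ((e : {ffun 'I_n -> S0^c^o}) i : S0^c) *: cM (v i).
have glin : linear gf.
  move=> a e e'; rewrite /gf scaler_sumr -big_split; apply: eq_bigr => i _ /=.
  by rewrite !ffunE scalerDl -scalerA.
pose gL := GRing.isLinear.Build _ _ _ _ gf glin.
pose g : {linear E -> M1} := HB.pack gf gL.
have gsurj y : exists x, g x = y.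
  have /quot_degP[x xD yE] := component_valP y.
  have [m xE] : exists m, x = tM m by exact: (elimT (tensor_degP 1 x) xD).
  have [c mE] := vP m isT.
  exists [ffun i => cS (c i *: (1 : S)) : S0^c^o].
  have -> : y = cM m by apply: val_inj; rewrite /= [LHS]yE xE.
  have cM0 : cM 0 = 0 by apply: (addrI (cM 0)); rewrite -cMD !addr0.
  rewrite mE (big_morph cM cMD cM0); apply: eq_bigr => i _.
  by rewrite ffunE -cMR ractZr ract1.
have [h hP] := proj _ _ g idfun gsurj.
pose phi i m := sOf ((h (cM m) : {ffun 'I_n -> S0^c^o}) i).
have phiE i m : cS (phi i m) = (h (cM m) : {ffun 'I_n -> S0^c^o}) i.
  exact: sOfK.
constructor; exists n v phi => [i m m'|i m s|m].
- by apply: cS_inj; rewrite cSD !phiE cMD linearD ffunE.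
- by apply: cS_inj; rewrite cSM !phiE cMR linearZ /= ffunE.
- apply: cM_inj; rewrite -[LHS]hP -[LHS]/(gf _) /gf.
  have cM0 : cM 0 = 0 by apply: (addrI (cM 0)); rewrite -cMD !addr0.
  rewrite (big_morph cM cMD cM0); apply: eq_bigr => i _.
  by rewrite cMR phiE.
Qed.

End DualBasisExistence.

End QuadraticAlgebra.

(** * Syzygies of the relations *)

Section Syzygies.
Variables (K : fieldType) (S : kalgebra K) (M : bimodType S).
Variable R : subbimodule (tensor M M).
Notation T := (tensor_algebra M).
Notation Q := (gen_ideal (@quadratic_rel K S M R)).
Notation tR r := (@tensor_incl K S M 2 (subbimod_val r)).

Variables (B : gralgebra K) (pi : T -> B).
Hypothesis piD : forall x y, pi (x + y) = pi x + pi y.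
Hypothesis piM : forall x y, pi (x * y) = pi x * pi y.
Hypothesis pi_surj : forall b, exists x, b = pi x.
Hypothesis pi_eq0 : forall x, pi x = 0 <-> x \in ideal_pred Q.
Hypothesis pi_deg : forall n x, x \in gdeg T n -> pi x \in gdeg B n.
Hypothesis pi_degP : forall n b, b \in gdeg B n ->
  exists a : tpow M n, b = pi (tensor_incl a).

Let pi0 : pi 0 = 0. Proof. by apply/pi_eq0/ideal0. Qed.
Let piN x : pi (- x) = - pi x.
Proof. by apply: (addrI (pi x)); rewrite -piD !subrr. Qed.
Let piB x y : pi (x - y) = pi x - pi y. Proof. by rewrite piD piN. Qed.
Let pi_sum J (r : seq J) (F : J -> T) :
  pi (\sum_(j <- r) F j) = \sum_(j <- r) pi (F j).
Proof. by elim: r => [|j r IH]; rewrite ?big_nil // !big_cons piD IH. Qed.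
Let piP x y : pi x = pi y <-> x - y \in ideal_pred Q.
Proof.
rewrite -pi_eq0 piB; split=> [->|/eqP]; first by rewrite subrr.
by rewrite subr_eq0 => /eqP.
Qed.
Let pi_incl n (a : tpow M n) : pi (tensor_incl a) \in gdeg B n.
Proof. exact/pi_deg/incl_gdeg. Qed.

(* An element of B lies in B_(>= 1) when its representatives have no component
   of degree 0. *)
Let positive_pi (x : T) :
  ((pi x : B) : (kcar B)^c^o) \in positive_part (B := B) <-> tcomp x 0 = 0.
Proof.
split=> [/positive_partP[s [sP xE]]|x0].
  have [t t0 tE] : exists2 t, tcomp t 0 = 0 & pi t = \sum_(y <- s) y.
    elim: s sP {xE} => [|y s IH] sP; first by exists 0; rewrite // pi0 big_nil.
    have [|t t0 tE] := IH; first by move=> z zs; apply: sP; rewrite inE zs orbT.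
    have [n /pi_degP[a yE]] := sP y (mem_head _ _).
    exists (tensor_incl a + t); first by rewrite tcompD t0 addr0 tcomp_incl_neq.
    by rewrite big_cons piD tE yE.
  have /piP/quadratic_low[] : pi x = pi t by rewrite xE tE.
  by rewrite tcompB t0 subr0.
have [N xE] := tensor_decomp x; apply/positive_partP.
exists [seq pi (tensor_incl (tcomp x n)) | n <- index_iota 0 N]; split.
  move=> _ /mapP[[|n] _ ->]; last by exists n; apply: pi_incl.
  by exists 0%N; rewrite x0 tensor_incl0 pi0 gdeg0.
by rewrite big_map {1}xE pi_sum.
Qed.

Variable db : dual_basis M.
Notation d := (db_size db).
Notation v := (@db_vec _ _ _ db).
Notation phi := (@db_fun _ _ _ db).
Notation D := (partial db).
Variables (N : nat) (rr : 'I_N -> subbimod_type R).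
Hypothesis rr_span : forall r, exists c : 'I_N -> K, r = \sum_(k < N) c k *: rr k.

Lemma partialD i x y : D i (x + y) = D i x + D i y. Proof. exact: contrD. Qed.
Lemma partialB i x y : D i (x - y) = D i x - D i y. Proof. exact: contrB. Qed.
Lemma partial0 i : D i 0 = 0. Proof. exact: contr0. Qed.
Lemma partial_sum i J (r : seq J) (F : J -> T) :
  D i (\sum_(j <- r) F j) = \sum_(j <- r) D i (F j).
Proof. exact: contr_sum. Qed.
Lemma partialM i m x : D i (tM m * x) = tS M (phi i m) * x.
Proof. exact: contrM. Qed.
Lemma partialR i (r : subbimod_type R) x : D i (tR r * x) = D i (tR r) * x.
Proof. exact: contr_tensM. Qed.

Lemma partial_expand0 (x : T) : tcomp x 0 = 0 -> x = \sum_i tM (v i) * D i x.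
Proof.
move=> x0; rewrite {1}(partial_expand db x) x0.
by rewrite -[tS M 0]/(@tensor_incl K S M 0 0) tensor_incl0 add0r.
Qed.

Lemma partial_expandR (r : subbimod_type R) : tR r = \sum_i tM (v i) * D i (tR r).
Proof. by apply: partial_expand0; rewrite tcomp_incl_neq. Qed.

Lemma partialR_proj i (r : subbimod_type R) :
  D i (tR r) = \sum_j tS M (phi i (v j)) * D j (tR r).
Proof.
rewrite {1}partial_expandR partial_sum; apply: eq_bigr => j _; exact: partialM.
Qed.

Lemma rel_span (r : subbimod_type R) : exists c : 'I_N -> K,
  tR r = \sum_(k < N) c k *: tR (rr k).
Proof.
have [c ->] := rr_span r; exists c.
rewrite -[subbimod_val _]/(val _) raddf_sum (@tensor_incl_sum _ _ M 2).
by apply: eq_bigr => k _; rewrite -(@tensor_inclZ _ _ M 2).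
Qed.

(** Q = R T + M Q: in a product a r b split off the first factors of a, using
    that s r is again a relation when s is a scalar. *)
Lemma quadratic_expand x : x \in ideal_pred Q ->
  exists (u : 'I_N -> T) (q : 'I_d -> T), (forall i, q i \in ideal_pred Q) /\
    x = \sum_k tR (rr k) * u k + \sum_i tM (v i) * q i.
Proof.
move: x; apply: gen_ideal_ind => [|x y [u [q [qQ ->]]] [u' [q' [q'Q ->]]]|a _ b [r ->]].
- exists (fun=> 0), (fun=> 0); split=> [i|]; first exact: ideal0.
  by rewrite !big1 ?addr0 // => i _; rewrite mulr0.
- exists (fun k => u k + u' k), (fun k => q k + q' k).
  split=> [i|]; first by apply: idealD.
  rewrite addrACA -!big_split; congr (_ + _); apply: eq_bigr => i _;
  by rewrite mulrDr.
have [c rE] := rel_span (sub_lact (tcomp a 0) r).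
exists (fun k => c k *: b), (fun i => D i a * tR r * b); split=> [i|].
  exact: (Defs.idealMr b (Defs.idealMl (D i a) (quadratic_gen r))).
rewrite {1}(partial_expand db a) !mulrDl tS_incl -[_ *>> _]/(subbimod_val (sub_lact _ _)).
rewrite rE !mulr_suml; congr (_ + _); apply: eq_bigr => k _; last by rewrite !mulrA.
by rewrite -kscalerAl kscalerAr.
Qed.

(* The presentation of S_B.  The columns of d2 are the vectors (D_i r_k)_i and
   those of the complement 1 - e of the idempotent e = (phi_i(v_j)), which add
   to the kernel of (v_i) the part of B^d that is not in M (x) B. *)
Let delta0 (_ : unit) : int := 0.
Let delta1 (_ : 'I_d) : int := 1.
Let delta2 (k : 'I_N + 'I_d) : int := if k is inl _ then 2%:Z else 1%:Z.
Notation F0 := (free_grmodule B delta0).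
Notation F1 := (free_grmodule B delta1).
Notation F2 := (free_grmodule B delta2).

Let A i k : B := pi (D i (tR (rr k))).
Let e i j : B := pi (tS M (phi i (v j))).

Let x2 (k : 'I_N + 'I_d) : F1 :=
  match k with
  | inl k => [ffun i => A i k : (kcar B)^c^o]
  | inr j => [ffun i => (if i == j then 1 else 0) - e i j : (kcar B)^c^o]
  end.

Let x2D k : x2 k \in gm_deg F1 (delta2 k).
Proof.
case: k => k; apply/in_free_degP => i; rewrite /fcoef ffunE.
  rewrite -[_ \in _]/(A i k \in gdeg B 1).
  have /tensor_degP[a aE] : D i (tR (rr k)) \in gdeg T 1.
    by apply/contr_deg/incl_gdeg.
  by rewrite /A aE; apply: pi_incl.
rewrite -[_ \in _]/((if i == k then 1 else 0) - e i k \in gdeg B 0).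
have [_ B1 _ [gz _ _]] := gdegP B; have [B0 BB] := gz 0%N; apply: BB.
  by case: eqP.
exact: (@pi_incl 0).
Qed.

Let x1 (i : 'I_d) : F0 := [ffun _ => pi (tM (v i)) : (kcar B)^c^o].

Let x1D i : x1 i \in gm_deg F0 (delta1 i).
Proof.
apply/in_free_degP => j; rewrite /fcoef ffunE.
exact: (@pi_incl 1).
Qed.

Let x0 (_ : unit) : trivial_module B := qmod (positive_submodule B) (1 : B).

Let x0D i : x0 i \in gm_deg (trivial_module B) (delta0 i).
Proof. by []. Qed.

Let d2 := free_hom x2D.
Let d1 := free_hom x1D.
Let aug := free_hom x0D.

Let fcoef_d2 (y : F2) i : fcoef (d2 y) i =
  \sum_k A i k * fcoef y (inl k) +
  \sum_j ((if i == j then 1 else 0) - e i j) * fcoef y (inr j).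
Proof.
rewrite free_homE fcoef_sum big_sumType /=.
by congr (_ + _); apply: eq_bigr => k _; rewrite fcoefZ /fcoef ffunE.
Qed.

Let fcoef_d1 (y : F1) i : fcoef (d1 y) i = \sum_j pi (tM (v j)) * fcoef y j.
Proof.
rewrite free_homE fcoef_sum.
by apply: eq_bigr => k _; rewrite fcoefZ /fcoef ffunE.
Qed.

Let augE (y : F0) : aug y = qmod (positive_submodule B) (fcoef y tt).
Proof.
rewrite free_homE (bigD1 tt) //= big1 ?addr0.
  by rewrite -qmodZ; congr (qmod _ _); apply: (@mulr1 (kcar B)^c).
by case.
Qed.

Let aug_surj y : exists x, aug x = y.
Proof.
exists [ffun _ => (qmod_repr y : B) : (kcar B)^c^o].
by rewrite augE /fcoef ffunE; apply: qmod_reprK.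
Qed.

Let ex0 x : aug x = 0 <-> exists y, d1 y = x.
Proof.
have [t tE] := pi_surj (fcoef x tt).
have -> : aug x = 0 <-> tcomp t 0 = 0.
  rewrite augE tE; split=> [/qmod_eq0/positive_pi//|t0].
  exact/qmod_eq0/positive_pi.
split=> [t0|[y yE]].
  exists [ffun i => pi (D i t) : (kcar B)^c^o]; apply: fcoefP => -[].
  rewrite fcoef_d1 tE [in RHS](partial_expand0 t0) pi_sum.
  by apply: eq_bigr => i _; rewrite /fcoef ffunE piM.
have /choice[w wE] j : exists w, fcoef y j = pi w by apply: pi_surj.
have : pi t = pi (\sum_j tM (v j) * w j).
  rewrite -tE -yE fcoef_d1 pi_sum; apply: eq_bigr => j _.
  by rewrite piM wE.
case/piP/quadratic_low => + _; rewrite tcompB tcomp_sum big1 ?subr0 //.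
by move=> j _; apply: tcomp_MM0.
Qed.

(* The matrix e is idempotent and fixes the columns of A; its complement is
   killed by the row (v_i). *)
Let eA i k : A i k = \sum_j e i j * A j k.
Proof.
rewrite /A partialR_proj pi_sum; apply: eq_bigr => j _.
by rewrite piM.
Qed.

Let ee i l : e i l = \sum_j e i j * e j l.
Proof.
rewrite /e {1}(db_expand db (v l)) db_fun_sum /tS (@tensor_incl_sum _ _ M 0) pi_sum.
by apply: eq_bigr => j _; rewrite db_funR -piM -(@tSM _ _ M).
Qed.

Let ve j : \sum_i pi (tM (v i)) * e i j = pi (tM (v j)).
Proof.
rewrite [in RHS](db_expand db (v j)) /tM (@tensor_incl_sum _ _ M 1) pi_sum.
by apply: eq_bigr => i _; rewrite -piM tMS.
Qed.

Let vA k : \sum_i pi (tM (v i)) * A i k = 0.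
Proof.
transitivity (pi (tR (rr k))); last exact/pi_eq0/quadratic_gen.
by rewrite [in RHS]partial_expandR pi_sum; apply: eq_bigr => i _; rewrite piM.
Qed.

(* If sum_j v_j w_j is in Q, expand it as in [quadratic_expand] and contract:
   this gives e w = A u in B, so that w = A u + (1 - e) w. *)
Let ex1 x : d1 x = 0 <-> exists y, d2 y = x.
Proof.
split=> [x0'|[y <-]]; last first.
  apply: fcoefP => u; rewrite fcoef_d1 fcoef0.
  under eq_bigr => i _ do rewrite fcoef_d2 mulrDr !mulr_sumr.
  rewrite big_split /= exchange_big /= big1 ?add0r => [|k _]; last first.
    by under eq_bigr => i _ do rewrite mulrA; rewrite -mulr_suml vA mul0r.
  rewrite exchange_big big1 // => j _.
  under eq_bigr => i _ do rewrite mulrA mulrBr.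
  rewrite -mulr_suml big_split /= sumrN ve (bigD1 j) //= eqxx mulr1 big1 ?addr0.
    by rewrite subrr mul0r.
  by move=> i /negPf->; rewrite mulr0.
have /choice[w wE] j : exists w, fcoef x j = pi w by apply: pi_surj.
have /quadratic_expand[u [q [qQ wQ]]] : \sum_j tM (v j) * w j \in ideal_pred Q.
  apply/pi_eq0; have := congr1 (fun f => fcoef f tt) x0'.
  rewrite fcoef_d1 fcoef0 => <-; rewrite pi_sum.
  by apply: eq_bigr => j _; rewrite piM wE.
pose y : F2 := [ffun k =>
  (match k with inl k => pi (u k) | inr j => fcoef x j end) : (kcar B)^c^o].
exists y; apply: fcoefP => i; rewrite fcoef_d2.
have -> : \sum_k A i k * fcoef y (inl k) = \sum_j e i j * fcoef x j.
  have /(congr1 (fun t => pi (D i t))) := wQ.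
  rewrite partialD !partial_sum piD !pi_sum.
  rewrite [X in _ = _ + X]big1 ?addr0 => [wE'|j _]; last first.
    by apply/pi_eq0; rewrite partialM; apply: Defs.idealMl.
  transitivity (\sum_k pi (D i (tR (rr k) * u k))).
    by apply: eq_bigr => k _; rewrite partialR piM /fcoef ffunE.
  rewrite -wE'; apply: eq_bigr => j _.
  by rewrite partialM piM wE.
rewrite -big_split /= (bigD1 i) //= big1 => [|j ji].
  by rewrite eqxx addr0 mulrBl mul1r /fcoef ffunE addrC subrK.
by rewrite eq_sym (negPf ji) sub0r mulNr /fcoef ffunE subrr.
Qed.

Lemma tensor_partial_inj (x : T) : tcomp x 0 = 0 -> (forall i, D i x = 0) -> x = 0.
Proof.
by move=> t0 Dx; rewrite (partial_expand0 t0) big1 // => i _; rewrite Dx mulr0.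
Qed.

(** The matrix c is the block of tau from B^N to B^N, whose entries have degree
    0.  The equation d2 tau = d2, multiplied by e to get rid of 1 - e, gives
    D_i(r_k) = sum_l D_i(r_l) c_kl in degree 1, where B and T agree. *)
Lemma relation_syzygies : proj_dim_le (trivial_module B) 2 ->
  exists c : 'I_N -> 'I_N -> S,
    (forall k, subbimod_val (rr k) = \sum_l subbimod_val (rr l) <<* c k l) /\
    forall b : 'I_N -> T,
      (forall i, \sum_k D i (tR (rr k)) * b k \in ideal_pred Q) ->
      forall l, \sum_k tS M (c k l) * b k \in ideal_pred Q.
Proof.
move=> pd; have [tau [d2tau tau_ker]] := second_syzygy_split aug_surj ex0 ex1 pd.
have /choice[c0 c0P] k : exists c : 'I_N -> S, forall l,
    fcoef (tau (basis B delta2 (inl k))) (inl l) = pi (tS M (c l)).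
  suff H l : exists s, fcoef (tau (basis B delta2 (inl k))) (inl l) = pi (tS M s).
    by have [c cE] := choice H; exists c.
  have tau_deg := grhom_deg tau (basis_deg B delta2 (inl k)).
  have /in_free_degP/(_ (inl l)) := tau_deg.
  by case/(pi_degP (n := 0)) => s ->; exists s.
exists c0; split=> [k|b bQ l].
  apply: (@tensor_incl_inj _ _ M 2); apply/eqP; rewrite -subr_eq0; apply/eqP.
  apply: tensor_partial_inj => [|i]; first by rewrite tcompB !tcomp_incl_neq // subr0.
  set x := tensor_incl _ - _.
  have DxE : D i x = D i (tR (rr k)) - \sum_l D i (tR (rr l)) * tS M (c0 k l).
    rewrite /x partialB (@tensor_incl_sum _ _ M 2) partial_sum.
    by congr (_ - _); apply: eq_bigr => l _; rewrite tens_incl_ract partialR.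
  have /tensor_degP[a aE] : D i x \in gdeg T 1.
    rewrite /x -(@tensor_inclN _ _ M 2) -(@tensor_inclD _ _ M 2).
    exact/contr_deg/incl_gdeg.
  suff /pi_eq0/quadratic_low[_] : pi (D i x) = 0.
    by rewrite aE tcomp_incl => ->; rewrite tensor_incl0.
  rewrite DxE piB pi_sum; apply/eqP; rewrite subr_eq0; apply/eqP.
  under eq_bigr => l _ do rewrite piM -c0P -/(A i l).
  (* y is the k-th column of tau; its second block is killed by e (1 - e) = 0. *)
  set y := tau _; rewrite -/(A i k).
  have yE j : A j k = \sum_l A j l * fcoef y (inl l) +
      \sum_l ((if j == l then 1 else 0) - e j l) * fcoef y (inr l).
    rewrite -fcoef_d2 /y d2tau fcoef_d2 [X in _ = _ + X]big1 ?addr0 => [|l _].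
      rewrite (bigD1 k) //= big1 ?addr0 => [|l lk].
        by rewrite fcoef_basis eqxx mulr1.
      by rewrite fcoef_basis (inj_eq (@inl_inj _ _)) (negPf lk) mulr0.
    by rewrite fcoef_basis mulr0.
  rewrite eA; under [LHS]eq_bigr => j _ do rewrite yE mulrDr !mulr_sumr.
  rewrite big_split /= exchange_big /= [X in _ + X]exchange_big /=.
  rewrite [X in _ + X]big1 ?addr0 => [|l _].
    by apply: eq_bigr => l _; rewrite eA mulr_suml; apply: eq_bigr => j _; rewrite mulrA.
  under eq_bigr => j _ do rewrite mulrA mulrBr.
  rewrite -mulr_suml sumrB -ee (bigD1 l) //= eqxx mulr1 big1 ?addr0.
    by rewrite subrr mul0r.
  by move=> j /negPf->; rewrite mulr0.
pose u : F2 := [ffun k => (if k is inl k then pi (b k) else 0) : (kcar B)^c^o].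
have uE : u = \sum_k (pi (b k) : (kcar B)^c) *: basis B delta2 (inl k).
  rewrite [LHS]free_expand big_sumType /= [X in _ + X]big1 ?addr0 => [|j _].
    by apply: eq_bigr => k _; rewrite /fcoef ffunE.
  by rewrite /fcoef ffunE scale0r.
have d2u : d2 u = 0.
  apply: fcoefP => i; rewrite fcoef_d2 fcoef0 [X in _ + X]big1 ?addr0 => [|j _].
    have /pi_eq0 := bQ i; rewrite pi_sum => {2}<-.
    by apply: eq_bigr => k _; rewrite piM /fcoef ffunE.
  by rewrite /fcoef ffunE mulr0.
have /(congr1 (fun f => fcoef f (inl l))) := tau_ker _ d2u.
rewrite fcoef0 uE linear_sum fcoef_sum => tau0.
apply/pi_eq0; rewrite pi_sum -[RHS]tau0.
by apply: eq_bigr => k _; rewrite linearZ fcoefZ c0P piM.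
Qed.

End Syzygies.

(** * The filtration of the deformed ideal *)

Section RelationFiltration.
Variables (K : fieldType) (S : kalgebra K) (M : bimodType S).
Variable R : subbimodule (tensor M M).
Variable theta : {linear subbimod_type R -> S}.
Notation T := (tensor_algebra M).
Notation Q := (gen_ideal (@quadratic_rel K S M R)).
Notation I := (gen_ideal (deformed_rel theta)).
Notation tR r := (@tensor_incl K S M 2 (subbimod_val r)).

Definition def_rel (r : subbimod_type R) : T := tR r - tS M (theta r).

(** [relfil n] is J_n: the part of the ideal of the deformed relations reached by
    products of formal degree at most n, as opposed to elements whose actual
    degree is at most n. *)
Inductive relfil : nat -> T -> Prop :=
| RF0 n : relfil n 0
| RFD n x y : relfil n x -> relfil n y -> relfil n (x + y)
| RFS n x : relfil n x -> relfil n.+1 x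
| RFR n r t : deg_le n t -> relfil n.+2 (def_rel r * t)
| RFM n m x : relfil n x -> relfil n.+1 (tM m * x).

Lemma relfil_sum n J (r : seq J) (F : J -> T) :
  (forall j, relfil n (F j)) -> relfil n (\sum_(j <- r) F j).
Proof. by move=> Fn; apply: big_ind => //; [apply: RF0 | apply: RFD]. Qed.

Lemma relfilW n p x : (n <= p)%N -> relfil n x -> relfil p x.
Proof.
move=> /subnKC <- xn; elim: (p - n)%N => [|k IH]; first by rewrite addn0.
by rewrite addnS; apply: RFS.
Qed.

Lemma relfil0 n x : relfil n x -> n = 0%N -> x = 0.
Proof. by elim=> // {}n {}x y _ IHx _ IHy n0; rewrite IHx // IHy // addr0. Qed.

Lemma relfil_ideal n x : relfil n x -> x \in ideal_pred I.
Proof.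
elim=> {n x} [n|n x y _ xI _ yI|//|n r t _|n m x _ xI].
- exact: ideal0.
- exact: idealD.
- by apply: Defs.idealMr; apply: gen_ideal_gen; exists r.
- exact: Defs.idealMl.
Qed.

Lemma relfil_deg n x : relfil n x -> deg_le n x.
Proof.
elim=> {n x} [//|n x y _ xn _ yn|n x _ xn|n r t tn|n m x _ xn].
- exact: deg_leD.
- exact: deg_leW xn.
- rewrite /def_rel mulrBl; apply: deg_leB; last exact/(deg_leW _ (deg_leS _ tn))/leqW.
  by rewrite -add2n; apply: deg_leMl => //; apply: (@deg_le_incl _ _ M 2).
- exact: deg_leM.
Qed.

(** By [quadratic_lift] conversely, every element of Q of degree n is such a
    component. *)
Lemma relfil_top n x : relfil n x -> tensor_incl (tcomp x n) \in ideal_pred Q.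
Proof.
elim=> {n x} [n|n x y _ xQ _ yQ|n x xn _|n r t tn|n m x _ xQ].
- by rewrite tcomp0 tensor_incl0 ideal0.
- by rewrite tcompD tensor_inclD; apply: idealD.
- by rewrite (relfil_deg xn) // tensor_incl0 ideal0.
- rewrite /def_rel mulrBl tcompB (deg_leS _ tn) ?subr0; last exact: leqW.
  by apply: quadratic_comp; apply: Defs.idealMr; apply: quadratic_gen.
- by rewrite tcomp_MMS -tM_incl; apply: Defs.idealMl.
Qed.

Hypothesis theta_l : forall s r, theta (s *>> r) = s * theta r.
Hypothesis theta_r : forall r s, theta (r <<* s) = theta r * s.

Lemma def_rel_sum J (r : seq J) (F : J -> subbimod_type R) :
  def_rel (\sum_(j <- r) F j) = \sum_(j <- r) def_rel (F j).
Proof.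
rewrite /def_rel linear_sum -[subbimod_val _]/(val _) raddf_sum.
by rewrite (@tensor_incl_sum _ _ M 2) /tS (@tensor_incl_sum _ _ M 0) -sumrB.
Qed.

Lemma def_relZ (k : K) r : def_rel (k *: r) = k *: def_rel r.
Proof.
rewrite /def_rel linearZ tSZ -[subbimod_val _]/(k *: subbimod_val r).
by rewrite (@tensor_inclZ _ _ M 2) scalerBr.
Qed.

Lemma def_rel_l s r : tS M s * def_rel r = def_rel (s *>> r).
Proof.
rewrite /def_rel theta_l tSM mulrBr; congr (_ - _).
exact: (@tS_incl _ _ M s 2).
Qed.

Lemma def_rel_r s r : def_rel r * tS M s = def_rel (r <<* s).
Proof.
rewrite /def_rel theta_r tSM mulrBl; congr (_ - _).
by rewrite -tens_incl_ract.
Qed.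

(** Uses the left linearity of theta: s (r - theta r) is the deformed relation of
    s r, without loss of degree. *)
Lemma relfil_lact n s x : relfil n x -> relfil n (tS M s * x).
Proof.
move=> xn; elim: xn s => {n x} [n|n x y _ IHx _ IHy|n x _ IHx|n r t tn|n m x xn _] s.
- by rewrite mulr0; apply: RF0.
- by rewrite mulrDr; apply: RFD.
- exact: RFS.
- by rewrite mulrA def_rel_l; apply: RFR.
- by rewrite mulrA tS_tM; apply: RFM.
Qed.

Lemma relfilN n x : relfil n x -> relfil n (- x).
Proof.
have -> : - x = tS M (- 1) * x by rewrite tSN mulN1r.
exact: relfil_lact.
Qed.

Lemma ideal_relfil x : x \in ideal_pred I -> exists n, relfil n x.
Proof.
have add (y z : T) : (exists n, relfil n y) -> (exists n, relfil n z) ->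
    exists n, relfil n (y + z).
  move=> [n yn] [p zp]; exists (maxn n p).
  by apply: RFD; [apply: relfilW yn | apply: relfilW zp]; rewrite leq_max leqnn ?orbT.
move: x; apply: gen_ideal_ind => //= [|a _ b [r ->]]; first by exists 0%N; apply: RF0.
rewrite -mulrA; have [p bp] := deg_le_ex b.
elim/tensor_alg_ind: a => [s|a a' IH IH'|m a [n an]].
- by exists p.+2; apply/relfil_lact/RFR.
- by rewrite mulrDl; apply: add.
- by exists n.+1; rewrite -mulrA; apply: RFM.
Qed.

Lemma relfil_def_rel n r t : deg_le n t -> tcomp t n = 0 -> relfil n.+1 (def_rel r * t).
Proof.
case: n => [|n] tn t0; last by apply: RFR; apply: deg_leP tn t0.
suff -> : t = 0 by rewrite mulr0; apply: RF0.
by apply: tcompP => -[|p]; [apply: t0 | apply: tn].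
Qed.

Lemma tcomp_RM (a : tensor M M) (t : T) n :
  tcomp (@tensor_incl K S M 2 a * t) n.+2 = tmul (a : tpow M 2) (tcomp t n).
Proof.
elim/tensor_ind: a => [|m m' a IH].
  by rewrite (@tensor_incl0 _ _ M 2) mul0r (@tmul0l _ _ _ 2).
rewrite (@tensor_inclD _ _ M 2) mulrDl tcompD IH (@tmulDl _ _ _ 2); congr (_ + _).
rewrite -tMM -mulrA !tcomp_MMS.
by rewrite -[tens m m']/(tcons m (m' : tpow M 1)) tmul_cons.
Qed.

Lemma tcomp_def_rel n r (t : T) : deg_le n t ->
  tcomp (def_rel r * t) n.+2 = tmul (subbimod_val r : tpow M 2) (tcomp t n).
Proof.
move=> tn; rewrite /def_rel mulrBl tcompB tcomp_RM tcomp_SM (tn n.+2 (leqnSn _)).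
by rewrite lact0 subr0.
Qed.

Variable db : dual_basis M.
Notation d := (db_size db).
Notation v := (@db_vec _ _ _ db).
Notation phi := (@db_fun _ _ _ db).
Notation D := (partial db).
Variables (N : nat) (rr : 'I_N -> subbimod_type R).
Hypothesis rr_span : forall r, exists c : 'I_N -> K, r = \sum_(k < N) c k *: rr k.

Lemma quadratic_lift n (a : tpow M n) : tensor_incl a \in ideal_pred Q ->
  exists2 x, relfil n x & tcomp x n = a.
Proof.
elim: n a => [|[|n] IH] a aQ.
- by exists 0; [apply: RF0 | have [] := quadratic_low aQ; rewrite tcomp_incl].
- by exists 0; [apply: RF0 | have [_] := quadratic_low aQ; rewrite tcomp_incl].
have [u [q [qQ aE]]] := quadratic_expand db rr_span aQ.
have /choice[j jP] i : exists j, relfil n.+1 j /\ tcomp j n.+1 = tcomp (q i) n.+1.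
  have [j jn jE] := IH (tcomp (q i) n.+1) (quadratic_comp _ (qQ i)).
  by exists j.
exists (\sum_k def_rel (rr k) * tensor_incl (tcomp (u k) n) + \sum_i tM (v i) * j i).
  apply: RFD; apply: relfil_sum => i; first exact/RFR/deg_le_incl.
  exact/RFM/(jP i).1.
rewrite -(tcomp_incl a) aE !tcompD !tcomp_sum; congr (_ + _).
  apply: eq_bigr => k _; rewrite tcomp_RM tcomp_def_rel ?tcomp_incl //.
  exact: deg_le_incl.
by apply: eq_bigr => i _; rewrite !tcomp_MMS (jP i).2.
Qed.

Lemma tM_dual m : tM m = \sum_i tM (v i) * tS M (phi i m).
Proof.
rewrite {1}(db_expand db m) /tM (@tensor_incl_sum _ _ M 1).
by apply: eq_bigr => i _; symmetry; apply: tMS.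
Qed.

(** Everything in J_(n+1) that is not of the two leading forms is in J_n: a factor
    t of degree smaller than n - 1 lowers the formal degree, and words in M
    starting a product can be rewritten with the v_i.  For n = 0 there is no room
    for a relation, whence the case distinction on the t_k. *)
Lemma relfil_normal n x : relfil n.+1 x ->
  exists j (t : 'I_N -> T) (y : 'I_d -> T),
    [/\ relfil n j,
        forall k, if n is n1.+1 then t k \in gdeg T n1 else t k = 0,
        forall i, relfil n (y i)
      & x = j + \sum_k def_rel (rr k) * t k + \sum_i tM (v i) * y i].
Proof.
have gz p : submod_closed (gdeg T p) by case: (gdegP T).
move En1: n.+1 => n1 xn1.
elim: xn1 n En1 => {n1 x} [n1|n1 x x' _ IH _ IH'|n1 x xn _|n1 r t tn|n1 m x xn _] n.
- move=> _; exists 0, (fun=> 0), (fun=> 0); split=> [|k|i|]; try exact: RF0.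
    by case: n => // n; apply: tensor_gdeg0.
  by rewrite !big1 ?addr0 // => i _; rewrite mulr0.
- move=> En; have [j [t [y [jn tn yn ->]]]] := IH n En.
  have [j' [t' [y' [j'n t'n y'n ->]]]] := IH' n En.
  exists (j + j'), (fun k => t k + t' k), (fun i => y i + y' i); split=> [|k|i|].
  + exact: RFD.
  + have := tn k; have := t'n k; case: (n) => [-> ->|p tp t'p]; first by rewrite addr0.
    by have [_ DP] := gz p; rewrite -[t k]scale1r; apply: DP.
  + exact: RFD.
  under [in RHS]eq_bigr => k _ do rewrite mulrDr.
  under [X in _ = _ + X]eq_bigr => k _ do rewrite mulrDr.
  by rewrite !big_split /= addrACA [X in X + _]addrACA.
- case=> ->; exists x, (fun=> 0), (fun=> 0); split=> [//|k|i|]; try exact: RF0.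
    by case: n1 {xn} => // p; apply: tensor_gdeg0.
  by rewrite !big1 ?addr0 // => i _; rewrite mulr0.
- case=> ->; have [c rE] := rr_span r.
  pose t0 := @tensor_incl K S M n1 (tcomp t n1).
  exists (def_rel r * (t - t0)), (fun k => c k *: t0), (fun=> 0).
  split=> [|k|i|].
  + apply: relfil_def_rel; first by apply: deg_leB => //; apply: deg_le_incl.
    by rewrite tcompB tcomp_incl subrr.
  + have [D0 DP] := gz n1; rewrite -[_ *: _]addr0; apply: DP => //.
    exact: incl_gdeg.
  + exact: RF0.
  rewrite [X in _ + X]big1 ?addr0 => [|i _]; last by rewrite mulr0.
  rewrite mulrBr -[LHS](subrK (def_rel r * t0)); congr (_ + _).
  rewrite rE def_rel_sum mulr_suml; apply: eq_bigr => k _.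
  by rewrite def_relZ -kscalerAl kscalerAr.
- case=> ->; exists 0, (fun=> 0), (fun i => tS M (phi i m) * x); split=> [|k|i|].
  + exact: RF0.
  + by case: n1 {xn} => // p; apply: tensor_gdeg0.
  + exact: relfil_lact.
  rewrite big1 ?addr0 ?add0r => [|k _]; last by rewrite mulr0.
  by rewrite tM_dual mulr_suml; apply: eq_bigr => i _; rewrite mulrA.
Qed.

(* The conclusion of [relation_syzygies]. *)
Variable c : 'I_N -> 'I_N -> S.
Hypothesis rr_syz : forall k,
  subbimod_val (rr k) = \sum_l subbimod_val (rr l) <<* c k l.
Hypothesis c_syz : forall b : 'I_N -> T,
  (forall i, \sum_k D i (tR (rr k)) * b k \in ideal_pred Q) ->
  forall l, \sum_k tS M (c k l) * b k \in ideal_pred Q.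

(** Uses the right linearity of theta. *)
Lemma def_rel_c k : def_rel (rr k) = \sum_l def_rel (rr l) * tS M (c k l).
Proof.
have {1}-> : rr k = \sum_l rr l <<* c k l.
  by apply: val_inj; rewrite raddf_sum /= rr_syz.
by rewrite def_rel_sum; apply: eq_bigr => l _; rewrite def_rel_r.
Qed.

(** The strictness of J: the leading terms of a normal form cancel only when its
    relations can be rewritten with coefficients q_l in Q.  As Q is made of
    leading components of J, this rewrites the whole sum in J_n up to terms
    v_i y with y in J_n, for which strictness in lower degree is enough. *)
Lemma relfil_strict n x : relfil n.+1 x -> tcomp x n.+1 = 0 -> relfil n x.
Proof.
elim: n x => [|n IH] x /relfil_normal[j [t [y [jn tn yn xE]]]] x0.
  rewrite xE big1 ?addr0 => [|k _]; last by rewrite tn mulr0.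
  by rewrite big1 ?addr0 // => i _; rewrite (relfil0 (yn i)) // mulr0.
have tE k : t k = tensor_incl (tcomp (t k) n) by apply: tensor_deg_comp.
have top : \sum_k tR (rr k) * t k +
    \sum_i tM (v i) * tensor_incl (tcomp (y i) n.+1) = 0.
  transitivity (@tensor_incl K S M n.+2 (tcomp x n.+2)); last first.
    by rewrite x0 tensor_incl0.
  rewrite xE !tcompD (relfil_deg jn) // add0r tensor_inclD !tcomp_sum.
  rewrite !(@tensor_incl_sum _ _ M n.+2); congr (_ + _); apply: eq_bigr => k _.
    rewrite tE tcomp_def_rel; last exact: deg_le_incl.
    by rewrite tcomp_incl [LHS]tensor_inclM.
  by rewrite tcomp_MMS tM_incl.
pose q l := \sum_k tS M (c k l) * t k.
have qQ l : q l \in ideal_pred Q.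
  apply: c_syz => i; have /(congr1 (D i)) := top.
  rewrite partialD !partial_sum partial0 => /eqP; rewrite addr_eq0 => /eqP Dtop.
  have -> : \sum_k D i (tR (rr k)) * t k = \sum_k D i (tR (rr k) * t k).
    by apply: eq_bigr => k _; rewrite partialR.
  rewrite Dtop; apply: idealN; apply: ideal_sum => l'; rewrite partialM.
  by apply: Defs.idealMl; apply: relfil_top.
have qE l : q l = tensor_incl (tcomp (q l) n).
  rewrite /q tcomp_sum (@tensor_incl_sum _ _ M n); apply: eq_bigr => k _.
  by rewrite tE tS_incl tcomp_incl.
have /choice[z zP] l : exists z, relfil n z /\ tcomp z n = tcomp (q l) n.
  have := qQ l; rewrite qE => /quadratic_lift[z zn zE].
  by exists z; rewrite zE tcomp_incl.
(* With z_l in J_n lifting q_l, the product (r_l - theta r_l) q_l is w_l plus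
   r_l z_l, and r_l z_l = sum_i v_i D_i(r_l) z_l goes with the y_i. *)
pose w l := def_rel (rr l) * (q l - z l) - tS M (theta (rr l)) * z l.
have wn l : relfil n.+1 (w l).
  have [zn zE] := zP l; apply: RFD; last exact/relfilN/RFS/relfil_lact.
  apply: relfil_def_rel; last by rewrite tcompB zE subrr.
  by apply: deg_leB; [rewrite qE; apply: deg_le_incl | apply: relfil_deg].
pose y' i := y i + \sum_l D i (tR (rr l)) * z l.
have y'n i : relfil n.+1 (y' i).
  apply: RFD => //; apply: relfil_sum => l.
  have /tensor_degP[a ->] : D i (tR (rr l)) \in gdeg T 1 by apply/contr_deg/incl_gdeg.
  by apply: RFM; have [] := zP l.
pose x' := \sum_i tM (v i) * y' i.
have x'E : x = j + \sum_l w l + x'.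
  have -> : x' = \sum_i tM (v i) * y i + \sum_l tR (rr l) * z l.
    under [X in _ = _ + X]eq_bigr => l _ do rewrite (partial_expandR db) mulr_suml.
    rewrite exchange_big -big_split; apply: eq_bigr => i _.
    rewrite mulrDr mulr_sumr; congr (_ + _).
    by apply: eq_bigr => l _; rewrite mulrA.
  rewrite xE -!addrA; congr (_ + _); rewrite addrCA [LHS]addrC; congr (_ + _).
  under eq_bigr => k _ do rewrite def_rel_c mulr_suml.
  rewrite exchange_big -big_split; apply: eq_bigr => l _ /=.
  have -> : tR (rr l) * z l = tS M (theta (rr l)) * z l + def_rel (rr l) * z l.
    by rewrite /def_rel mulrBl addrC subrK.
  rewrite /w mulrBr -!addrA addKr addNr addr0.
  by rewrite mulr_sumr; apply: eq_bigr => k _; rewrite mulrA.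
have x'0 : tcomp x' 0 = 0.
  by rewrite tcomp_sum big1 // => i _; apply: tcomp_MM0.
have x'top : tcomp x' n.+2 = 0.
  move: x0; rewrite x'E tcompD tcompD (relfil_deg jn) // add0r.
  by rewrite (relfil_deg (relfil_sum _ wn)) // add0r.
rewrite x'E; apply: RFD; first by apply: RFD => //; apply: relfil_sum.
rewrite (partial_expand0 db x'0); apply: relfil_sum => i; apply/RFM/IH.
  rewrite /x' partial_sum; apply: relfil_sum => k; rewrite partialM.
  exact: relfil_lact.
by rewrite tcomp_contr x'top contr_pow0 //; [apply: db_funD | apply: db_funR].
Qed.

(** Descend from J_p to J_n one step at a time. *)
Lemma deformed_top n x : x \in ideal_pred I -> deg_le n x ->
  tensor_incl (tcomp x n) \in ideal_pred Q.
Proof.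
case/ideal_relfil=> p xp xn; apply: relfil_top.
have [pn|/subnKC] := leqP p n; first exact: relfilW xp.
rewrite addSnnS => np; rewrite -np in xp.
elim: (p - n.+1)%N xp => [|k IH] xp.
  by rewrite addn1 in xp; apply: relfil_strict xp (xn _ _).
apply: IH; rewrite addnS in xp; apply: relfil_strict xp (xn _ _).
by rewrite ltnS addnS leqW // leq_addr.
Qed.

End RelationFiltration.

(** * The symbol map and the theorem *)

(** Two graded quotients of A with the same kernel are isomorphic. *)
Lemma quotients_iso (K : fieldType) (A B C : gralgebra K)
    (p : {linear A -> C}) (q : {linear A -> B}) :
  (forall c, exists x, p x = c) -> (forall b, exists x, q x = b) ->
  {morph p : x y / x * y} -> {morph q : x y / x * y} -> p 1 = 1 -> q 1 = 1 ->
  (forall x, p x = 0 <-> q x = 0) ->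
  (forall n c, c \in gdeg C n <-> exists2 x, x \in gdeg A n & p x = c) ->
  (forall n b, b \in gdeg B n <-> exists2 x, x \in gdeg A n & q x = b) ->
  gralgebra_iso C B.
Proof.
move=> psurj qsurj pM qM p1 q1 ker pdeg qdeg.
have pq x y : p x = p y <-> q x = q y.
  have := ker (x - y); rewrite !linearB => kxy.
  split=> [pxy|qxy]; apply/eqP; rewrite -subr_eq0; apply/eqP; apply/kxy.
    by rewrite pxy subrr.
  by rewrite qxy subrr.
have [r rK] := choice psurj; pose f c := q (r c).
have fp x : f (p x) = q x by apply/pq.
have flin : linear f.
  move=> k c c'; have [x <-] := psurj c; have [x' <-] := psurj c'.
  by rewrite -linearP !fp linearP.
pose fL := GRing.isLinear.Build _ _ _ _ f flin.
pose F : {linear C -> B} := HB.pack f fL.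
have Fp x : F (p x) = q x by apply: fp.
exists F; split=> [|c c'||n c].
- have [s sK] := choice qsurj; exists (fun b => p (s b)) => [c|b].
    by have [x <-] := psurj c; rewrite Fp; apply/pq; rewrite sK.
  by rewrite Fp sK.
- have [x <-] := psurj c; have [x' <-] := psurj c'.
  by rewrite -pM !Fp qM.
- by rewrite -p1 Fp.
- split=> [/qdeg[x xn fx]|/pdeg[x xn <-]]; last by rewrite Fp; apply/qdeg; exists x.
  apply/pdeg; exists x => //.
  by have [y yE] := psurj c; rewrite -yE Fp in fx *; apply/pq.
Qed.

Section SymbolMap.
Variables (K : fieldType) (S : kalgebra K) (M : bimodType S).
Notation T := (tensor_algebra M).
Variable I : ideal T.
Notation F := (natural_filtration I).
Notation G := (gr F).

Lemma incl_fil n (a : tpow M n) : qalg I (tensor_incl a) \in fil F n.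
Proof. exact: natural_fil_deg (incl_gdeg a) (leqnn n). Qed.

(** The class in F_n / F_(n-1) of the image in U of an element of degree n. *)
Definition symbol_piece n (a : tpow M n) : gr_piece F n := gr_class (incl_fil a).

Lemma symbol_pieceD n (a b : tpow M n) :
  symbol_piece (a + b) = symbol_piece a + symbol_piece b.
Proof.
have abF : qalg I (tensor_incl a) + qalg I (tensor_incl b) \in fil F n.
  by rewrite -qalgD -tensor_inclD; apply: incl_fil.
rewrite /symbol_piece (gr_classD _ _ abF); apply: gr_class_eq.
by rewrite tensor_inclD; apply: qalgD.
Qed.

Lemma symbol_pieceZ n (k : K) (a : tpow M n) :
  symbol_piece (k *: a) = k *: symbol_piece a.
Proof.
have abF : k *: qalg I (tensor_incl a) \in fil F n.
  by rewrite -qalgZ -tensor_inclZ; apply: incl_fil.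
rewrite /symbol_piece (gr_classZ _ abF); apply: gr_class_eq.
by rewrite tensor_inclZ; apply: qalgZ.
Qed.

Lemma symbol_piece0 n : symbol_piece (0 : tpow M n) = 0.
Proof. by rewrite -(scale0r (0 : tpow M n)) symbol_pieceZ scale0r. Qed.

Lemma symbol_piece_eq0 n (a : tpow M n) :
  symbol_piece a = 0 <-> qalg I (tensor_incl a) \in fpred F n.
Proof.
rewrite -(symbol_piece0 n) /symbol_piece gr_classP.
by rewrite tensor_incl0 qalg0 subr0.
Qed.

(** Lower components of a representative are in F_(n-1). *)
Lemma symbol_piece_surj n (u : gr_piece F n) : exists a, symbol_piece a = u.
Proof.
elim/gr_ind: u => x xF; have /natural_filP[c [cD xE]] := xF.
exists (tcomp (c n) n); apply/gr_classP; rewrite -tensor_deg_comp //.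
rewrite xE big_nat_recr //= qalgD opprD addrCA subrr addr0.
case: n x xF c cD xE => [|n] x xF c cD xE.
  by rewrite big_nil /= qalg0 oppr0; apply: eqxx.
have [F0 FP] := fil_submod F n.
rewrite -scaleN1r -[_ *: _]addr0; apply: FP => //.
by apply/natural_filP; exists c.
Qed.

Fact symbol_fin (x : T) :
  exists N, forall n, (N <= n)%N -> symbol_piece (tcomp x n) = 0.
Proof.
have [N xN] := deg_le_ex x; exists N.+1 => n Nn.
by rewrite xN // symbol_piece0.
Qed.

Definition symbol (x : T) : G := DSum (symbol_fin x).

Lemma symbol_apply (x : T) n : dval (symbol x : dsum _) n = symbol_piece (tcomp x n).
Proof. by []. Qed.

Lemma symbol_linear : linear symbol.
Proof.
move=> k x y; apply: dsumP => n.
rewrite -[RHS]/(k *: dval (symbol x : dsum _) n + dval (symbol y : dsum _) n).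
by rewrite !symbol_apply tcompD tcompZ symbol_pieceD symbol_pieceZ.
Qed.

HB.instance Definition _ := GRing.isLinear.Build K T G _ symbol symbol_linear.

Lemma symbol_incl n (a : tpow M n) :
  symbol (tensor_incl a) = dincl (symbol_piece a).
Proof.
symmetry; apply: dinclP => [|p np]; first by rewrite symbol_apply tcomp_incl.
by rewrite symbol_apply tcomp_incl_neq // symbol_piece0.
Qed.

Lemma symbol_eq0 x : symbol x = 0 <-> forall n, symbol_piece (tcomp x n) = 0.
Proof.
split=> [x0 n|x0]; first by rewrite -symbol_apply x0.
by apply: dsumP => n; rewrite symbol_apply x0.
Qed.

Lemma symbol_surj g : exists x, symbol x = g.
Proof.
elim/dsum_ind: g => [|n u g [x xg]]; first by exists 0; rewrite linear0.
have [a au] := symbol_piece_surj u; exists (tensor_incl a + x).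
by rewrite linearD /= symbol_incl au xg.
Qed.

Lemma symbol_degP n g :
  g \in gdeg G n <-> exists2 x, x \in gdeg T n & symbol x = g.
Proof.
split=> [/graded_sum_degP[u ->]|[x /tensor_degP[a ->] <-]].
  have [a <-] := symbol_piece_surj u.
  by exists (tensor_incl a); [apply: incl_gdeg | apply: symbol_incl].
by apply/graded_sum_degP; exists (symbol_piece a); apply: symbol_incl.
Qed.

Lemma symbol1 : symbol 1 = 1.
Proof.
rewrite -[1 in LHS]/(@tensor_incl K S M 0 (1 : S)) symbol_incl.
by rewrite -[RHS]/(dincl _); congr dincl; apply: gr_class_eq.
Qed.

Lemma symbolM : {morph symbol : x y / x * y}.
Proof.
have inclM i j (a : tpow M i) (b : tpow M j) :
    symbol (tensor_incl a * tensor_incl b)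
    = symbol (tensor_incl a) * symbol (tensor_incl b).
  rewrite tensor_inclM !symbol_incl.
  rewrite [RHS](gmul_dincl (gr_graded_mul F)) /= /symbol_piece gr_opE.
  congr dincl; apply: gr_class_eq.
  by rewrite -tensor_inclM qalgMr.
move=> x y; have [N ->] := tensor_decomp x; have [N' ->] := tensor_decomp y.
rewrite mulr_suml !linear_sum mulr_suml; apply: eq_bigr => i _.
rewrite mulr_sumr !linear_sum mulr_sumr; apply: eq_bigr => j _; exact: inclM.
Qed.

Lemma deg_le_fil n x : deg_le n x -> qalg I x \in fil F n.
Proof.
move=> xn; apply/natural_filP; exists (fun j => tensor_incl (tcomp x j)).
split=> [j|]; first exact: incl_gdeg.
by congr qalg; apply: dsum_decomp.
Qed.

Lemma fil_deg_le n u : u \in fil F n -> exists2 x, deg_le n x & u = qalg I x.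
Proof.
case/natural_filP=> c [cD ->]; exists (\sum_(0 <= j < n.+1) c j) => //.
move=> p np; rewrite tcomp_sum big_nat big1 // => j /andP[_ jn].
by rewrite (tensor_deg_comp (cD j)) tcomp_incl_neq // neq_ltn (leq_ltn_trans _ np).
Qed.

End SymbolMap.

Section PBWTheorem.
Variables (K : fieldType) (S : kalgebra K) (M : bimodType S).
Variable R : subbimodule (tensor M M).
Variable theta : {linear subbimod_type R -> S}.
Notation T := (tensor_algebra M).
Notation Q := (gen_ideal (@quadratic_rel K S M R)).
Notation I := (gen_ideal (deformed_rel theta)).
Notation B := (quadratic_algebra R).
Notation tR r := (@tensor_incl K S M 2 (subbimod_val r)).

Definition quad_proj (x : T) : B := qalg Q x.

Fact quad_proj_linear : linear quad_proj.
Proof. by move=> k x y; rewrite /quad_proj qalgD qalgZ. Qed.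

HB.instance Definition _ := GRing.isLinear.Build K T B _ quad_proj quad_proj_linear.

Lemma quad_projM : {morph quad_proj : x y / x * y}.
Proof. by move=> x y; apply: qalgMr. Qed.
Lemma quad_proj_surj b : exists x, quad_proj x = b.
Proof. by exists (qalg_repr b); apply: qalg_reprK. Qed.
Lemma quad_proj_eq0 x : quad_proj x = 0 <-> x \in ideal_pred Q.
Proof. exact: qalg_eq0. Qed.
Lemma quad_proj_degP n b :
  b \in gdeg B n <-> exists2 x, x \in gdeg T n & quad_proj x = b.
Proof.
split=> [/quot_degP[x xn ->]|[x xn <-]]; first by exists x.
by apply/quot_degP; exists x.
Qed.

Lemma relations_finite : fin_dim (V := M) predT ->
  exists N (rr : 'I_N -> subbimod_type R),
    forall r, exists c : 'I_N -> K, r = \sum_(k < N) c k *: rr k.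
Proof.
move=> Mfin.
have [N [w [wR wspan]]] := fin_dim_sub (subbimod_closed R) (tensor_fin_dim Mfin Mfin).
exists N, (fun k => SubbimodElt (wR k)) => r.
have [c rE] := wspan _ (subbimod_valP r); exists c.
by apply: val_inj; rewrite raddf_sum.
Qed.

(** The kernel of the symbol map is compared with Q degree by degree.  An element
    a of degree n has zero symbol when it agrees modulo I with an element of lower
    degree, that is when a is the component of degree n of an element of I of
    degree at most n. *)
Lemma deformation_of_top :
  (forall n x, x \in ideal_pred I -> deg_le n x ->
     tensor_incl (tcomp x n) \in ideal_pred Q) ->
  (forall n (a : tpow M n), tensor_incl a \in ideal_pred Q ->
     exists x, [/\ x \in ideal_pred I, deg_le n x & tcomp x n = a]) ->
  pbw_deformation I B.
Proof.
move=> top lift.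
apply: (quotients_iso (p := symbol I) (q := quad_proj)).
- exact: symbol_surj.
- exact: quad_proj_surj.
- exact: symbolM.
- exact: quad_projM.
- exact: symbol1.
- by [].
- move=> x; rewrite quad_proj_eq0 symbol_eq0.
  suff E n (a : tpow M n) : symbol_piece I a = 0 <-> tensor_incl a \in ideal_pred Q.
    split=> [x0|xQ n]; last exact/E/quadratic_comp.
    by apply: quadratic_of_comp => n; apply/E.
  move=> {x}; rewrite symbol_piece_eq0; split=> [aF|aQ].
    case: n a aF => [|n] a aF.
      have /eqP/qalg_eq0/(top 0%N) := aF; rewrite tcomp_incl; apply.
      exact: deg_le_incl.
    have [x xn /qalgP/(top n.+1)] := fil_deg_le aF.
    rewrite tcompB tcomp_incl xn // subr0; apply.
    apply: deg_leB; first exact: deg_le_incl.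
    exact: deg_leW xn.
  have [x [xI xn xa]] := lift _ _ aQ.
  have -> : qalg I (tensor_incl a) = qalg I (tensor_incl a - x).
    by apply/qalgP; rewrite opprD opprK addrA subrr add0r.
  have axn : deg_le n (tensor_incl a - x) by apply: deg_leB => //; apply: deg_le_incl.
  have ax0 : tcomp (tensor_incl a - x) n = 0 by rewrite tcompB tcomp_incl xa subrr.
  case: n a xn xa axn ax0 {aQ} => [|n] a xn xa axn ax0; last first.
    by apply: deg_le_fil; apply: deg_leP.
  have -> : tensor_incl a - x = 0.
    by apply: tcompP => -[|p]; [apply: ax0 | apply: axn].
  by rewrite qalg0; apply: eqxx.
- exact: symbol_degP.
- exact: quad_proj_degP.
Qed.

(** An isomorphism from gr U to B turns the surjection from S to gr_0 U into a
    surjective linear endomorphism of S, which is injective by dimension; scalars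
    in I are in its kernel. *)
Lemma deformation_scalars_inj : fin_dim (V := S) predT -> pbw_deformation I B ->
  forall s, tS M s \in ideal_pred I -> s = 0.
Proof.
move=> Sfin [f [fbij _ _ fdeg]].
have deg0 g : g \in gdeg (gr (natural_filtration I)) 0 ->
    exists s, symbol I (tS M s) = g.
  case/symbol_degP=> x /tensor_degP[s ->] <-; by exists s.
have qS_inj s t : quad_proj (tS M s) = quad_proj (tS M t) -> s = t.
  case/qalgP/quadratic_low => + _; rewrite tcompB !tcomp_incl => /eqP.
  by rewrite subr_eq0 => /eqP.
have fS s : exists t, f (symbol I (tS M s)) = quad_proj (tS M t).
  have /fdeg/quad_proj_degP[x /tensor_degP[t ->] <-] :
      symbol I (tS M s) \in gdeg (gr (natural_filtration I)) 0.
    by apply/symbol_degP; exists (tS M s) => //; apply: (@incl_gdeg _ _ _ 0).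
  by exists t.
have [psi psiP] := choice fS.
have psi_lin : linear psi.
  move=> k s t; apply: qS_inj; rewrite -psiP !tSD !tSZ !linearP /=.
  by rewrite !psiP.
pose psiL := GRing.isLinear.Build _ _ _ _ psi psi_lin.
pose Psi : {linear S -> S} := HB.pack psi psiL.
have Psi_surj t : exists s, Psi s = t.
  have [g fg gf] := fbij.
  have : g (quad_proj (tS M t)) \in gdeg (gr (natural_filtration I)) 0.
    apply/fdeg; rewrite gf; apply/quad_proj_degP.
    by exists (tS M t) => //; apply: (@incl_gdeg _ _ _ 0).
  case/deg0=> s sE; exists s; apply: qS_inj.
  by rewrite -[Psi s]/(psi s) -psiP sE gf.
move=> s sI; apply: (fin_dim_surj_inj Sfin Psi_surj).
apply: qS_inj; rewrite -[Psi s]/(psi s) -psiP.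
rewrite (_ : symbol I _ = 0) ?linear0 ?tSZ.
  by rewrite -[tS M 0]/(@tensor_incl K S M 0 0) tensor_incl0 linear0.
rewrite [LHS](@symbol_incl _ _ _ _ 0); apply/(dinclP _ _) => [|//].
by symmetry; apply/symbol_piece_eq0/eqP/qalg_eq0.
Qed.

End PBWTheorem.

Theorem theoremA (K : fieldType) (S : kalgebra K) (M : bimodType S)
    (R : subbimodule (tensor M M))
    (theta : {linear subbimod_type R -> S}) :
  fin_dim (V := S) predT ->
  fin_dim (V := M) predT ->
  generalized_koszul (quadratic_algebra R) ->
  proj_dim_eq (trivial_module (quadratic_algebra R)) 2 ->
  pbw_deformation (gen_ideal (deformed_rel theta)) (quadratic_algebra R) <->
  bimodule_morphism (N := regular_bimod S) theta.
Proof.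
move=> Sfin Mfin [_ proj _] [pd _]; split=> [pbw|[_ theta_l theta_r]].
  have S_inj := deformation_scalars_inj Sfin pbw.
  have relI r : def_rel theta r \in ideal_pred (gen_ideal (deformed_rel theta)).
    by apply: gen_ideal_gen; exists r.
  have eqS s t : tS M s - tS M t \in ideal_pred (gen_ideal (deformed_rel theta)) -> s = t.
    by rewrite -tSN -tSD => /S_inj/eqP; rewrite subr_eq0 => /eqP.
  split=> [x y|s r|r s]; first exact: linearD.
    apply: eqS; rewrite [X in _ - X]tSM.
    have -> : tS M (theta (s *>> r)) - tS M s * tS M (theta r)
        = tS M s * def_rel theta r - def_rel theta (s *>> r).
      rewrite /def_rel mulrBr (@tS_incl _ _ M s 2) opprB [RHS]addrC.
      by rewrite addrA subrK.
    by apply: idealB => //; apply: Defs.idealMl.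
  apply: eqS; rewrite [X in _ - X]tSM.
  have -> : tS M (theta (r <<* s)) - tS M (theta r) * tS M s
      = def_rel theta r * tS M s - def_rel theta (r <<* s).
    rewrite /def_rel mulrBl -tens_incl_ract opprB [RHS]addrC.
    by rewrite addrA subrK.
  by apply: idealB => //; apply: Defs.idealMr.
have [_ M_proj] := proj 1%N isT.
have [db] := dual_basis_exists Mfin M_proj.
have [N [rr rr_span]] := relations_finite R Mfin.
have [c [rr_syz c_syz]] : exists c : 'I_N -> 'I_N -> S,
    (forall k, subbimod_val (rr k) = \sum_l subbimod_val (rr l) <<* c k l) /\
    forall b : 'I_N -> tensor_algebra M,
      (forall i, \sum_k partial db i (@tensor_incl K S M 2 (subbimod_val (rr k))) * b k
         \in ideal_pred (gen_ideal (@quadratic_rel K S M R))) ->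
      forall l, \sum_k tS M (c k l) * b k
         \in ideal_pred (gen_ideal (@quadratic_rel K S M R)).
  apply: (relation_syzygies (pi := @quad_proj K S M R)) pd => //.
  - exact: linearD.
  - exact: quad_projM.
  - by move=> b; have [x xb] := quad_proj_surj b; exists x.
  - exact: quad_proj_eq0.
  - by move=> n x xn; apply/quad_proj_degP; exists x.
  - by move=> n b /quad_proj_degP[x /tensor_degP[a ->] <-]; exists a.
apply: deformation_of_top => [n x|n a aQ].
  exact: (deformed_top theta_l theta_r rr_span rr_syz c_syz).
have [x xn xa] := quadratic_lift theta db rr_span aQ.
exists x; split=> //; first exact: relfil_ideal xn.
exact: relfil_deg xn.
Qed.
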